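(* Let $f\in\mathcal G^\omega_{**,3/2}(\mathbb R^2_J,\mathbb R^3,C)$. Then the number of right equivalence classes of $f$, $\check f$, $f_*$ and $\check f_*$ is four if and only if $ds^2_f$ has no symmetries.
   Context: $C^\omega$ means real analytic. Let $o=(0,0)$, $\mathbf 0=(0,0,0)$, $l>0$, $J=[-l,l]$, and let $\mathbf c:J\to\mathbb R^3$ be a $C^\omega$ embedding parametrized by arc length with $\mathbf c(0)=\mathbf 0$ and positive curvature; $C=\mathbf c(J)$. A point $p$ is a cuspidal edge point of a $C^\omega$ map $f:U\to\mathbb R^3$ ($U\subset\mathbb R^2$ open) if there are local $C^\omega$ diffeomorphisms $\varphi$ of $\mathbb R^2$ and $\Phi$ of $\mathbb R^3$ with $\varphi(o)=p$, $\Phi(f(p))=\mathbf 0$ and $\Phi\circ f\circ\varphi(u,v)=(u,v^2,v^3)$; a generalized cuspidal edge point if the same holds with $(u,v^2,v^3\alpha(u,v))$ for some $C^\omega$ function $\alpha$. $\mathcal G^\omega(\mathbb R^2_J,\mathbb R^3,C)$ is the set of $C^\omega$ maps $f$ from a neighborhood of $J\times\{0\}$ in the $uv$-plane to $\mathbb R^3$ such that every point of $J\times\{0\}$ is a generalized cuspidal edge point, the $u$-axis is the singular set, and either $f(u,0)=\mathbf c(u)$ for all $u\in J$ or $f(u,0)=\mathbf c(-u)$ for all $u\in J$. Maps agreeing near $J\times\{0\}$ are identified. Cuspidal angle: put $\mathbf c_f(u)=f(u,0)$, with unit principal normal $\mathbf n$, binormal $\mathbf b=\mathbf c_f'\times\mathbf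 n$ and curvature $\kappa(u)$. After a change of parameters fixing $J\times\{0\}$ pointwise, $f(u,v)=\mathbf c_f(u)+\frac{v^2}{2}\xi(u,v)$ with $\xi(u,0)$ linearly independent of $\mathbf c_f'(u)$. The normalized component of $\xi(u,0)$ orthogonal to $\mathbf c_f'(u)$ is independent of choices and is written $\cos\theta(u)\,\mathbf n(u)-\sin\theta(u)\,\mathbf b(u)$; $\theta$ is the cuspidal angle ($C^\omega$, normalized by $\theta(0)\in(-\pi,\pi]$). The singular curvature is $\kappa_s=\kappa\cos\theta$. $\mathcal G^\omega_{**}(\mathbb R^2_J,\mathbb R^3,C)$ (admissible) is the set of $f\in\mathcal G^\omega(\mathbb R^2_J,\mathbb R^3,C)$ with $\max_J|\kappa_s|<\min_J\kappa$; $\mathcal G^\omega_{**,3/2}(\mathbb R^2_J,\mathbb R^3,C)$ is the subset of those all of whose points on $J\times\{0\}$ are cuspidal edge points. $ds^2_f$ is the first fundamental form of $f$. For $f\in\mathcal G^\omega_{**}(\mathbb R^2_J,\mathbb R^3,C)$ with cuspidal angle $\theta$ (then $\sin\theta\ne0$): the isometric dual $\check f$ is the unique element of $\mathcal G^\omega_{**}(\mathbb R^2_J,\mathbb R^3,C)$ with $ds^2_{\check f}=ds^2_f$, $\check f(u,0)=f(u,0)$ and cuspidal angle $-\theta$; the inverse $f_*$ is the unique element with $ds^2_{f_*}=ds^2_f$, $f_*(u,0)=f(-u,0)$ and cuspidal angle $\theta_*$ (with respect to the oriented curve $u\mapsto f_*(u,0)$) satisfying $\cos\theta_*(u)=\kappa_s(u)/\kappa(-u)$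 and $\theta_*(u)\theta(u)>0$, angles being taken in $(-\pi,0)\cup(0,\pi)$; the inverse dual $\check f_*$ is the isometric dual of $f_*$. Diffeomorphisms considered are between neighborhoods of $J\times\{0\}$ and preserve $J\times\{0\}$; they are identified when they agree near $J\times\{0\}$. Two maps $f,g$ are right equivalent if $g=f\circ\varphi$ for such a $\varphi$. A symmetry of $ds^2_f$ is such a ($C^\omega$) diffeomorphism $\varphi$, not the identity, with $\varphi^*ds^2_f=ds^2_f$. *)

(* Defs.v *)
From HB Require Import structures.
From mathcomp Require Import all_boot all_order all_algebra.
From mathcomp Require Import all_classical all_reals all_analysis.

Set Implicit Arguments.
Unset Strict Implicit.
Unset Printing Implicit Defensive.

Import Order.TTheory GRing.Theory Num.Theory.
Import numFieldNormedType.Exports.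

Local Open Scope classical_set_scope.
Local Open Scope ring_scope.

Section RealAnalytic.
Context {R : realType}.
Implicit Types n m : nat.

Definition multi_monomial n (x : 'rV[R]_n) (k : {ffun 'I_n -> nat}) : R :=
  \prod_i x 0 i ^+ k i.

(* [f] is the sum of an absolutely convergent power series on a polydisc
   centred at [p]; the value of the multiple series is taken as the limit of its
   partial sums over the boxes {0, ..., N-1}^n. *)
Definition analytic_at n (f : 'rV[R]_n -> R) (p : 'rV[R]_n) : Prop :=
  exists (a : {ffun 'I_n -> nat} -> R) (r : R), 0 < r /\
    forall x : 'rV[R]_n, (forall i, `|(x - p) 0 i| < r) ->
      summable [set: {ffun 'I_n -> nat}]
        (fun k => (a k * multi_monomial (x - p) k)%:E) /\
      (fun N : nat => \sum_(k : {ffun 'I_n -> 'I_N})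
         a [ffun i => val (k i)] *
         multi_monomial (x - p) [ffun i => val (k i)]) @ \oo --> f x.

Definition map_analytic_at n m (f : 'rV[R]_n -> 'rV[R]_m) (p : 'rV[R]_n) : Prop :=
  forall j : 'I_m, analytic_at (fun x => f x 0 j) p.

Definition fun_analytic_at (h : R -> R) (t : R) : Prop :=
  analytic_at (fun x : 'rV[R]_1 => h (x 0 0)) (const_mx t).

Definition curve_analytic_at m (c : R -> 'rV[R]_m) (t : R) : Prop :=
  map_analytic_at (fun x : 'rV[R]_1 => c (x 0 0)) (const_mx t).

Definition local_diffeo_at n (phi : 'rV[R]_n -> 'rV[R]_n) (p : 'rV[R]_n) : Prop :=
  map_analytic_at phi p /\
  exists psi : 'rV[R]_n -> 'rV[R]_n,
    [/\ map_analytic_at psi (phi p),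
        (\forall x \near p, psi (phi x) = x) &
        (\forall y \near phi p, phi (psi y) = y)].

End RealAnalytic.

Section Euclidean3.
Context {R : realType}.

Definition pt2 (u v : R) : 'rV[R]_2 := \row_i [:: u; v]`_i.
Definition pt3 (x y z : R) : 'rV[R]_3 := \row_i [:: x; y; z]`_i.

Definition dot3 (x y : 'rV[R]_3) : R := \sum_i x 0 i * y 0 i.

(* The library norm on row vectors is the sup norm. *)
Definition enorm3 (x : 'rV[R]_3) : R := Num.sqrt (dot3 x x).

Definition cross3 (x y : 'rV[R]_3) : 'rV[R]_3 :=
  let a (i : 'I_3) := x 0 i in let b (i : 'I_3) := y 0 i in
  pt3 (a 1 * b 2 - a 2 * b 1) (a 2 * b 0 - a 0 * b 2) (a 0 * b 1 - a 1 * b 0).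

(* The next three notions are for curves parametrized by arc length. *)
Definition curvature (g : R -> 'rV[R]_3) (u : R) : R := enorm3 (derive1 (derive1 g) u).

Definition principal_normal (g : R -> 'rV[R]_3) (u : R) : 'rV[R]_3 :=
  (curvature g u)^-1 *: derive1 (derive1 g) u.

Definition binormal (g : R -> 'rV[R]_3) (u : R) : 'rV[R]_3 :=
  cross3 (derive1 g u) (principal_normal g u).

(* Since J = [-l, l] is compact, an injective immersion of J is an embedding. *)
Definition arclength_embedding (l : R) (c : R -> 'rV[R]_3) : Prop :=
  [/\ (forall u, u \in `[- l, l] -> curve_analytic_at c u),
      {in `[- l, l] &, injective c},
      (forall u, u \in `[- l, l] -> enorm3 (derive1 c u) = 1),
      c 0 = 0 &
      (forall u, u \in `[- l, l] -> 0 < curvature c u)].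

End Euclidean3.

Section GeneralizedCuspidalEdges.
Context {R : realType}.
Implicit Types (l : R) (c : R -> 'rV[R]_3) (f g h : 'rV[R]_2 -> 'rV[R]_3).
Implicit Types (phi : 'rV[R]_2 -> 'rV[R]_2) (theta : R -> R).

Definition Jseg l : set 'rV[R]_2 := [set pt2 u 0 | u in `[- l, l]].

Definition Jnear l : set_system 'rV[R]_2 := set_nbhs (Jseg l).

(* Map germs along J x {0} are represented by total functions, and compared by
   [germ_eq]; values away from J x {0} are irrelevant. *)
Definition germ_eq (T : Type) l (f g : 'rV[R]_2 -> T) : Prop :=
  \forall q \near Jnear l, f q = g q.

Definition equivalent_at f (p : 'rV[R]_2) (model : 'rV[R]_2 -> 'rV[R]_3) : Prop :=
  exists (phi : 'rV[R]_2 -> 'rV[R]_2) (Phi : 'rV[R]_3 -> 'rV[R]_3),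
    [/\ local_diffeo_at phi 0, local_diffeo_at Phi (f p),
        phi 0 = p, Phi (f p) = 0 &
        \forall q \near (0 : 'rV[R]_2), Phi (f (phi q)) = model q].

Definition cuspidal_edge_point f (p : 'rV[R]_2) : Prop :=
  equivalent_at f p
    (fun q => let u := q 0 0 in let v := q 0 1 in pt3 u (v ^+ 2) (v ^+ 3)).

Definition generalized_cuspidal_edge_point f (p : 'rV[R]_2) : Prop :=
  exists2 alpha : 'rV[R]_2 -> R, analytic_at alpha 0 &
    equivalent_at f p
      (fun q => let u := q 0 0 in let v := q 0 1 in
                pt3 u (v ^+ 2) (v ^+ 3 * alpha q)).

Definition singular_point f (p : 'rV[R]_2) : Prop := (\rank ('J f p) < 2)%N.

Definition Gomega l c f : Prop :=
  [/\ exists U : set 'rV[R]_2,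
        [/\ open U, Jseg l `<=` U,
            (forall p, U p -> map_analytic_at f p) &
            (forall p, U p -> (singular_point f p <-> p 0 1 = 0))],
      (forall p, Jseg l p -> generalized_cuspidal_edge_point f p) &
      (forall u, u \in `[- l, l] -> f (pt2 u 0) = c u) \/
      (forall u, u \in `[- l, l] -> f (pt2 u 0) = c (- u))].

(* [psi] is the inverse of [phi] : U -> V, up to its values off V. *)
Definition Jdiffeo l phi : Prop :=
  exists (U V : set 'rV[R]_2) (psi : 'rV[R]_2 -> 'rV[R]_2),
    [/\ [/\ open U, open V, Jseg l `<=` U & Jseg l `<=` V],
        set_bij U V phi,
        (forall p, U p -> map_analytic_at phi p /\ psi (phi p) = p),
        (forall q, V q -> map_analytic_at psi q) &
        phi @` Jseg l = Jseg l].

Definition axis_curve f : R -> 'rV[R]_3 := fun u => f (pt2 u 0).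

(* [theta] is the cuspidal angle of [f]; only its values on J matter. *)
Definition cuspidal_angle l f theta : Prop :=
  [/\ (forall u, u \in `[- l, l] -> fun_analytic_at theta u),
      - pi < theta 0 <= pi &
      exists (phi : 'rV[R]_2 -> 'rV[R]_2) (xi : 'rV[R]_2 -> 'rV[R]_3),
        [/\ Jdiffeo l phi /\
              (forall u, u \in `[- l, l] -> phi (pt2 u 0) = pt2 u 0),
            (forall p, Jseg l p -> map_analytic_at xi p),
            (\forall q \near Jnear l,
               f (phi q) = axis_curve f (q 0 0) + (q 0 1 ^+ 2 / 2) *: xi q) &
            forall u, u \in `[- l, l] ->
              let tau := derive1 (axis_curve f) u in
              let x := xi (pt2 u 0) in
              let xperp := x - dot3 x tau *: tau in
              row_free (col_mx tau x) /\
              (enorm3 xperp)^-1 *: xperp =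
                cos (theta u) *: principal_normal (axis_curve f) u
                - sin (theta u) *: binormal (axis_curve f) u]].

Definition singular_curvature f theta (u : R) : R :=
  curvature (axis_curve f) u * cos (theta u).

(* The maximum and the minimum over J are written with [sup] and [inf]. *)
Definition Gadmissible l c f : Prop :=
  Gomega l c f /\
  exists2 theta, cuspidal_angle l f theta &
    sup [set `|singular_curvature f theta u| | u in `[- l, l]] <
    inf [set curvature (axis_curve f) u | u in `[- l, l]].

Definition Gadmissible32 l c f : Prop :=
  Gadmissible l c f /\ forall p, Jseg l p -> cuspidal_edge_point f p.

(* Gram matrix (E F; F G). With row vectors, the rows of ['J f q] are f_u, f_v. *)
Definition first_fundamental_form f (q : 'rV[R]_2) : 'M[R]_2 :=
  'J f q *m ('J f q)^T.

(* A quadratic form on the tangent planes is given by its field of Gram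
   matrices. *)
Definition pullback_form phi (w : 'rV[R]_2 -> 'M[R]_2) (q : 'rV[R]_2) : 'M[R]_2 :=
  'J phi q *m w (phi q) *m ('J phi q)^T.

Definition same_first_fundamental_form l f g : Prop :=
  germ_eq l (first_fundamental_form f) (first_fundamental_form g).

(* [g] represents "the unique element satisfying [P]". *)
Definition the_unique_germ l (P : ('rV[R]_2 -> 'rV[R]_3) -> Prop) g : Prop :=
  P g /\ forall h, P h -> germ_eq l h g.

Definition isometric_dual l c f : ('rV[R]_2 -> 'rV[R]_3) -> Prop :=
  the_unique_germ l (fun g =>
    [/\ Gadmissible l c g,
        same_first_fundamental_form l g f,
        (forall u, u \in `[- l, l] -> g (pt2 u 0) = f (pt2 u 0)) &
        exists2 theta, cuspidal_angle l f theta &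
          cuspidal_angle l g (fun u => - theta u)]).

Definition inverse_map l c f : ('rV[R]_2 -> 'rV[R]_3) -> Prop :=
  the_unique_germ l (fun g =>
    [/\ Gadmissible l c g,
        same_first_fundamental_form l g f,
        (forall u, u \in `[- l, l] -> g (pt2 u 0) = f (pt2 (- u) 0)) &
        exists theta theta' : R -> R,
          [/\ cuspidal_angle l f theta,
              cuspidal_angle l g theta' &
              forall u, u \in `[- l, l] ->
                [/\ 0 < `|theta u| < pi,
                    0 < `|theta' u| < pi,
                    cos (theta' u) =
                      singular_curvature f theta u /
                      curvature (axis_curve f) (- u) &
                    0 < theta' u * theta u]]]).

Definition right_equivalent l f g : Prop :=
  exists2 phi, Jdiffeo l phi & germ_eq l g (f \o phi).

Definition right_class l f : set ('rV[R]_2 -> 'rV[R]_3) :=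
  [set g | right_equivalent l f g].

Definition form_symmetry l f phi : Prop :=
  [/\ Jdiffeo l phi, ~ germ_eq l phi id &
      germ_eq l (pullback_form phi (first_fundamental_form f))
                (first_fundamental_form f)].

End GeneralizedCuspidalEdges.

(* Main.v *)
Require Import Defs.
From HB Require Import structures.
From mathcomp Require Import all_boot all_order all_algebra.
From mathcomp Require Import finmap.
From mathcomp Require Import all_classical all_reals all_analysis.
From mathcomp Require Import ring lra.

Set Implicit Arguments.
Unset Strict Implicit.
Unset Printing Implicit Defensive.

Import Order.TTheory GRing.Theory Num.Theory.
Import numFieldNormedType.Exports.

Local Open Scope classical_set_scope.
Local Open Scope ring_scope.

(** The four maps have the same first fundamental form, and everything is decided
    by the isometries of that form.

    Suppose that two of the maps are right equivalent, h = g o phi. Then phi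
    preserves the common form ([equivalence_isometry], [isometry_transfer]). If
    the form has no symmetries, phi is the identity and g = h as germs. But the
    four germs are different: a map and its dual have opposite cuspidal angles
    with nonzero sine ([opposite_angles_distinct]), and f and its dual run along
    the curve in the direction opposite to that of the other two
    ([opposite_axes_distinct]). So there are four classes.

    Conversely let phi be a symmetry. It preserves arc length on the axis, hence
    acts there as u -> u or as u -> -u ([isometry_axis]).

    If it reverses the axis, then f o phi has the form and the axis of the inverse.
    The singular curvature is determined by the form
    ([singular_curvature_reversed]), so the cuspidal angle of f o phi is opposite to
    that of the inverse, and by uniqueness f o phi is the inverse dual
    ([reversed_inverse_dual]). At most three classes remain.

    If it fixes the axis, then uniqueness of the dual g gives g o phi = g
    ([dual_invariant]). In a normal chart (u, v^2, v^3 alpha) of g the map phi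
    preserves u and v^2, so near each point of the axis it is the identity or the
    flip v -> -v ([normal_chart_symmetry]). In the second case the coefficients
    f_u . f_u and f_v . f_v are even in v and f_u . f_v is odd; differentiating
    these parities shows that f_vvv is orthogonal to f_u, f_uu and f_vv on the
    axis ([vflip_invariant_cubic]). These three vectors span the space, because
    the sine of the cuspidal angle is not zero, so f_vvv = 0, against the
    assumption that f has cuspidal edges ([flip_not_isometry]). Hence phi is the
    identity near J x {0} ([isometry_rigid]), and a symmetry of this kind does not
    exist.

    The analytic facts behind these computations (composition, termwise
    differentiation, symmetry of second derivatives, the identity theorem along
    the axis) come from power series in several variables, treated as elements of
    the weighted l^1 algebra of a polydisc by means of unordered sums. The
    comparison of coordinates along the axis rests on [chart_second_order]: in
    coordinates where the transverse direction is singular, the second derivatives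
    of the map determine the direction of the edge. *)

(** * Unordered sums *)

Section UnorderedSums.

(** The filter of large finite sets of indices; convergence along it is
    unconditional summation. *)
Definition fset_oo {I : choiceType} : set_system {fset I} :=
  filter_from setT (fun A : {fset I} => [set B : {fset I} | (A `<=` B)%fset]).

#[global] Instance fset_oo_filter {I : choiceType} : ProperFilter (@fset_oo I).
Proof.
apply: filter_from_proper; last by move=> A _; exists A; rewrite /= fsubset_refl.
apply: filter_fromT_filter; first by exists fset0.
by move=> A B /=; exists (A `|` B)%fset => P /=; rewrite fsubUset => /andP[].
Qed.

Lemma fset_oo_ge {I : choiceType} (A : {fset I}) :
  \forall B \near fset_oo, (A `<=` B)%fset.
Proof. by exists A. Qed.

Context {R : realType}.

Definition has_sum {I : choiceType} (f : I -> R) (s : R) : Prop :=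
  (fun A : {fset I} => \sum_(i <- A) f i) @ @fset_oo I --> s.

Definition abs_bounded {I : choiceType} (f : I -> R) (M : R) : Prop :=
  forall A : {fset I}, \sum_(i <- A) `|f i| <= M.

Implicit Types I J : choiceType.

Lemma sum_imfset I J (h : I -> J) (f : J -> R) (A : {fset I}) :
  {in A &, injective h} ->
  \sum_(j <- [fset h i | i in A]%fset) f j = \sum_(i <- A) f (h i).
Proof. by move=> hI; rewrite big_imfset. Qed.

Lemma big_fsetX I J (F : I * J -> R) (A : {fset I}) (B : {fset J}) :
  \sum_(x <- (A `*` B)%fset) F x = \sum_(i <- A) \sum_(j <- B) F (i, j).
Proof.
rewrite (partition_big_imfset _ (fun x => x.1)) /=.
set A' := imfset _ _ _.
have A'A : (A' `<=` A)%fset.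
  by apply/fsubsetP => i /imfsetP[[a b] /=]; rewrite ?inE/= => /andP[aA _] ->.
rewrite (big_fset_incl _ A'A); last first.
  move=> i iA iA'; rewrite big_fset_condE big1_fset// => -[a b].
  rewrite ?inE /= => /andP[/andP[aA bB] /eqP ai]; case/negP: iA'; apply/imfsetP.
  by exists (a, b) => //=; rewrite ?inE ?aA ?bB.
rewrite big_seq [RHS]big_seq; apply: eq_bigr => i iA.
rewrite big_fset_condE.
have -> : [fset x in (A `*` B)%fset | x.1 == i]%fset = [fset (i, j) | j in B]%fset.
  apply/fsetP => -[a b]; rewrite ?inE/=; apply/idP/imfsetP => [/andP[/andP[aA bB]] /eqP ->|].
    by exists b.
  by move=> [j /= jB [-> ->]]; rewrite iA jB eqxx.
by rewrite sum_imfset// => x y _ _ [].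
Qed.

Lemma has_sum_unique I (f : I -> R) s t : has_sum f s -> has_sum f t -> s = t.
Proof. by move=> fs ft; apply: (cvg_unique _ fs ft). Qed.

Lemma eq_has_sum I (f g : I -> R) s : f =1 g -> has_sum f s -> has_sum g s.
Proof. by move=> /funext ->. Qed.

Lemma has_sumD I (f g : I -> R) s t :
  has_sum f s -> has_sum g t -> has_sum (fun i => f i + g i) (s + t).
Proof.
move=> fs gt; rewrite /has_sum.
under eq_cvg do rewrite big_split.
exact: cvgD.
Qed.

Lemma has_sumZ I (f : I -> R) c s :
  has_sum f s -> has_sum (fun i => c * f i) (c * s).
Proof.
move=> fs; rewrite /has_sum.
under eq_cvg do rewrite -mulr_sumr.
exact: cvgM (cvg_cst _) fs.
Qed.

Lemma has_sumB I (f g : I -> R) s t :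
  has_sum f s -> has_sum g t -> has_sum (fun i => f i - g i) (s - t).
Proof.
move=> fs /(has_sumZ (c := -1)) gt; have := has_sumD fs gt.
by rewrite mulN1r; apply: eq_has_sum => i; rewrite mulN1r.
Qed.

Lemma has_sum_fset I (f : I -> R) (A : {fset I}) :
  (forall i, i \notin A -> f i = 0) -> has_sum f (\sum_(i <- A) f i).
Proof.
move=> f0; apply/cvgrPdist_lt => /= e e0; exists A => // B /= AB.
rewrite (big_fset_incl _ AB) ?subrr ?normr0// => i _ iA; exact: f0.
Qed.

Lemma has_sum_single I (f : I -> R) i0 :
  (forall i, i != i0 -> f i = 0) -> has_sum f (f i0).
Proof.
move=> f0; rewrite -[f i0](big_seq_fset1 (@GRing.add R)).
by apply: has_sum_fset => i; rewrite inE; exact: f0.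
Qed.

Lemma has_sum_sum I (T : Type) (r : seq T) (f : T -> I -> R) (s : T -> R) :
  (forall x, has_sum (f x) (s x)) ->
  has_sum (fun i => \sum_(x <- r) f x i) (\sum_(x <- r) s x).
Proof.
move=> fs; elim: r => [|x r IH].
  under eq_fun do rewrite big_nil; rewrite big_nil.
  by have := @has_sum_fset I (fun=> 0) fset0 (fun _ _ => erefl); rewrite big_seq_fset0.
rewrite big_cons; apply: eq_has_sum (has_sumD (fs x) IH) => i.
by rewrite big_cons.
Qed.

Lemma has_sum_norm_le I (f : I -> R) s M :
  has_sum f s -> abs_bounded f M -> `|s| <= M.
Proof.
move=> fs fM.
have h : (fun A : {fset I} => `|\sum_(i <- A) f i|) @ @fset_oo I --> `|s| by exact: cvg_norm.
apply: (closed_cvg (fun x => x <= M) (@closed_le _ M) _ _ h).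
by apply: nearW => A /=; rewrite (le_trans _ (fM A))//; exact: ler_norm_sum.
Qed.

Lemma has_sum_le_norm I (f : I -> R) s (A : {fset I}) :
  has_sum (fun i => `|f i|) s -> \sum_(i <- A) `|f i| <= s.
Proof.
move=> fs; apply: (closed_cvg (fun x => \sum_(i <- A) `|f i| <= x) (@closed_ge _ _) _ _ fs).
have := fset_oo_ge A; apply: filterS => B AB.
rewrite [leRHS](big_fsetID _ (mem A))/=.
have -> : [fset x in B | x \in A]%fset = A.
  apply/fsetP => x; rewrite ?inE; apply/andP/idP => [[]//|xA]; split => //.
  exact: (fsubsetP AB).
by rewrite lerDl sumr_ge0.
Qed.

Lemma abs_bounded_ge0 I (f : I -> R) M : abs_bounded f M -> 0 <= M.
Proof. by move=> /(_ fset0); rewrite big_seq_fset0. Qed.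

Lemma abs_bounded_le I (f g : I -> R) M :
  (forall i, `|f i| <= `|g i|) -> abs_bounded g M -> abs_bounded f M.
Proof. by move=> fg gM A; apply: le_trans _ (gM A); apply: ler_sum. Qed.

Lemma abs_boundedD I (f g : I -> R) M N :
  abs_bounded f M -> abs_bounded g N -> abs_bounded (fun i => f i + g i) (M + N).
Proof.
move=> fM gN A; apply: le_trans _ (lerD (fM A) (gN A)).
by rewrite -big_split; apply: ler_sum => i _; exact: ler_normD.
Qed.

Lemma abs_boundedZ I (f : I -> R) c M :
  abs_bounded f M -> abs_bounded (fun i => c * f i) (`|c| * M).
Proof.
move=> fM A; under eq_bigr do rewrite normrM.
by rewrite -mulr_sumr ler_wpM2l.
Qed.

Lemma abs_bounded_single I (f : I -> R) i0 :
  (forall i, i != i0 -> f i = 0) -> abs_bounded f `|f i0|.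
Proof.
move=> f0 A; have [iA|iA] := boolP (i0 \in A).
  rewrite (big_fsetD1 i0)//= big1_fset ?addr0// => i.
  by rewrite ?inE => /andP[/f0 -> _]; rewrite normr0.
rewrite big1_fset// => i iA' _; rewrite f0 ?normr0//.
by apply: contra iA => /eqP <-.
Qed.

Let has_sum_ge0_ex I (f : I -> R) M :
  (forall i, 0 <= f i) -> abs_bounded f M -> exists s, has_sum f s.
Proof.
move=> f0 fM; pose E := [set \sum_(i <- A) f i | A in [set: {fset I}]].
have ubE : ubound E M.
  by move=> _ [A _ <-]; apply: le_trans _ (fM A); apply: ler_sum => i _; rewrite ler_norm.
have supE : has_sup E by split; [exists (\sum_(i <- fset0) f i); exists fset0|exists M].
exists (sup E); apply/cvgrPdist_lt => /= e e0.
have [_ [A _ <-] sA] := sup_adherent e0 supE.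
exists A => // B /= AB.
have hB : \sum_(i <- B) f i <= sup E by apply: ub_le_sup; [exists M|exists B].
rewrite ger0_norm ?subr_ge0//.
have : \sum_(i <- A) f i <= \sum_(i <- B) f i.
  rewrite [leRHS](big_fsetID _ (mem A))/=.
  have -> : [fset x in B | x \in A]%fset = A.
    apply/fsetP => x; rewrite ?inE; apply/andP/idP => [[]//|xA]; split => //.
    exact: (fsubsetP AB).
  by rewrite lerDl sumr_ge0.
lra.
Qed.

(** Absolute boundedness is summability: a family of reals is the difference of
    two families of nonnegative ones, and those are summed by a supremum. *)
Lemma has_sum_ex I (f : I -> R) M : abs_bounded f M -> exists s, has_sum f s.
Proof.
move=> fM.
have [s hs] : exists s, has_sum (fun i => `|f i|) s.
  by apply: (@has_sum_ge0_ex _ _ M) => // A; under eq_bigr do rewrite normr_id.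
have [t ht] : exists t, has_sum (fun i => `|f i| + f i) t.
  apply: (@has_sum_ge0_ex _ _ (M + M)) => [i|].
    by have := ler_norm (- f i); rewrite normrN; lra.
  apply: abs_boundedD => // A; under eq_bigr do rewrite normr_id; exact: fM.
exists (t - s); apply: eq_has_sum (has_sumB ht hs) => i; ring.
Qed.

Lemma abs_bounded_pair I J (F : I * J -> R) (m : I -> R) M :
  (forall i, abs_bounded (fun j => F (i, j)) (m i)) -> abs_bounded m M ->
  abs_bounded F M.
Proof.
move=> Fm mM A.
pose A1 : {fset I} := [fset x.1 | x in A]%fset; pose A2 : {fset J} := [fset x.2 | x in A]%fset.
apply: le_trans _ (mM A1).
have -> : \sum_(x <- A) `|F x| =
    \sum_(i <- A1) \sum_(x <- A | x.1 == i) `|F x| by exact: partition_big_imfset.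
apply: ler_sum => i _; apply: le_trans _ (ler_norm _).
apply: le_trans _ (Fm i A2).
rewrite big_fset_condE.
have -> : \sum_(x <- [fset x in A | x.1 == i]%fset) `|F x| =
    \sum_(j <- [fset x.2 | x in [fset x in A | x.1 == i]]%fset) `|F (i, j)|.
  rewrite sum_imfset; last first.
    move=> [a b] [c d]; rewrite !inE/= => /andP[_ /eqP ->] /andP[_ /eqP ->].
    by move=> ->.
  rewrite big_seq [RHS]big_seq; apply: eq_bigr => -[a b]/=.
  by rewrite !inE/= => /andP[_ /eqP ->].
set B := [fset x.2 | x in _]%fset.
have BA2 : (B `<=` A2)%fset.
  apply/fsubsetP => j /imfsetP[x /=]; rewrite ?inE => /andP[xA _] ->.
  by apply/imfsetP; exists x.
rewrite [leRHS](big_fsetID _ (mem B))/=.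
have -> : [fset x in A2 | x \in B]%fset = B.
  apply/fsetP => x; rewrite ?inE; apply/andP/idP => [[]//|xA]; split => //.
  exact: (fsubsetP BA2).
by rewrite lerDl sumr_ge0.
Qed.

Lemma abs_boundedM I J (f : I -> R) (g : J -> R) M N :
  abs_bounded f M -> abs_bounded g N ->
  abs_bounded (fun x : I * J => f x.1 * g x.2) (M * N).
Proof.
move=> fM gN; have N0 := abs_bounded_ge0 gN.
apply: (@abs_bounded_pair _ _ _ (fun i => N * `|f i|)) => [i A|] /=.
  under eq_bigr do rewrite normrM.
  by rewrite -mulr_sumr mulrC ler_wpM2r.
rewrite mulrC -[X in X * M]ger0_norm//; apply: abs_boundedZ => A.
by under eq_bigr do rewrite normr_id; exact: fM.
Qed.

Lemma abs_bounded_inj I J (f : I -> R) (h : J -> I) M :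
  injective h -> abs_bounded f M -> abs_bounded (fun j => f (h j)) M.
Proof.
move=> hI fM A; apply: le_trans _ (fM [fset h x | x in A]%fset).
by rewrite sum_imfset// => x y _ _; exact: hI.
Qed.

Lemma has_sum_inj I J (f : I -> R) (h : J -> I) s :
  injective h -> (forall i, (forall j, h j != i) -> f i = 0) ->
  has_sum f s -> has_sum (fun j => f (h j)) s.
Proof.
move=> hI f0 fs; apply/cvgrPdist_lt => /= e e0.
have /cvgrPdist_lt/(_ e e0)[A _ Ae] := fs.
pose B := fset_set (h @^-1` [set` A]).
have fB : finite_set (h @^-1` [set` A]).
  by apply: finite_preimage; [move=> x y _ _; exact: hI|exact: finite_fset].
exists B => // C /= BC.
have -> : \sum_(j <- C) f (h j) = \sum_(i <- (A `|` [fset h j | j in C])%fset) f i.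
  rewrite -(sum_imfset (h := h)); last by move=> x y _ _; exact: hI.
  apply: big_fset_incl; first exact: fsubsetUr.
  move=> i; rewrite inE => /orP[iA|->]//.
  move=> ihC; apply: f0 => j; apply/negP => /eqP ji.
  move/negP: ihC; apply; rewrite -ji; apply/imfsetP; exists j => //=.
  apply: (fsubsetP BC); rewrite in_fset_set// inE /= ji; exact: iA.
by apply: Ae => /=; exact: fsubsetUl.
Qed.

Lemma abs_bounded_row I J (F : I * J -> R) M i :
  abs_bounded F M -> abs_bounded (fun j => F (i, j)) M.
Proof. by apply: (@abs_bounded_inj _ _ F (fun j => (i, j))) => x y []. Qed.

Lemma abs_bounded_sums I J (F : I * J -> R) M (r : I -> R) :
  abs_bounded F M -> (forall i, has_sum (fun j => F (i, j)) (r i)) ->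
  abs_bounded r M.
Proof.
move=> FM Fr A.
have FnM : abs_bounded (fun x => `|F x|) M.
  by move=> B; under eq_bigr do rewrite normr_id; exact: FM.
have /choice[q Fq] : forall i, exists s, has_sum (fun j => `|F (i, j)|) s.
  by move=> i; apply: has_sum_ex (abs_bounded_row i FnM).
apply: (@le_trans _ _ (\sum_(i <- A) q i)).
  by apply: ler_sum => i _; apply: has_sum_norm_le (Fr i) _ => B; exact: has_sum_le_norm.
apply: le_trans (ler_norm _) _.
have Aq := has_sum_sum (r := A) Fq; apply: has_sum_norm_le Aq _ => B.
rewrite (eq_bigr (fun j => \sum_(i <- A) `|F (i, j)|)); last first.
  by move=> j _; rewrite ger0_norm// sumr_ge0.
by rewrite exchange_big /=; apply: le_trans _ (FM (A `*` B)%fset); rewrite big_fsetX.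
Qed.

(** Fubini: a finite set containing the projections of a large finite set of
    pairs already captures the whole double sum up to any prescribed error. *)
Lemma has_sum_fubini I J (F : I * J -> R) M S (r : I -> R) :
  abs_bounded F M -> has_sum F S -> (forall i, has_sum (fun j => F (i, j)) (r i)) ->
  has_sum r S.
Proof.
move=> FM FS Fr; apply/cvgrPdist_le => /= e e0.
have /cvgrPdist_le/(_ e e0)[A _ Ae] := FS.
exists [fset x.1 | x in A]%fset => // B /= AB.
have h := has_sum_sum (r := B) Fr.
have hn : (fun C : {fset J} => `|S - \sum_(j <- C) \sum_(i <- B) F (i, j)|) @ @fset_oo J -->
    `|S - \sum_(i <- B) r i| by apply: cvg_norm; apply: cvgB h; exact: cvg_cst.
apply: (closed_cvg (fun x => x <= e) (@closed_le _ e) _ _ hn).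
have := fset_oo_ge [fset x.2 | x in A]%fset; apply: filterS => C AC.
rewrite exchange_big /=.
have -> : \sum_(i <- B) \sum_(j <- C) F (i, j) = \sum_(x <- (B `*` C)%fset) F x.
  by rewrite big_fsetX.
apply: Ae => /=; apply/fsubsetP => -[a b] abA; rewrite inE /=; apply/andP; split.
  by apply: (fsubsetP AB); apply/imfsetP; exists (a, b).
by apply: (fsubsetP AC); apply/imfsetP; exists (a, b).
Qed.

Lemma has_sum_swap I J (F : I * J -> R) S :
  has_sum F S -> has_sum (fun x : J * I => F (x.2, x.1)) S.
Proof.
apply: (@has_sum_inj _ _ F (fun x : J * I => (x.2, x.1))) => [[a b] [c d] [-> ->]//|].
by move=> [a b] /(_ (b, a)); rewrite /= eqxx.
Qed.

Lemma abs_bounded_swap I J (F : I * J -> R) M :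
  abs_bounded F M -> abs_bounded (fun x : J * I => F (x.2, x.1)) M.
Proof.
by apply: (@abs_bounded_inj _ _ F (fun x : J * I => (x.2, x.1))) => -[a b] [c d] [-> ->].
Qed.

Lemma has_sum_fubini_inv I J (F : I * J -> R) M S (r : I -> R) :
  abs_bounded F M -> (forall i, has_sum (fun j => F (i, j)) (r i)) ->
  has_sum r S -> has_sum F S.
Proof.
move=> FM Fr rS; have [T FT] := has_sum_ex FM.
by rewrite (has_sum_unique rS (has_sum_fubini FM FT Fr)).
Qed.

End UnorderedSums.

(** * Power series on polydiscs *)

Local Notation mon := multi_monomial.
Local Notation midx n := {ffun 'I_n -> nat}.

Section PowerSeries.
Context {R : realType}.
Implicit Types (n m : nat) (I J : choiceType) (r s M N : R).

Definition addk n (k k' : midx n) : midx n := [ffun i => (k i + k' i)%N].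

Lemma monD n (z : 'rV[R]_n) k k' : mon z (addk k k') = mon z k * mon z k'.
Proof. by rewrite /mon -big_split; apply: eq_bigr => i _; rewrite ffunE exprD. Qed.

Lemma mon_const_ge0 n r (k : midx n) : 0 <= r -> 0 <= mon (const_mx r) k.
Proof. by move=> r0; apply: prodr_ge0 => i _; rewrite mxE exprn_ge0. Qed.

Lemma mon_const_gt0 n r (k : midx n) : 0 < r -> 0 < mon (const_mx r) k.
Proof. by move=> r0; apply: prodr_gt0 => i _; rewrite mxE exprn_gt0. Qed.

Lemma mon_norm_le n r (z : 'rV[R]_n) k :
  (forall i, `|z 0 i| <= r) -> `|mon z k| <= mon (const_mx r) k.
Proof.
move=> zr; rewrite /mon normr_prod; apply: ler_prod => i _; rewrite normr_ge0/=.
by rewrite normrX mxE; apply: lerXn2r; rewrite ?nnegrE// (le_trans _ (zr i)).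
Qed.

Lemma mon0 n (z : 'rV[R]_n) : mon z [ffun=> 0%N] = 1.
Proof. by rewrite /mon big1// => i _; rewrite ffunE. Qed.

(** [r] is the radius of a closed polydisc centred at the origin on which the
    series with coefficients [a] converges to [g]; [M] bounds its norm in the
    weighted l^1 algebra of that polydisc. *)
Definition power_sum n (a : midx n -> R) r M (g : 'rV[R]_n -> R) : Prop :=
  abs_bounded (fun k => a k * mon (const_mx r) k) M /\
  forall z : 'rV[R]_n, (forall i, `|z 0 i| <= r) -> has_sum (fun k => a k * mon z k) (g z).

Definition polyseries n r M (g : 'rV[R]_n -> R) : Prop := exists a, power_sum a r M g.

Lemma term_le n (a : midx n -> R) r (z : 'rV[R]_n) k : (forall i, `|z 0 i| <= r) ->
  `|a k * mon z k| <= `|a k * mon (const_mx r) k|.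
Proof.
move=> zr; rewrite !normrM ler_wpM2l//; apply: le_trans (ler_norm _).
exact: mon_norm_le.
Qed.

Lemma power_sum_bound n (a : midx n -> R) r M g (z : 'rV[R]_n) :
  power_sum a r M g -> (forall i, `|z 0 i| <= r) -> `|g z| <= M.
Proof.
move=> [aM ag] zr; apply: has_sum_norm_le (ag z zr) _.
by apply: abs_bounded_le aM => k; exact: term_le.
Qed.

Lemma polyseries_bound n r M (g : 'rV[R]_n -> R) (z : 'rV[R]_n) :
  polyseries r M g -> (forall i, `|z 0 i| <= r) -> `|g z| <= M.
Proof. by move=> [a]; exact: power_sum_bound. Qed.

(** A summable family of monomials with repeated exponents is a power series:
    collect the terms with equal exponents. *)
Lemma polyseries_family n I (b : I -> R) (e : I -> midx n) r M g : 0 < r ->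
  abs_bounded (fun i => b i * mon (const_mx r) (e i)) M ->
  (forall z : 'rV[R]_n, (forall i, `|z 0 i| <= r) -> has_sum (fun i => b i * mon z (e i)) (g z)) ->
  polyseries r M g.
Proof.
move=> r0 bM bg.
pose F (z : 'rV[R]_n) (x : I * midx n) :=
  if e x.1 == x.2 then b x.1 * mon z (e x.1) else 0.
have F1 z i k : k != e i -> F z (i, k) = 0 by rewrite /F/= eq_sym => /negbTE ->.
have FM (z : 'rV[R]_n) : (forall i, `|z 0 i| <= r) -> abs_bounded (F z) M.
  move=> zr; apply: (@abs_bounded_pair _ _ _ _ (fun i => `|F z (i, e i)|)) => [i|].
    by apply: (@abs_bounded_single _ _ (fun k => F z (i, k)) (e i)) => k; exact: F1.
  apply: abs_bounded_le bM => i; rewrite normr_id /F/= eqxx !normrM ler_wpM2l//.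
  by apply: le_trans (ler_norm _); exact: mon_norm_le.
have Fg (z : 'rV[R]_n) : (forall i, `|z 0 i| <= r) -> has_sum (F z) (g z).
  move=> zr; apply: has_sum_fubini_inv (FM z zr) _ (bg z zr) => i.
  have := @has_sum_single _ _ (fun k => F z (i, k)) (e i) (F1 z i).
  by rewrite {2}/F /= eqxx.
pose rr : 'rV[R]_n := const_mx r.
have rrr i : `|rr 0 i| <= r by rewrite mxE gtr0_norm.
have /choice[q Fq] : forall k, exists s, has_sum (fun i => F rr (i, k)) s.
  by move=> k; apply: has_sum_ex (abs_bounded_row k (abs_bounded_swap (FM rr rrr))).
have mr k : mon rr k != 0 by rewrite gt_eqF// mon_const_gt0.
exists (fun k => q k / mon rr k); split.
  apply: (abs_bounded_sums (abs_bounded_swap (FM rr rrr))) => k /=.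
  by rewrite divfK.
move=> z zr.
apply: (has_sum_fubini (abs_bounded_swap (FM z zr)) (has_sum_swap (Fg z zr))) => k /=.
rewrite mulrAC -mulrA mulrC.
apply: eq_has_sum (has_sumZ (c := mon z k / mon rr k) (Fq k)) => i.
rewrite /F/=; case: eqP => [->|_]; last by rewrite mulr0.
by rewrite mulrCA divfK.
Qed.

Lemma polyseries_cst n r c : 0 <= r -> polyseries r `|c| (fun _ : 'rV[R]_n => c).
Proof.
move=> r0; pose a (k : midx n) := if k == [ffun=> 0%N] then c else 0.
have a0 (z : 'rV[R]_n) k : k != [ffun=> 0%N] -> a k * mon z k = 0.
  by rewrite /a => /negbTE ->; rewrite mul0r.
exists a; split.
  have := @abs_bounded_single _ _ (fun k => a k * mon (const_mx r) k) [ffun=> 0%N] (a0 _).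
  by rewrite mon0 /a eqxx mulr1.
move=> z _; have := @has_sum_single _ _ (fun k => a k * mon z k) [ffun=> 0%N] (a0 _).
by rewrite mon0 /a eqxx mulr1.
Qed.

Lemma polyseries_coord n r (i : 'I_n) : 0 < r -> polyseries r r (fun z : 'rV[R]_n => z 0 i).
Proof.
move=> r0; apply: (@polyseries_family _ unit (fun=> 1) (fun=> [ffun j => (j == i : nat)])) => //.
  have /= := @abs_bounded_single R _ (fun _ : unit => r) tt.
  rewrite gtr0_norm// => /(_ _)/wrap[]; first by case.
  apply: abs_bounded_le => -[]; rewrite mul1r /mon (bigD1 i)//= big1 => [|j ji].
    by rewrite ffunE eqxx mxE mulr1 expr1.
  by rewrite ffunE (negbTE ji).
move=> z _; have /= := @has_sum_single R _ (fun _ : unit => z 0 i) tt.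
move=> /(_ _)/wrap[]; first by case.
apply: eq_has_sum => -[]; rewrite mul1r /mon (bigD1 i)//= big1 => [|j ji].
  by rewrite ffunE eqxx mulr1 expr1.
by rewrite ffunE (negbTE ji).
Qed.

Lemma polyseriesD n r M N (g h : 'rV[R]_n -> R) :
  polyseries r M g -> polyseries r N h -> polyseries r (M + N) (fun z => g z + h z).
Proof.
move=> [a [aM ag]] [b [bN bh]]; exists (fun k => a k + b k); split.
  by apply: abs_bounded_le (abs_boundedD aM bN) => k; rewrite mulrDl.
move=> z zr; apply: eq_has_sum (has_sumD (ag z zr) (bh z zr)) => k.
by rewrite mulrDl.
Qed.

Lemma polyseriesM n r M N (g h : 'rV[R]_n -> R) : 0 < r ->
  polyseries r M g -> polyseries r N h -> polyseries r (M * N) (fun z => g z * h z).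
Proof.
move=> r0 [a [aM ag]] [b [bN bh]].
have E (z : 'rV[R]_n) (x : midx n * midx n) : a x.1 * b x.2 * mon z (addk x.1 x.2) =
    (a x.1 * mon z x.1) * (b x.2 * mon z x.2) by rewrite monD; ring.
apply: (@polyseries_family _ _ (fun x : midx n * midx n => a x.1 * b x.2)
  (fun x => addk x.1 x.2)) => //.
  by apply: abs_bounded_le (abs_boundedM aM bN) => x; rewrite E.
move=> z zr; apply: eq_has_sum; first by move=> x; rewrite E.
have aM' : abs_bounded (fun k => a k * mon z k) M.
  by apply: abs_bounded_le aM => k; exact: term_le.
have bN' : abs_bounded (fun k => b k * mon z k) N.
  by apply: abs_bounded_le bN => k; exact: term_le.
apply: (has_sum_fubini_inv (abs_boundedM aM' bN')) => /= [k|].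
  by apply: has_sumZ; exact: bh.
by rewrite mulrC; apply: eq_has_sum (has_sumZ (c := h z) (ag z zr)) => k; rewrite mulrC.
Qed.

Lemma polyseriesX n r M (g : 'rV[R]_n -> R) k : 0 < r ->
  polyseries r M g -> polyseries r (M ^+ k) (fun z => g z ^+ k).
Proof.
move=> r0 gM; elim: k => [|k IH].
  by have := @polyseries_cst n r 1 (ltW r0); rewrite normr1.
have := polyseriesM r0 gM IH.
by rewrite -exprS; under [X in polyseries _ _ X]eq_fun do rewrite -exprS.
Qed.

Lemma polyseries_prod n r (T : Type) (s : seq T) (M : T -> R) (g : T -> 'rV[R]_n -> R) : 0 < r ->
  (forall i, polyseries r (M i) (g i)) ->
  polyseries r (\prod_(i <- s) M i) (fun z => \prod_(i <- s) g i z).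
Proof.
move=> r0 gM; elim: s => [|x s IH].
  have := @polyseries_cst n r 1 (ltW r0); rewrite normr1 big_nil.
  by under [X in _ -> polyseries _ _ X]eq_fun do rewrite big_nil.
have := polyseriesM r0 (gM x) IH; rewrite big_cons.
by under [X in _ -> polyseries _ _ X]eq_fun do rewrite big_cons.
Qed.

Lemma polyseries_sum n r I (m : I -> R) M (g : I -> 'rV[R]_n -> R) h : 0 < r ->
  (forall i, polyseries r (m i) (g i)) -> abs_bounded m M ->
  (forall z : 'rV[R]_n, (forall i, `|z 0 i| <= r) -> has_sum (fun i => g i z) (h z)) ->
  polyseries r M h.
Proof.
move=> r0 /choice[a ag] mM gh.
apply: (@polyseries_family _ _ (fun x : I * midx n => a x.1 x.2) (fun x => x.2)) => //=.
  apply: (abs_bounded_pair (m := m)) => // i; exact: (ag i).1.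
move=> z zr; apply: (has_sum_fubini_inv (M := M)) (gh z zr) => [|i]; last first.
  exact: (ag i).2.
apply: (abs_bounded_pair (m := m)) => // i /=.
by apply: abs_bounded_le (ag i).1 => k; exact: term_le.
Qed.

(** Substitution: the powers of the inner series are summed in the weighted
    l^1 algebra, where their norms are those of the outer terms. *)
Lemma polyseries_comp n m r s N (h : 'rV[R]_m -> R) (G : 'I_m -> 'rV[R]_n -> R) :
  0 < r -> polyseries s N h -> (forall j, polyseries r s (G j)) ->
  polyseries r N (fun z => h (\row_j G j z)).
Proof.
move=> r0 [b [bN bh]] Gs.
apply: (@polyseries_sum _ _ _ (fun k => `|b k| * mon (const_mx s) k) _
    (fun k z => b k * mon (\row_j G j z) k)) => //.
- move=> k; apply: polyseriesM => //; first exact: polyseries_cst (ltW r0).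
  have := @polyseries_prod _ _ _ (index_enum 'I_m) (fun j => s ^+ k j) (fun j z => G j z ^+ k j) r0
    (fun j => polyseriesX (k j) r0 (Gs j)).
  rewrite /mon; under [X in _ -> polyseries _ X _]eq_bigr do rewrite mxE.
  by under [X in _ -> polyseries _ _ X]eq_fun do under eq_bigr do rewrite mxE.
- by apply: abs_bounded_le bN => k; rewrite !normrM normr_id.
- move=> z zr; apply: bh => j; rewrite mxE.
  exact: polyseries_bound (Gs j) zr.
Qed.

End PowerSeries.

(** * Analytic functions as sums of power series *)

Section Analytic.
Context {R : realType}.
Implicit Types (n m : nat) (I J : choiceType) (r s M N : R).

Lemma summable_abs_bounded I (f : I -> R) :
  summable setT (fun i => (f i)%:E) <-> exists M, abs_bounded f M.
Proof.
have sumE (A : {fset I}) :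
    (\sum_(i \in [set` A]) `|(f i)%:E| = (\sum_(i <- A) `|f i|)%:E)%E.
  by rewrite fsbig_finite//= set_fsetK sumEFin.
split=> [fs|[M fM]].
  have fin : (\esum_(i in [set: I]) `|(f i)%:E|)%E \is a fin_num by rewrite -summableE.
  exists (fine (\esum_(i in [set: I]) `|(f i)%:E|)%E) => A.
  rewrite -lee_fin fineK// -sumE; apply: esum_ge; exists [set` A] => //.
rewrite /summable; apply: (@le_lt_trans _ _ M%:E); last exact: ltry.
apply: ge_ereal_sup => _ [X [fX _] <-].
rewrite -(fset_setK fX) sumE lee_fin; exact: fM.
Qed.

(** Boxes are cofinal among the finite sets of multi-indices. *)
Lemma has_sum_boxes n (F : midx n -> R) S : has_sum F S ->
  (fun N : nat => \sum_(k : {ffun 'I_n -> 'I_N}) F [ffun i => val (k i)]) @ \oo --> S.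
Proof.
move=> FS; apply/cvgrPdist_lt => /= e e0.
have /cvgrPdist_lt/(_ e e0)[A _ Ae] := FS.
pose B := (\max_(k <- A) \max_(i < n) k i).+1.
have AB k i : k \in A -> (k i < B)%N.
  move=> kA; rewrite ltnS /B; apply: leq_trans (leq_bigmax_seq _ kA _) => //.
  exact: leq_bigmax.
exists B => // N /= BN.
pose h (k : {ffun 'I_n -> 'I_N}) : midx n := [ffun i => val (k i)].
have hI : injective h.
  move=> k k' /ffunP hk; apply/ffunP => i; apply: val_inj.
  by have := hk i; rewrite !ffunE.
have -> : \sum_(k : {ffun 'I_n -> 'I_N}) F [ffun i => val (k i)] =
    \sum_(k <- [fset h k | k : {ffun 'I_n -> 'I_N}]%fset) F k.
  by rewrite big_imfset//=; [rewrite big_enum|move=> x y _ _; exact: hI].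
apply: Ae => /=; apply/fsubsetP => k kA; apply/imfsetP => /=.
exists [ffun i => Ordinal (leq_trans (AB k i kA) BN)] => //.
by apply/ffunP => i; rewrite !ffunE.
Qed.

(** The limit over boxes is an unordered sum, since absolute summability on a
    smaller closed polydisc makes the order irrelevant. *)
Lemma analytic_atP n (f : 'rV[R]_n -> R) p :
  analytic_at f p <-> exists r M, 0 < r /\ polyseries r M (fun z => f (p + z)).
Proof.
split=> [[a [r [r0 af]]]|[r [M [r0 [a [aM af]]]]]].
  have r2 : 0 < r / 2 by rewrite divr_gt0.
  have afz (z : 'rV[R]_n) : (forall i, `|z 0 i| <= r / 2) ->
      summable setT (fun k => (a k * mon z k)%:E) /\
      (fun N : nat => \sum_(k : {ffun 'I_n -> 'I_N}) a [ffun i => val (k i)] *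
         mon z [ffun i => val (k i)]) @ \oo --> f (p + z).
    move=> zr; have := af (p + z); rewrite addrC addKr.
    apply=> i; apply: le_lt_trans (zr i) _; lra.
  have rr (i : 'I_n) : `|(const_mx (r / 2) : 'rV[R]_n) 0 i| <= r / 2.
    by rewrite mxE gtr0_norm.
  have [/summable_abs_bounded[M aM] _] := afz _ rr.
  exists (r / 2), M; split => //; exists a; split => // z zr.
  have [_ afN] := afz z zr.
  have [S hS] : exists S, has_sum (fun k => a k * mon z k) S.
    apply: (@has_sum_ex _ _ _ M); apply: abs_bounded_le aM => k; exact: term_le.
  by rewrite -(cvg_unique _ (has_sum_boxes hS) afN).
exists a, r; split => // x xr.
have xpr i : `|(x - p) 0 i| <= r by exact: ltW.
split.
  apply/summable_abs_bounded; exists M; apply: abs_bounded_le aM => k; exact: term_le.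
by have := has_sum_boxes (af _ xpr); rewrite /= [p + _]addrC subrK.
Qed.

(** Away from its constant term a series gains a factor t when the polydisc is
    shrunk by t; so the inner series of a composition can be made small. *)
Lemma polyseries_shrink n r M (g : 'rV[R]_n -> R) t : 0 < r -> 0 <= t <= 1 ->
  polyseries r M g -> polyseries (t * r) (t * M) (fun z => g z - g 0).
Proof.
move=> r0 /andP[t0 t1] [a [aM ag]]; pose o : midx n := [ffun=> 0%N].
pose a' (k : midx n) := if k == o then 0 else a k.
have g0 : g 0 = a o.
  have z0 (i : 'I_n) : `|(0 : 'rV[R]_n) 0 i| <= r by rewrite mxE normr0 ltW.
  apply: has_sum_unique (ag _ z0) _; rewrite -[X in has_sum _ X]mulr1 -(mon0 (0 : 'rV[R]_n)).
  apply: (@has_sum_single _ _ (fun k => a k * mon 0 k)) => k ko.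
  have [i ki] : exists i, k i != 0%N.
    apply/existsP; apply: contraNT ko; rewrite negb_exists => /forallP h.
    by apply/eqP/ffunP => i; rewrite ffunE; apply/eqP; rewrite -[_ == _]negbK.
  by rewrite /mon (bigD1 i)//= mxE expr0n (negbTE ki) mul0r mulr0.
exists a'; split.
  have := abs_boundedZ t aM; rewrite ger0_norm//; apply: abs_bounded_le => k.
  rewrite /a'; case: eqP => [_|/eqP ko]; first by rewrite mul0r normr0.
  have [i ki] : exists i, k i != 0%N.
    apply/existsP; apply: contraNT ko; rewrite negb_exists => /forallP h.
    by apply/eqP/ffunP => i; rewrite ffunE; apply/eqP; rewrite -[_ == _]negbK.
  rewrite mulrCA normrM [leRHS]normrM ler_wpM2l//.
  have -> : mon (const_mx (t * r)) k = mon (const_mx t) k * mon (const_mx r) k.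
    by rewrite /mon -big_split; apply: eq_bigr => j _; rewrite !mxE exprMn.
  rewrite !normrM ler_wpM2r// !ger0_norm//; last exact: mon_const_ge0.
  rewrite /mon (bigD1 i)//= mxE -[leRHS]mulr1; apply: ler_pM.
  - exact: exprn_ge0.
  - by apply: prodr_ge0 => j _; rewrite mxE exprn_ge0.
  - have k0 : (0 < k i)%N by rewrite lt0n.
    by rewrite -(prednK k0) exprS ler_piMr// exprn_ile1.
  - by apply: prodr_ile1 => j _; rewrite mxE exprn_ge0//= exprn_ile1.
move=> z zr.
have zr' i : `|z 0 i| <= r by apply: le_trans (zr i) _; rewrite ler_piMl// ltW.
pose b (k : midx n) := if k == o then a k else 0.
have b0 k : k != o -> b k = 0 by rewrite /b => /negbTE ->.
have := has_sumB (ag z zr') (has_sum_single b0).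
rewrite {2}/b eqxx g0; apply: eq_has_sum => k; rewrite /a' /b; case: eqP => [->|_]; last by rewrite subr0.
by rewrite mon0 mulr1 subrr mul0r.
Qed.

Lemma polyseries_radius n r s M (g : 'rV[R]_n -> R) : 0 <= s <= r ->
  polyseries r M g -> polyseries s M g.
Proof.
move=> /andP[s0 sr] [a [aM ag]]; exists a; split.
  apply: abs_bounded_le aM => k; apply: term_le => i; rewrite mxE ger0_norm//.
by move=> z zs; apply: ag => i; exact: le_trans (zs i) sr.
Qed.

End Analytic.

(** * Stability of analytic functions *)

Section AnalyticCalculus.
Context {R : realType}.
Implicit Types (n m : nat) (I J : choiceType) (r s M N : R).

Lemma polyseries_le n r M N (g : 'rV[R]_n -> R) :
  M <= N -> polyseries r M g -> polyseries r N g.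
Proof. by move=> MN [a [aM ag]]; exists a; split => // A; exact: le_trans (aM A) MN. Qed.

Lemma coord_norm_le n (z : 'rV[R]_n) i : `|z 0 i| <= `|z|.
Proof.
rewrite [leRHS]/Num.Def.normr/= mx_normrE.
exact: (le_bigmax _ _ (0 : 'I_1, i)).
Qed.

Lemma norm_row_le n (z : 'rV[R]_n) r : 0 <= r -> (forall i, `|z 0 i| <= r) -> `|z| <= r.
Proof.
move=> r0 zr; rewrite [leLHS]/Num.Def.normr/= mx_normrE.
by apply: bigmax_le => //= -[a i] _; rewrite ord1.
Qed.

(** Expanding at a nearby centre is the substitution of a translation. *)
Lemma analytic_near n (f : 'rV[R]_n -> R) p :
  analytic_at f p -> \forall y \near p, analytic_at f y.
Proof.
move=> /analytic_atP[r [M [r0 fM]]].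
have r2 : 0 < r / 2 by rewrite divr_gt0.
near=> y; apply/analytic_atP; exists (r / 2), M; split => //.
have yr : `|y - p| <= r / 2.
  by rewrite distrC; near: y; apply: cvgr_dist_le => //; exact: cvg_id.
have := @polyseries_comp R n n (r / 2) r M _ (fun j z => (y - p) 0 j + z 0 j) r2 fM.
move=> /(_ _)/wrap[] => [j|].
  apply: (@polyseries_le _ _ (`|(y - p) 0 j| + r / 2)).
    by have := le_trans (coord_norm_le (y - p) j) yr; lra.
  by apply: polyseriesD; [exact: polyseries_cst (ltW r2)|exact: polyseries_coord].
rewrite (_ : (fun z => f (p + _)) = (fun z => f (y + z)))//.
apply/funext => z; congr f; apply/rowP => j; rewrite !mxE; ring.
Unshelve. all: by end_near. Qed.

Lemma analytic_comp n m (h : 'rV[R]_m -> R) (G : 'rV[R]_n -> 'rV[R]_m) p :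
  analytic_at h (G p) -> map_analytic_at G p -> analytic_at (fun x => h (G x)) p.
Proof.
move=> /analytic_atP[s [N [s0 hN]]] Ga.
have : \forall r \near (0 : R)^'+, forall j, polyseries r s (fun z => G (p + z) 0 j - G p 0 j).
  apply: filter_forall => j.
  have /analytic_atP[r [M [r0 GM]]] := Ga j.
  have M0 : 0 <= M.
    have := @polyseries_bound R _ _ _ _ 0 GM; move=> /(_ _)/wrap[].
      by move=> i; rewrite mxE normr0 ltW.
    exact: le_trans.
  (* Shrinking by t keeps the inner series within the radius s of the outer one. *)
  pose t := Num.min 1 (s / (M + 1)).
  have t0 : 0 < t by rewrite lt_min ltr01 divr_gt0// ltr_wpDl.
  have t1 : 0 <= t <= 1 by rewrite ltW//= ge_min lexx.
  have tM : t * M <= s.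
    have : t <= s / (M + 1) by rewrite ge_min lexx orbT.
    rewrite ler_pdivlMr ?ltr_wpDl// => h1; have := ltW t0; nra.
  near=> r'.
  apply: polyseries_le tM _; apply: (@polyseries_radius _ _ (t * r)).
    apply/andP; split; first by near: r'; exact: nbhs_right_ge.
    by near: r'; apply: nbhs_right_le; rewrite mulr_gt0.
  have := polyseries_shrink r0 t1 GM; rewrite addr0//.
move=> /(filterI (nbhs_right_gt (0 : R)))/filter_ex[r [r0 Gr]].
apply/analytic_atP; exists r, N; split => //.
have := polyseries_comp r0 hN Gr.
rewrite (_ : (fun z => h (G p + _)) = (fun z => h (G (p + z))))//.
apply/funext => z; congr h; apply/rowP => j; rewrite !mxE; ring.
Unshelve. all: by end_near. Qed.

Lemma map_analytic_comp n m k (h : 'rV[R]_m -> 'rV[R]_k) (G : 'rV[R]_n -> 'rV[R]_m) p :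
  map_analytic_at h (G p) -> map_analytic_at G p -> map_analytic_at (fun x => h (G x)) p.
Proof. by move=> ha Ga j; exact: (@analytic_comp _ _ (fun y => h y 0 j) G p (ha j) Ga). Qed.

Lemma map_analytic_near n m (f : 'rV[R]_n -> 'rV[R]_m) p :
  map_analytic_at f p -> \forall y \near p, map_analytic_at f y.
Proof.
move=> fa; rewrite /map_analytic_at.
apply: (@filter_forall _ _ (fun j y => analytic_at (fun x => f x 0 j) y) (nbhs p)) => j.
exact: analytic_near.
Qed.

Lemma analytic_cst n (c : R) (p : 'rV[R]_n) : analytic_at (fun=> c) p.
Proof. by apply/analytic_atP; exists 1, `|c|; split => //; exact: polyseries_cst. Qed.

Lemma analytic_coord n i (p : 'rV[R]_n) : analytic_at (fun x => x 0 i) p.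
Proof.
apply/analytic_atP; exists 1, (`|p 0 i| + 1); split => //.
rewrite (_ : (fun z => _) = (fun z : 'rV[R]_n => p 0 i + z 0 i)); last by apply/funext => z; rewrite mxE.
by apply: polyseriesD; [exact: polyseries_cst|exact: polyseries_coord].
Qed.

(** Sums and products are compositions with polynomials in two variables. *)
Lemma analyticD n (f g : 'rV[R]_n -> R) p :
  analytic_at f p -> analytic_at g p -> analytic_at (fun x => f x + g x) p.
Proof.
move=> fa ga.
pose s (y : 'rV[R]_2) := y 0 0 + y 0 1.
have sa y : analytic_at s y.
  apply/analytic_atP; exists 1, (`|y 0 0| + 1 + (`|y 0 1| + 1)); split => //.
  rewrite (_ : (fun z => _) = (fun z : 'rV[R]_2 => (y 0 0 + z 0 0) + (y 0 1 + z 0 1))).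
    by apply: polyseriesD; apply: polyseriesD; do ?[exact: polyseries_cst|exact: polyseries_coord].
  by apply/funext => z; rewrite /s !mxE.
rewrite (_ : (fun x => _) = (fun x => s (pt2 (f x) (g x)))); last first.
  by apply/funext => x; rewrite /s /pt2 !mxE.
apply: (@analytic_comp _ _ s) => //.
case=> -[|[|//]] j2.
  by rewrite (_ : (fun x => _) = f)//; apply/funext => x; rewrite mxE.
by rewrite (_ : (fun x => _) = g)//; apply/funext => x; rewrite mxE.
Qed.

Lemma analyticM n (f g : 'rV[R]_n -> R) p :
  analytic_at f p -> analytic_at g p -> analytic_at (fun x => f x * g x) p.
Proof.
move=> fa ga.
pose s (y : 'rV[R]_2) := y 0 0 * y 0 1.
have sa y : analytic_at s y.
  apply/analytic_atP; exists 1, ((`|y 0 0| + 1) * (`|y 0 1| + 1)); split => //.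
  rewrite (_ : (fun z => _) = (fun z : 'rV[R]_2 => (y 0 0 + z 0 0) * (y 0 1 + z 0 1))).
    by apply: polyseriesM => //; apply: polyseriesD; do ?[exact: polyseries_cst|exact: polyseries_coord].
  by apply/funext => z; rewrite /s !mxE.
rewrite (_ : (fun x => _) = (fun x => s (pt2 (f x) (g x)))); last first.
  by apply/funext => x; rewrite /s /pt2 !mxE.
apply: (@analytic_comp _ _ s) => //.
case=> -[|[|//]] j2.
  by rewrite (_ : (fun x => _) = f)//; apply/funext => x; rewrite mxE.
by rewrite (_ : (fun x => _) = g)//; apply/funext => x; rewrite mxE.
Qed.

End AnalyticCalculus.

(** * Termwise differentiation *)

Section AnalyticDerivative.
Context {R : realType}.
Implicit Types (n m : nat) (I J : choiceType) (r s M N : R).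

(** The remainder of a monomial of degree m is geometric in m, so that it can be
    summed against the coefficients of a series. *)
Lemma binomial_remainder (x t d : R) m : 0 < d -> `|x| <= d -> `|t| <= d ->
  `|(x + t) ^+ m - x ^+ m - t * (m%:R * x ^+ m.-1)| <= (t / d) ^+ 2 * (2 * d) ^+ m.
Proof.
move=> d0 xd td.
suff : `|(x + t) ^+ m - x ^+ m - t * (m%:R * x ^+ m.-1)| <=
    (t / d) ^+ 2 * d ^+ m * (2 ^+ m - 1 - m%:R).
  move=> /le_trans; apply; rewrite [(2 * d) ^+ m]exprMn [2 ^+ m * _]mulrC mulrA.
  apply: ler_wpM2l; first by rewrite mulr_ge0// ?sqr_ge0// exprn_ge0// ltW.
  by have := ler0n R m; lra.
elim: m => [|m IH].
  by rewrite !expr0 !mulr0n mul0r mulr0 !subr0 !subrr normr0 mulr0.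
have -> : (x + t) ^+ m.+1 - x ^+ m.+1 - t * (m.+1%:R * x ^+ m) =
   (x + t) * ((x + t) ^+ m - x ^+ m - t * (m%:R * x ^+ m.-1)) + t ^+ 2 * (m%:R * x ^+ m.-1).
  case: m {IH} => [|m /=]; first by rewrite !expr0 !expr1 !mul0r; ring.
  by rewrite !exprS -!natr1; ring.
have xt : `|x + t| <= 2 * d by have := ler_normD x t; lra.
apply: le_trans (ler_normD _ _) _.
have -> : (t / d) ^+ 2 * d ^+ m.+1 * (2 ^+ m.+1 - 1 - m.+1%:R) =
   2 * d * ((t / d) ^+ 2 * d ^+ m * (2 ^+ m - 1 - m%:R)) + t ^+ 2 * (m%:R * d ^+ m.-1).
  case: m {IH} => [|m /=]; first by rewrite !expr0 !expr1 !mul0r; field; rewrite gt_eqF.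
  by rewrite !exprS -!natr1; field; rewrite gt_eqF.
apply: lerD.
  by rewrite normrM; apply: ler_pM.
rewrite normrM [X in X * _]ger0_norm ?sqr_ge0// normrM normr_nat normrX.
rewrite ler_wpM2l ?sqr_ge0// ler_wpM2l ?ler0n//; apply: lerXn2r; rewrite ?nnegrE//.
exact: ltW.
Qed.

Definition ebase n (i : 'I_n) : 'rV[R]_n := delta_mx 0 i.
Definition incr_idx n (i : 'I_n) (k : midx n) : midx n := [ffun j => (k j + (j == i))%N].
Definition decr_idx n (i : 'I_n) (k : midx n) : midx n := [ffun j => (k j - (j == i))%N].

(** The coefficients of the termwise derivative in direction [i]. *)
Definition deriv_coef n (i : 'I_n) (a : midx n -> R) (k : midx n) : R :=
  (k i).+1%:R * a (incr_idx i k).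

Lemma deriv_coefC n (i j : 'I_n) a :
  deriv_coef i (deriv_coef j a) =1 deriv_coef j (deriv_coef i a).
Proof.
move=> k; rewrite /deriv_coef.
have -> : incr_idx j (incr_idx i k) = incr_idx i (incr_idx j k).
  by apply/ffunP => x; rewrite !ffunE addnAC.
rewrite !ffunE; have [->|ij] := eqVneq i j; first by [].
by rewrite !addn0 mulrCA.
Qed.

Lemma incr_idx_inj n (i : 'I_n) : injective (incr_idx i).
Proof.
by move=> k k' /ffunP h; apply/ffunP => j; have := h j; rewrite !ffunE => /addIn.
Qed.

Lemma incr_idxK n (i : 'I_n) : cancel (incr_idx i) (decr_idx i).
Proof. by move=> k; apply/ffunP => j; rewrite !ffunE addnK. Qed.

Lemma decr_idxK n (i : 'I_n) (k : midx n) : (0 < k i)%N -> incr_idx i (decr_idx i k) = k.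
Proof.
move=> k0; apply/ffunP => j; rewrite !ffunE; have [->|ji] := eqVneq j i.
  by rewrite subnK.
by rewrite subn0 addn0.
Qed.

Lemma mon_split n (i : 'I_n) (z : 'rV[R]_n) k :
  mon z k = z 0 i ^+ k i * \prod_(j | j != i) z 0 j ^+ k j.
Proof. by rewrite /mon (bigD1 i). Qed.

Lemma mon_decr n (i : 'I_n) (z : 'rV[R]_n) k :
  mon z (decr_idx i k) = z 0 i ^+ (k i).-1 * \prod_(j | j != i) z 0 j ^+ k j.
Proof.
rewrite (mon_split i) ffunE eqxx subn1; congr (_ * _).
by apply: eq_bigr => j /negbTE ji; rewrite ffunE ji subn0.
Qed.

(** Termwise differentiation costs half of the radius; the quadratic estimate
    shows that the new series is the derivative. *)
Lemma power_sum_deriv n (i : 'I_n) (a : midx n -> R) r M g : 0 < r -> power_sum a r M g ->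
  exists2 g', power_sum (deriv_coef i a) (r / 2) (2 / r * M) g' &
  forall (z : 'rV[R]_n) (t : R), (forall j, `|z 0 j| <= r / 2) -> `|t| <= r / 2 ->
    `|g (z + t *: ebase i) - g z - t * g' z| <= (t / (r / 2)) ^+ 2 * M.
Proof.
move=> r0 [aM ag]; have d0 : 0 < r / 2 by rewrite divr_gt0.
have r2 : 2 * (r / 2) = r by rewrite mulrC divfK.
pose f (z : 'rV[R]_n) k := a k * ((k i)%:R * mon z (decr_idx i k)).
have prodle (z : 'rV[R]_n) (k : midx n) : (forall j, `|z 0 j| <= r / 2) ->
    `|\prod_(j | j != i) z 0 j ^+ k j| <= \prod_(j | j != i) r ^+ k j.
  move=> zr; rewrite normr_prod; apply: ler_prod => j _; rewrite normr_ge0/=.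
  rewrite normrX; apply: lerXn2r; rewrite ?nnegrE ?(ltW r0)//.
  by have := zr j; lra.
have fle (z : 'rV[R]_n) k : (forall j, `|z 0 j| <= r / 2) ->
    `|f z k| <= `|2 / r * (a k * mon (const_mx r) k)|.
  move=> zr; rewrite /f mon_decr (mon_split i (const_mx r)) [X in _ <= `|X|]mulrCA.
  rewrite normrM [leRHS]normrM ler_wpM2l// mulrA normrM [leRHS]ger0_norm; last first.
    apply: mulr_ge0; first by rewrite divr_ge0// ltW.
    apply: mulr_ge0; first by rewrite mxE exprn_ge0// ltW.
    by apply: prodr_ge0 => j _; rewrite mxE exprn_ge0// ltW.
  rewrite mulrA; apply: ler_pM => //; last first.
    by under [leRHS]eq_bigr do rewrite mxE; exact: prodle.
  rewrite mxE normrM normr_nat normrX.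
  have h1 : `|z 0 i| ^+ (k i).-1 <= (r / 2) ^+ (k i).-1 by apply: lerXn2r; rewrite ?nnegrE ?(ltW d0).
  apply: (@le_trans _ _ ((k i)%:R * (r / 2) ^+ (k i).-1)); first by rewrite ler_wpM2l.
  case: (k i) => [|m]/=; first by rewrite mul0r mulr_ge0// ?exprn_ge0// ?divr_ge0// ltW.
  have -> : 2 / r * r ^+ m.+1 = (2 ^+ m.+1) * (r / 2) ^+ m.
    rewrite [in RHS]exprMn exprVn !exprS; field.
    by rewrite ?expf_neq0 ?gt_eqF.
  rewrite ler_wpM2r ?exprn_ge0 ?(ltW d0)// -natrX ler_nat.
  exact: ltnW (ltn_expl _ _).
have fM (z : 'rV[R]_n) : (forall j, `|z 0 j| <= r / 2) -> abs_bounded (f z) (2 / r * M).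
  move=> zr; have := abs_boundedZ (2 / r) aM; rewrite ger0_norm ?divr_ge0 ?(ltW r0)//.
  by apply: abs_bounded_le => k; exact: fle.
have /choice[g' fg'] : forall z : 'rV[R]_n, exists s, (forall j, `|z 0 j| <= r / 2) -> has_sum (f z) s.
  move=> z; have [zr|zr] := pselect (forall j, `|z 0 j| <= r / 2).
    by have [s fs] := has_sum_ex (fM z zr); exists s.
  by exists 0.
have fincr z k : f z (incr_idx i k) = deriv_coef i a k * mon z k.
  by rewrite /f /deriv_coef incr_idxK ffunE eqxx addn1 mulrCA mulrA.
have f0 z k : (forall j, incr_idx i j != k) -> f z k = 0.
  move=> kj; have [k0|k0] := posnP (k i); first by rewrite /f k0 mul0r mulr0.
  by have := kj (decr_idx i k); rewrite decr_idxK// eqxx.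
exists g'; first split.
- have rr (j : 'I_n) : `|(const_mx (r / 2) : 'rV[R]_n) 0 j| <= r / 2 by rewrite mxE gtr0_norm.
  by apply: abs_bounded_le (abs_bounded_inj (@incr_idx_inj n i) (fM _ rr)) => k; rewrite fincr.
- move=> z zr; apply: eq_has_sum (has_sum_inj (@incr_idx_inj n i) (f0 z) (fg' z zr)) => k.
  exact: fincr.
move=> z t zr tr.
have zr1 j : `|z 0 j| <= r by have := zr j; lra.
have zr2 j : `|(z + t *: ebase i) 0 j| <= r.
  rewrite !mxE eqxx /=; apply: le_trans (ler_normD _ _) _; rewrite normrM.
  have := zr j; case: (_ == _); rewrite ?normr1 ?normr0; lra.
have hs := has_sumB (has_sumB (ag _ zr2) (ag _ zr1)) (has_sumZ (c := t) (fg' z zr)).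
apply: has_sum_norm_le hs _.
have := abs_boundedZ ((t / (r / 2)) ^+ 2) aM; rewrite ger0_norm ?sqr_ge0//.
apply: abs_bounded_le => k.
rewrite /f mon_decr !(mon_split i) !mxE !eqxx /= mulr1.
have -> : \prod_(j | j != i) (z + t *: ebase i) 0 j ^+ k j = \prod_(j | j != i) z 0 j ^+ k j.
  by apply: eq_bigr => j /negbTE ji; rewrite !mxE ji andbF mulr0 addr0.
set P := \prod_(j | j != i) z 0 j ^+ k j.
have -> : a k * ((z 0 i + t) ^+ k i * P) - a k * (z 0 i ^+ k i * P) -
    t * (a k * ((k i)%:R * (z 0 i ^+ (k i).-1 * P))) =
    a k * (((z 0 i + t) ^+ k i - z 0 i ^+ k i - t * ((k i)%:R * z 0 i ^+ (k i).-1)) * P) by ring.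
have -> : (t / (r / 2)) ^+ 2 * (a k * (r ^+ k i * \prod_(j | j != i) (const_mx r : 'rV[R]_n) 0 j ^+ k j)) =
   a k * ((t / (r / 2)) ^+ 2 * r ^+ k i * \prod_(j | j != i) (const_mx r : 'rV[R]_n) 0 j ^+ k j) by ring.
rewrite normrM [leRHS]normrM ler_wpM2l// normrM [leRHS]normrM.
apply: ler_pM => //.
  by apply: le_trans (binomial_remainder _ d0 (zr i) tr) _; rewrite r2 ler_norm.
apply: le_trans (prodle z k zr) _; under [X in _ <= `|X|]eq_bigr do rewrite mxE.
exact: ler_norm.
Qed.

End AnalyticDerivative.

(** * Analytic functions are differentiable *)

Section AnalyticDifferentiable.
Context {R : realType}.
Implicit Types (n m : nat) (I J : choiceType) (r s M N : R).

Definition idx0 n : midx n := [ffun=> 0%N].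

Lemma mon_idx1 n (i : 'I_n) (z : 'rV[R]_n) : mon z (incr_idx i (idx0 n)) = z 0 i.
Proof.
rewrite (mon_split i) !ffunE eqxx expr1 big1 ?mulr1// => j /negbTE ji.
by rewrite !ffunE ji expr0.
Qed.

Lemma mon_degree2 n (t : R) (k : midx n) : 0 <= t <= 1 -> k != idx0 n ->
  (forall i, k != incr_idx i (idx0 n)) -> mon (const_mx t) k <= t ^+ 2.
Proof.
move=> /andP[t0 t1] k0 k1.
have [i ki] : exists i, (0 < k i)%N.
  apply/existsP; apply: contraNT k0; rewrite negb_exists => /forallP h.
  by apply/eqP/ffunP => i; rewrite ffunE; apply/eqP; have := h i; rewrite -eqn0Ngt.
have rest (P : pred 'I_n) : 0 <= \prod_(j | P j) (const_mx t : 'rV[R]_n) 0 j ^+ k j <= 1.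
  rewrite prodr_ge0/= => [|j _]; last by rewrite mxE exprn_ge0.
  by apply: prodr_ile1 => j _; rewrite mxE exprn_ge0//= exprn_ile1.
have powle b c : (b <= c)%N -> t ^+ c <= t ^+ b by move=> bc; exact: ler_wiXn2l.
rewrite (mon_split i) mxE.
have [ki2|ki2] := leqP 2 (k i).
  rewrite -[leRHS]mulr1; apply: ler_pM; rewrite ?exprn_ge0 ?powle//.
    by have /andP[] := rest (fun j => j != i).
  by have /andP[] := rest (fun j => j != i).
have {ki ki2}ki : k i = 1%N by apply/eqP; rewrite eqn_leq ki andbT -ltnS.
have [j /andP[ji kj]] : exists j, (j != i) && (0 < k j)%N.
  apply/existsP; apply: contraNT (k1 i); rewrite negb_exists => /forallP h.
  apply/eqP/ffunP => j; rewrite !ffunE; have := h j; have [->|ji] := eqVneq j i; first by [].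
  by rewrite /= -eqn0Ngt => /eqP.
rewrite ki expr1 expr2 ler_wpM2l// (bigD1 j)//= mxE -[leRHS]mulr1.
apply: ler_pM; rewrite ?exprn_ge0//.
- by have /andP[] := rest (fun x => (x != i) && (x != j)).
- by rewrite -[leRHS]expr1 powle.
- by have /andP[] := rest (fun x => (x != i) && (x != j)).
Qed.

(** Every monomial of degree at least two gains t^2 on the polydisc of radius
    t r. *)
Lemma power_sum_linear_approx n (a : midx n -> R) r M g t (z : 'rV[R]_n) :
  0 < r -> 0 <= t <= 1 -> power_sum a r M g -> (forall j, `|z 0 j| <= t * r) ->
  `|g z - a (idx0 n) - \sum_i a (incr_idx i (idx0 n)) * z 0 i| <= t ^+ 2 * M.
Proof.
move=> r0 t01 [aM ag] zr; have /andP[t0 t1] := t01.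
have zr' i : `|z 0 i| <= r by apply: le_trans (zr i) _; rewrite ler_piMl// ltW.
pose term l (k : midx n) := if k == l then a k * mon z k else 0.
have term_sum l : has_sum (term l) (a l * mon z l).
  rewrite (_ : a l * mon z l = term l l); last by rewrite /term eqxx.
  apply: has_sum_single => k.
  by rewrite /term => /negbTE ->.
have h := has_sumB (has_sumB (ag z zr') (term_sum (idx0 n)))
  (has_sum_sum (r := index_enum 'I_n) (fun i => term_sum (incr_idx i (idx0 n)))).
rewrite mon0 mulr1 in h; under eq_bigr do rewrite -mon_idx1.
apply: has_sum_norm_le h _.
have := abs_boundedZ (t ^+ 2) aM; rewrite ger0_norm ?sqr_ge0//; apply: abs_bounded_le => k.
have [->|k0] := eqVneq k (idx0 n).
  rewrite {1}/term eqxx subrr big1 ?subr0 ?normr0// => i _.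
  rewrite /term; case: eqP => // /ffunP/(_ i); by rewrite !ffunE eqxx.
have [[i ki]|kn] := pselect (exists i, k = incr_idx i (idx0 n)).
  rewrite {1}/term (negbTE k0) subr0 (bigD1 i)//= {1}/term ki eqxx.
  rewrite big1 ?addr0 ?subrr ?normr0// => j ji; rewrite /term; case: eqP => // /ffunP/(_ i).
  by rewrite !ffunE eqxx eq_sym (negbTE ji).
rewrite {1}/term (negbTE k0) subr0 big1 ?subr0; last first.
  by move=> i _; rewrite /term; case: eqP => // kE; case: kn; exists i.
rewrite mulrCA normrM [leRHS]normrM ler_wpM2l// -[leRHS]ger0_norm//.
have mr0 : 0 <= mon (const_mx r) k by apply: mon_const_ge0; exact: ltW.
apply: (@le_trans _ _ (mon (const_mx (t * r)) k)); first exact: mon_norm_le.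
have -> : mon (const_mx (t * r)) k = mon (const_mx t) k * mon (const_mx r) k.
  by rewrite /mon -big_split; apply: eq_bigr => j _; rewrite !mxE exprMn.
rewrite !normr_id [leRHS]ger0_norm ?mulr_ge0 ?sqr_ge0//.
apply: ler_wpM2r => //; apply: mon_degree2 => //.
by move=> i; apply/eqP => kE; apply: kn; exists i.
Qed.

Lemma analytic_differentiable n (f : 'rV[R]_n -> R) (p : 'rV[R]_n) :
  analytic_at f p -> differentiable f p.
Proof.
move=> /analytic_atP[r [M [r0 [a aM]]]].
have M0 : 0 <= M by exact: abs_bounded_ge0 aM.1.
pose c : 'cV[R]_n := \col_i a (incr_idx i (idx0 n)).
pose df (z : 'rV[R]_n) : R := (z *m c) 0 0.
have dfl : linear df by move=> k x y; rewrite /df mulmxDl -scalemxAl !mxE.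
pose L : {linear 'rV[R]_n -> R} := HB.pack df (GRing.isLinear.Build _ _ _ _ df dfl).
have LE z : L z = \sum_i a (incr_idx i (idx0 n)) * z 0 i.
  by rewrite /L /= /df !mxE; apply: eq_bigr => i _; rewrite mxE mulrC.
have Lc : continuous L.
  move=> x; rewrite (_ : L = \sum_i (fun z : 'rV[R]_n => a (incr_idx i (idx0 n)) * z 0 i) :> ('rV[R]_n -> R)); last first.
    by apply/funext => z; rewrite fct_sumE; exact: LE.
  apply: differentiable_continuous; apply: differentiable_sum => i.
  apply: differentiableM; first exact: differentiable_cst.
  exact: differentiable_coord.
have fL : f \o shift p = cst (f p) + (L : 'rV[R]_n -> R) +o_ (0 : 'rV[R]_n) id.
  apply/(@eqaddoP R 'rV[R]_n R 'rV[R]_n) => e e0.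
  have q0 : 0 < Num.min r (e * r ^+ 2 / (M + 1)).
    by rewrite lt_min r0 divr_gt0 ?mulr_gt0 ?exprn_gt0// ltr_wpDl.
  apply: filterS (@nbhs0_le _ 'rV[R]_n _ q0) => z zq.
  have zr : `|z| <= r by apply: le_trans zq _; rewrite ge_min lexx.
  pose t := `|z| / r.
  have t01 : 0 <= t <= 1 by rewrite divr_ge0 ?(ltW r0)//= ler_pdivrMr// mul1r.
  have zt j : `|z 0 j| <= t * r by rewrite divfK ?gt_eqF//; exact: coord_norm_le.
  have := power_sum_linear_approx r0 t01 aM zt.
  have f0 : f p = a (idx0 n).
    have := @power_sum_linear_approx _ _ _ _ _ 0 0 r0 _ aM.
    rewrite lexx ler01 => /(_ isT) /(_ _)/wrap[] => [j|]; first by rewrite mxE normr0 mul0r.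
    rewrite expr0n mul0r addr0 normr_le0 big1 => [|i _]; last by rewrite mxE mulr0.
    by rewrite subr0 subr_eq0 => /eqP.
  rewrite -f0 -LE [p + z]addrC => h; apply: le_trans (le_trans _ h) _.
    by rewrite le_eqVlt /=; apply/orP; left; apply/eqP; congr (`|_|); rewrite !fctE; ring.
  rewrite /t; have zM : `|z| * (M + 1) <= e * r ^+ 2.
    by rewrite -ler_pdivlMr ?ltr_wpDl//; apply: le_trans zq _; rewrite ge_min lexx orbT.
  rewrite exprMn exprVn mulrAC ler_pdivrMr ?exprn_gt0//.
  have := normr_ge0 z; nra.
apply/diff_locallyP; split.
  by rewrite (diff_unique Lc fL).
by rewrite (diff_unique Lc fL).
Qed.

End AnalyticDifferentiable.

(** * Partial derivatives of analytic maps *)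

(** Partial derivatives; they are locked so that conversion never unfolds a
    limit when two of them are compared. *)
HB.lock Definition pd (R : realType) n (i : 'I_n) (f : 'rV[R]_n -> R)
  (q : 'rV[R]_n) : R := 'D_(ebase i) f q.

HB.lock Definition vpd (R : realType) n m (i : 'I_n) (F : 'rV[R]_n -> 'rV[R]_m)
  (q : 'rV[R]_n) : 'rV[R]_m := 'D_(ebase i) F q.

Section Partials.
Context {R : realType}.
Implicit Types (n m : nat) (I J : choiceType) (r s M N : R).

Lemma pdE n i (f : 'rV[R]_n -> R) q : pd i f q = 'D_(ebase i) f q.
Proof. by rewrite pd.unlock. Qed.

Lemma vpdE n m i (F : 'rV[R]_n -> 'rV[R]_m) q : vpd i F q = 'D_(ebase i) F q.
Proof. by rewrite vpd.unlock. Qed.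

Lemma analytic_at_near n (f g : 'rV[R]_n -> R) p :
  (\forall q \near p, f q = g q) -> analytic_at f p -> analytic_at g p.
Proof.
move=> /nbhs_normP[e /= e0 fg] /analytic_atP[r [M [r0 [a [aM af]]]]].
have s0 : 0 < Num.min r (e / 2) by rewrite lt_min r0 divr_gt0.
have sr : 0 <= Num.min r (e / 2) <= r by rewrite (ltW s0) ge_min lexx.
have [b [bM bf]] := polyseries_radius sr (ex_intro _ a (conj aM af)).
apply/analytic_atP; exists (Num.min r (e / 2)), M; split => //.
exists b; split => // z zs; rewrite -fg; first exact: bf.
rewrite /= opprD addrA subrr sub0r normrN.
apply: (@le_lt_trans _ _ (e / 2)); last by rewrite ltr_pdivrMr// ltr_pMr// ltr1n.
apply: norm_row_le; first by rewrite divr_ge0// ltW.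
by move=> i; apply: le_trans (zs i) _; rewrite ge_min lexx orbT.
Qed.

Lemma map_analytic_at_near n m (f g : 'rV[R]_n -> 'rV[R]_m) p :
  (\forall q \near p, f q = g q) -> map_analytic_at f p -> map_analytic_at g p.
Proof.
by move=> fg fa j; apply: analytic_at_near (fa j); apply: filterS fg => q ->.
Qed.

Lemma power_sum_pd n (f : 'rV[R]_n -> R) p i (a : midx n -> R) r M :
  0 < r -> power_sum a r M (fun z => f (p + z)) ->
  power_sum (deriv_coef i a) (r / 2) (2 / r * M) (fun z => pd i f (p + z)).
Proof.
move=> r0 fa; have [g' [g'M g'S] hg'] := power_sum_deriv i r0 fa.
have M0 : 0 <= M := abs_bounded_ge0 fa.1.
split => // z zr; suff -> : pd i f (p + z) = g' z by exact: g'S.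
rewrite pdE /derive; apply/cvg_lim => //; apply/cvgrPdist_le => /= e e0.
have q0 : 0 < Num.min (r / 2) (e * (r / 2) ^+ 2 / (M + 1)).
  by rewrite lt_min divr_gt0//= divr_gt0 ?mulr_gt0 ?exprn_gt0 ?divr_gt0// ltr_wpDl.
near=> h.
have h0 : h != 0 by near: h; exact: nbhs_dnbhs_neq.
have hq : `|h| <= Num.min (r / 2) (e * (r / 2) ^+ 2 / (M + 1)).
  by near: h; exact: dnbhs0_le.
have hr : `|h| <= r / 2 by apply: le_trans hq _; rewrite ge_min lexx.
have := hg' z h zr hr.
rewrite (_ : p + (z + h *: ebase i) = h *: ebase i + (p + z)); last by rewrite addrA [RHS]addrC.
set D := f _ - f _ => hD.
have -> : g' z - h^-1 *: D = - (h^-1 * (D - h * g' z)) by rewrite /GRing.scale/=; field.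
rewrite normrN normrM normfV ler_pdivrMl ?normr_gt0//.
apply: le_trans hD _.
have hM : `|h| * (M + 1) <= e * (r / 2) ^+ 2.
  by rewrite -ler_pdivlMr ?ltr_wpDl//; apply: le_trans hq _; rewrite ge_min lexx orbT.
rewrite exprMn exprVn mulrAC ler_pdivrMr ?exprn_gt0 ?divr_gt0//.
rewrite -real_normK ?num_real//.
have := normr_ge0 h; nra.
Unshelve. all: by end_near. Qed.

Lemma analytic_pd n i (f : 'rV[R]_n -> R) p : analytic_at f p -> analytic_at (pd i f) p.
Proof.
move=> /analytic_atP[r [M [r0 [a fa]]]]; apply/analytic_atP.
exists (r / 2), (2 / r * M); split; first exact: divr_gt0.
by exists (deriv_coef i a); exact: power_sum_pd.
Qed.

(** Schwarz: on power series, partial derivatives act on the coefficients. *)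
Lemma analytic_pdC n i j (f : 'rV[R]_n -> R) p :
  analytic_at f p -> pd i (pd j f) p = pd j (pd i f) p.
Proof.
move=> /analytic_atP[r [M [r0 [a fa]]]].
have r2 : 0 < r / 2 by exact: divr_gt0.
have [_ h1] := power_sum_pd i r2 (power_sum_pd j r0 fa).
have [_ h2] := power_sum_pd j r2 (power_sum_pd i r0 fa).
have z0 (k : 'I_n) : `|(0 : 'rV[R]_n) 0 k| <= r / 2 / 2 by rewrite mxE normr0 !divr_ge0// ltW.
have := h1 0 z0; have := h2 0 z0; rewrite !addr0 => s2 s1.
apply: has_sum_unique s1 _; apply: eq_has_sum s2 => k; by rewrite deriv_coefC.
Qed.

Lemma map_analytic_differentiable n m (F : 'rV[R]_n -> 'rV[R]_m) p :
  map_analytic_at F p -> differentiable F p.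
Proof.
move=> Fa.
have -> : F = \sum_j (fun x => F x 0 j *: (delta_mx 0 j : 'rV[R]_m)).
  by apply/funext => x; rewrite fct_sumE [LHS]row_sum_delta.
apply: differentiable_sum => j; apply: differentiableZl.
exact: analytic_differentiable.
Qed.

Lemma analytic_continuous n (f : 'rV[R]_n -> R) p : analytic_at f p -> {for p, continuous f}.
Proof. by move=> /analytic_differentiable/differentiable_continuous. Qed.

Lemma map_analytic_continuous n m (F : 'rV[R]_n -> 'rV[R]_m) p :
  map_analytic_at F p -> {for p, continuous F}.
Proof. by move=> /map_analytic_differentiable/differentiable_continuous. Qed.

Lemma pd_coord n m i (F : 'rV[R]_n -> 'rV[R]_m) p j : differentiable F p ->
  vpd i F p 0 j = pd i (fun x => F x 0 j) p.
Proof. by move=> /diff_derivable dF; rewrite vpdE pdE derive_mx// mxE. Qed.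

Lemma map_analytic_vpd n m i (F : 'rV[R]_n -> 'rV[R]_m) p :
  map_analytic_at F p -> map_analytic_at (vpd i F) p.
Proof.
move=> Fa j; apply: analytic_at_near (analytic_pd i (Fa j)).
apply: filterS (map_analytic_near Fa) => q Fq.
by rewrite pd_coord//; exact: map_analytic_differentiable.
Qed.

Lemma near_eq_pd n i (f g : 'rV[R]_n -> R) (p : 'rV[R]_n) :
  (\forall q \near p, f q = g q) -> \forall q \near p, pd i f q = pd i g q.
Proof. by move=> /nbhs_interior; apply: filterS => q; rewrite !pdE; exact: near_eq_derive. Qed.

Lemma near_eq_vpd n m i (F G : 'rV[R]_n -> 'rV[R]_m) (p : 'rV[R]_n) :
  (\forall q \near p, F q = G q) -> \forall q \near p, vpd i F q = vpd i G q.
Proof. by move=> /nbhs_interior; apply: filterS => q; rewrite !vpdE; exact: near_eq_derive. Qed.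

Lemma map_analytic_vpdC n m i j (F : 'rV[R]_n -> 'rV[R]_m) p :
  map_analytic_at F p -> vpd i (vpd j F) p = vpd j (vpd i F) p.
Proof.
move=> Fa; apply/rowP => k.
have dF l : differentiable (vpd l F) p by exact: map_analytic_differentiable (map_analytic_vpd _ Fa).
rewrite [LHS](pd_coord i k (dF j)) [RHS](pd_coord j k (dF i)).
have E l : \forall q \near p, vpd l F q 0 k = pd l (fun x => F x 0 k) q.
  by apply: filterS (map_analytic_near Fa) => q /map_analytic_differentiable/pd_coord.
rewrite (nbhs_singleton (near_eq_pd i (E j))) (nbhs_singleton (near_eq_pd j (E i))).
exact: analytic_pdC.
Qed.

Lemma derive_chain (V : normedModType R) n m v (h : 'rV[R]_m -> V) (G : 'rV[R]_n -> 'rV[R]_m) q :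
  differentiable h (G q) -> differentiable G q ->
  'D_v (fun x => h (G x)) q = \sum_j 'D_v G q 0 j *: 'D_(ebase j) h (G q).
Proof.
move=> dh dG; rewrite deriveE; last exact: differentiable_comp.
rewrite (_ : (fun x => h (G x)) = h \o G)// diff_comp//=.
have -> : 'd G q v = 'D_v G q by rewrite deriveE.
rewrite {1}['D_v G q]row_sum_delta linear_sum; apply: eq_bigr => j _.
by rewrite linearZ; congr (_ *: _); symmetry; exact: deriveE.
Qed.

Lemma pd_chain n m i (h : 'rV[R]_m -> R) (G : 'rV[R]_n -> 'rV[R]_m) q :
  differentiable h (G q) -> differentiable G q ->
  pd i (fun x => h (G x)) q = \sum_j vpd i G q 0 j * pd j h (G q).
Proof. by move=> dh dG; rewrite pdE derive_chain//; apply: eq_bigr => j _; rewrite vpdE pdE. Qed.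

Lemma vpd_chain n m k i (h : 'rV[R]_m -> 'rV[R]_k) (G : 'rV[R]_n -> 'rV[R]_m) q :
  differentiable h (G q) -> differentiable G q ->
  vpd i (fun x => h (G x)) q = \sum_j vpd i G q 0 j *: vpd j h (G q).
Proof. by move=> dh dG; rewrite vpdE derive_chain//; apply: eq_bigr => j _; rewrite !vpdE. Qed.

Lemma row_jacobian n m i (F : 'rV[R]_n -> 'rV[R]_m) p :
  differentiable F p -> row i ('J F p) = vpd i F p.
Proof. by move=> dF; rewrite rowE vpdE deriveEjacobian. Qed.

End Partials.

(** * Product rules of higher order *)

Section Leibniz.
Context {R : realType}.
Implicit Types (n m : nat) (I J : choiceType) (r s M N : R).

Lemma map_analyticN n m (F : 'rV[R]_n -> 'rV[R]_m) p : map_analytic_at F p ->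
  map_analytic_at (fun x => - F x) p.
Proof.
move=> Fa j; have := analyticM (analytic_cst (-1) p) (Fa j).
by rewrite (_ : (fun x => _ * _) = (fun x => (- F x) 0 j))//; apply/funext => x; rewrite !mxE mulN1r.
Qed.

Lemma analytic_sum n (T : Type) (s : seq T) (f : T -> 'rV[R]_n -> R) p :
  (forall t, analytic_at (f t) p) -> analytic_at (fun x => \sum_(t <- s) f t x) p.
Proof.
move=> fa; elim: s => [|t s IH].
  rewrite (_ : (fun x => _) = (fun=> 0)); first exact: analytic_cst.
  by apply/funext => x; rewrite big_nil.
rewrite (_ : (fun x => _) = (fun x => f t x + \sum_(t <- s) f t x)); first exact: analyticD.
by apply/funext => x; rewrite big_cons.
Qed.

Lemma map_analyticZ n m (c : 'rV[R]_n -> R) (F : 'rV[R]_n -> 'rV[R]_m) p :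
  analytic_at c p -> map_analytic_at F p -> map_analytic_at (fun x => c x *: F x) p.
Proof.
move=> ca Fa j; have := analyticM ca (Fa j).
by rewrite (_ : (fun x => c x * _) = (fun x => (c x *: F x) 0 j))//; apply/funext => x; rewrite mxE.
Qed.

Lemma map_analyticD n m (F G : 'rV[R]_n -> 'rV[R]_m) p :
  map_analytic_at F p -> map_analytic_at G p -> map_analytic_at (fun x => F x + G x) p.
Proof.
move=> Fa Ga j; have := analyticD (Fa j) (Ga j).
by rewrite (_ : (fun x => _ + _) = (fun x => (F x + G x) 0 j))//; apply/funext => x; rewrite mxE.
Qed.

Lemma map_analytic_pt2 n (f g : 'rV[R]_n -> R) p :
  analytic_at f p -> analytic_at g p -> map_analytic_at (fun x => pt2 (f x) (g x)) p.
Proof.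
move=> fa ga; case=> -[|[|//]] j2.
  by rewrite (_ : (fun x => _) = f)//; apply/funext => x; rewrite mxE.
by rewrite (_ : (fun x => _) = g)//; apply/funext => x; rewrite mxE.
Qed.

Lemma pdM n i (f g : 'rV[R]_n -> R) p : differentiable f p -> differentiable g p ->
  pd i (fun q => f q * g q) p = pd i f p * g p + f p * pd i g p.
Proof.
move=> /diff_derivable df /diff_derivable dg.
rewrite !pdE (_ : (fun q => f q * g q) = f * g)// deriveM// /GRing.scale/=.
by rewrite addrC mulrC.
Qed.

Lemma pdD n i (f g : 'rV[R]_n -> R) p : differentiable f p -> differentiable g p ->
  pd i (fun q => f q + g q) p = pd i f p + pd i g p.
Proof. by move=> /diff_derivable df /diff_derivable dg; rewrite !pdE; exact: deriveD. Qed.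

Lemma vpdD n m i (f g : 'rV[R]_n -> 'rV[R]_m) p :
  differentiable f p -> differentiable g p ->
  vpd i (fun q => f q + g q) p = vpd i f p + vpd i g p.
Proof. by move=> /diff_derivable df /diff_derivable dg; rewrite !vpdE; exact: deriveD. Qed.

Lemma vpdZ n m i (c : 'rV[R]_n -> R) (W : 'rV[R]_n -> 'rV[R]_m) p :
  analytic_at c p -> map_analytic_at W p ->
  vpd i (fun q => c q *: W q) p = pd i c p *: W p + c p *: vpd i W p.
Proof.
move=> ca Wa; have dW := map_analytic_differentiable Wa.
have dcW := map_analytic_differentiable (map_analyticZ ca Wa).
apply/rowP => j; rewrite (pd_coord i j dcW) !mxE (pd_coord i j dW).
rewrite (_ : (fun x => _) = (fun x => c x * W x 0 j)).
  by apply: pdM; apply: analytic_differentiable.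
by apply/funext => x; rewrite mxE.
Qed.

Lemma analytic_dot3 n (A B : 'rV[R]_n -> 'rV[R]_3) p :
  map_analytic_at A p -> map_analytic_at B p -> analytic_at (fun q => dot3 (A q) (B q)) p.
Proof. by move=> Aa Ba; apply: analytic_sum => k; exact: analyticM. Qed.

Lemma pd_dot3 n i (A B : 'rV[R]_n -> 'rV[R]_3) p :
  map_analytic_at A p -> map_analytic_at B p ->
  pd i (fun q => dot3 (A q) (B q)) p = dot3 (vpd i A p) (B p) + dot3 (A p) (vpd i B p).
Proof.
move=> Aa Ba.
have dA := map_analytic_differentiable Aa; have dB := map_analytic_differentiable Ba.
rewrite pdE (_ : (fun q => _) = \sum_k (fun q => A q 0 k * B q 0 k)); last first.
  by apply/funext => q; rewrite fct_sumE.
rewrite derive_sum => [|k]; last first.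
  by apply: diff_derivable; apply: differentiableM; exact: analytic_differentiable.
rewrite /dot3 -big_split; apply: eq_bigr => k _ /=.
rewrite (pd_coord i k dA) (pd_coord i k dB).
by rewrite -pdE; apply: pdM; exact: analytic_differentiable.
Qed.

Lemma pd_dot3_2 n i j (A B : 'rV[R]_n -> 'rV[R]_3) p :
  map_analytic_at A p -> map_analytic_at B p ->
  pd i (pd j (fun q => dot3 (A q) (B q))) p =
  dot3 (vpd i (vpd j A) p) (B p) + dot3 (vpd j A p) (vpd i B p) +
  dot3 (vpd i A p) (vpd j B p) + dot3 (A p) (vpd i (vpd j B) p).
Proof.
move=> Aa Ba.
have E : \forall q \near p, pd j (fun q => dot3 (A q) (B q)) q =
    dot3 (vpd j A q) (B q) + dot3 (A q) (vpd j B q).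
  by near=> q; apply: pd_dot3; near: q; exact: map_analytic_near.
have Aj := map_analytic_vpd j Aa; have Bj := map_analytic_vpd j Ba.
rewrite (nbhs_singleton (near_eq_pd i E)) pdD; last 2 first.
- by apply: analytic_differentiable; exact: analytic_dot3.
- by apply: analytic_differentiable; exact: analytic_dot3.
by rewrite (pd_dot3 i Aj Ba) (pd_dot3 i Aa Bj) addrA.
Unshelve. all: by end_near. Qed.

Lemma pd_dot3_3 n i (A B : 'rV[R]_n -> 'rV[R]_3) p :
  map_analytic_at A p -> map_analytic_at B p ->
  pd i (pd i (pd i (fun q => dot3 (A q) (B q)))) p =
  dot3 (vpd i (vpd i (vpd i A)) p) (B p) + 3 * dot3 (vpd i (vpd i A) p) (vpd i B p) +
  3 * dot3 (vpd i A p) (vpd i (vpd i B) p) + dot3 (A p) (vpd i (vpd i (vpd i B)) p).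
Proof.
move=> Aa Ba.
have E : \forall q \near p, pd i (fun q => dot3 (A q) (B q)) q =
    dot3 (vpd i A q) (B q) + dot3 (A q) (vpd i B q).
  by near=> q; apply: pd_dot3; near: q; exact: map_analytic_near.
have Ai := map_analytic_vpd i Aa; have Bi := map_analytic_vpd i Ba.
rewrite (nbhs_singleton (near_eq_pd i (near_eq_pd i E))).
have E2 : \forall q \near p, pd i (fun q => dot3 (vpd i A q) (B q) + dot3 (A q) (vpd i B q)) q =
   pd i (fun q => dot3 (vpd i A q) (B q)) q + pd i (fun q => dot3 (A q) (vpd i B q)) q.
  near=> q; apply: pdD; apply: analytic_differentiable; near: q; apply: analytic_near;
    exact: analytic_dot3.
rewrite (nbhs_singleton (near_eq_pd i E2)) pdD; last 2 first.
- by apply: analytic_differentiable; apply: analytic_pd; exact: analytic_dot3.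
- by apply: analytic_differentiable; apply: analytic_pd; exact: analytic_dot3.
by rewrite (pd_dot3_2 i i Ai Ba) (pd_dot3_2 i i Aa Bi); ring.
Unshelve. all: by end_near. Qed.

Lemma pd_cube n i (y : 'rV[R]_n -> R) p : analytic_at y p -> y p = 0 ->
  pd i (pd i (pd i (fun q => y q ^+ 3))) p = 6 * pd i y p ^+ 3.
Proof.
move=> ya y0.
have y2a : analytic_at (fun q => y q * y q) p by exact: analyticM.
have dy : \forall q \near p, differentiable y q.
  by near=> q; apply: analytic_differentiable; near: q; exact: analytic_near.
have dy' : \forall q \near p, differentiable (pd i y) q.
  by near=> q; apply: analytic_differentiable; near: q; apply: analytic_near; exact: analytic_pd.
have E1 : \forall q \near p, pd i (fun q => y q ^+ 3) q = 3 * (y q * y q) * pd i y q.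
  near=> q.
  have dq : differentiable y q by near: q.
  rewrite (_ : (fun q => y q ^+ 3) = (fun q => y q * (y q * y q))); last first.
    by apply/funext => x; rewrite !exprS expr0 mulr1.
  rewrite pdM//; last exact: differentiableM.
  by rewrite pdM//; ring.
rewrite (nbhs_singleton (near_eq_pd i (near_eq_pd i E1))).
have E2 : \forall q \near p, pd i (fun q => 3 * (y q * y q) * pd i y q) q =
    y q * (6 * pd i y q * pd i y q + 3 * y q * pd i (pd i y) q).
  near=> q.
  have dq : differentiable y q by near: q.
  have dq' : differentiable (pd i y) q by near: q.
  rewrite pdM//; last by do ?[exact: differentiableM|apply: differentiableM].
  rewrite pdM//; last exact: differentiableM.
  by rewrite pdM// [pd i (fun=> _) q]pdE derive_cst; ring.
rewrite (nbhs_singleton (near_eq_pd i E2)) pdM.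
- by rewrite y0 mul0r addr0 mulr0 mul0r addr0; ring.
- exact: nbhs_singleton dy.
- apply: analytic_differentiable; apply: analyticD; apply: analyticM.
  + by apply: analyticM; [exact: analytic_cst|exact: analytic_pd].
  + exact: analytic_pd.
  + by apply: analyticM; [exact: analytic_cst|].
  + by apply: analytic_pd; exact: analytic_pd.
Unshelve. all: by end_near. Qed.

Lemma vpd_chain2 n m k i (h : 'rV[R]_m -> 'rV[R]_k) (G : 'rV[R]_n -> 'rV[R]_m) q :
  map_analytic_at h (G q) -> map_analytic_at G q ->
  vpd i (vpd i (fun x => h (G x))) q =
  \sum_j (vpd i (vpd i G) q 0 j *: vpd j h (G q) +
          vpd i G q 0 j *: \sum_l vpd i G q 0 l *: vpd l (vpd j h) (G q)).
Proof.
move=> ha Ga.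
have dG := map_analytic_differentiable Ga.
have dG' : differentiable (vpd i G) q by apply: map_analytic_differentiable; exact: map_analytic_vpd.
have E : \forall x \near q, vpd i (fun x => h (G x)) x = \sum_j vpd i G x 0 j *: vpd j h (G x).
  near=> x; apply: vpd_chain; last first.
    by apply: map_analytic_differentiable; near: x; exact: map_analytic_near.
  apply: map_analytic_differentiable; near: x.
  by apply: (map_analytic_continuous Ga); exact: map_analytic_near.
rewrite (nbhs_singleton (near_eq_vpd i E)) vpdE.
rewrite (_ : (fun x => \sum_j _) = \sum_j (fun x => vpd i G x 0 j *: vpd j h (G x))); last first.
  by apply/funext => x; rewrite fct_sumE.
have hja j : map_analytic_at (fun x => vpd j h (G x)) q.
  by apply: map_analytic_comp => //; exact: map_analytic_vpd.
have Gja j : analytic_at (fun x => vpd i G x 0 j) q by exact: map_analytic_vpd.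
rewrite derive_sum => [|j]; last first.
  apply: diff_derivable; apply: map_analytic_differentiable.
  exact: map_analyticZ.
apply: eq_bigr => j _; rewrite -vpdE vpdZ//.
congr (_ *: _ + _ *: _); first by rewrite pd_coord.
by apply: vpd_chain => //; apply: map_analytic_differentiable; exact: map_analytic_vpd.
Unshelve. all: by end_near. Qed.

End Leibniz.

(** * The first fundamental form along a singular axis *)

Section AxisCalculus.
Context {R : realType}.
Implicit Types (n m : nat) (I J : choiceType) (r s M N : R).

Lemma dot3E (x y : 'rV[R]_3) :
  dot3 x y = x 0 0 * y 0 0 + x 0 1 * y 0 1 + x 0 2 * y 0 2.
Proof.
rewrite /dot3 !big_ord_recl big_ord0 addr0 addrA.
by congr (_ * _ + _ * _ + _ * _); congr (_ 0 _); apply: val_inj.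
Qed.

Lemma dot3C (x y : 'rV[R]_3) : dot3 x y = dot3 y x.
Proof. by rewrite !dot3E; ring. Qed.

Lemma dot3Dl (x y z : 'rV[R]_3) : dot3 (x + y) z = dot3 x z + dot3 y z.
Proof. by rewrite !dot3E !mxE; ring. Qed.

Lemma dot3Dr (x y z : 'rV[R]_3) : dot3 x (y + z) = dot3 x y + dot3 x z.
Proof. by rewrite !dot3E !mxE; ring. Qed.

Lemma dot3Zl a (x z : 'rV[R]_3) : dot3 (a *: x) z = a * dot3 x z.
Proof. by rewrite !dot3E !mxE; ring. Qed.

Lemma dot3Zr a (x z : 'rV[R]_3) : dot3 x (a *: z) = a * dot3 x z.
Proof. by rewrite !dot3E !mxE; ring. Qed.

Lemma dot3Nl (x z : 'rV[R]_3) : dot3 (- x) z = - dot3 x z.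
Proof. by rewrite !dot3E !mxE; ring. Qed.

Lemma dot3Nr (x z : 'rV[R]_3) : dot3 x (- z) = - dot3 x z.
Proof. by rewrite !dot3E !mxE; ring. Qed.

Lemma dot30l (x : 'rV[R]_3) : dot3 0 x = 0.
Proof. by rewrite !dot3E !mxE; ring. Qed.

Lemma dot30r (x : 'rV[R]_3) : dot3 x 0 = 0.
Proof. by rewrite dot3C dot30l. Qed.

Lemma dot3_ge0 (x : 'rV[R]_3) : 0 <= dot3 x x.
Proof. by rewrite dot3E; nra. Qed.

Lemma dot3_eq0 (x : 'rV[R]_3) : dot3 x x = 0 -> x = 0.
Proof.
rewrite dot3E => h.
have h0 : x 0 0 = 0 by nra.
have h1 : x 0 1 = 0 by nra.
have h2 : x 0 2 = 0 by nra.
apply/rowP => -[[|[|[|//]]] i3]; rewrite mxE.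
- by rewrite -[RHS]h0; congr (x 0 _); exact: val_inj.
- by rewrite -[RHS]h1; congr (x 0 _); exact: val_inj.
- by rewrite -[RHS]h2; congr (x 0 _); exact: val_inj.
Qed.

(** The Gram determinant of three vectors is the square of their determinant. *)
Lemma gram_cross (w a b : 'rV[R]_3) :
  dot3 w w * (dot3 a a * dot3 b b - dot3 a b ^+ 2) =
  dot3 w (cross3 a b) ^+ 2 + dot3 w a ^+ 2 * dot3 b b + dot3 w b ^+ 2 * dot3 a a -
  2 * dot3 w a * dot3 w b * dot3 a b.
Proof. by rewrite !dot3E /cross3 /pt3 !mxE /=; ring. Qed.

Lemma ord2P (i : 'I_2) : i = 0 \/ i = 1.
Proof. by case: i => -[|[|//]] i2; [left|right]; apply: val_inj. Qed.

Lemma pt2_eta (q : 'rV[R]_2) : pt2 (q 0 0) (q 0 1) = q.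
Proof. by apply/rowP => i; case: (ord2P i) => ->; rewrite mxE. Qed.

Lemma pt2_0 (u v : R) : pt2 u v 0 0 = u. Proof. by rewrite mxE. Qed.
Lemma pt2_1 (u v : R) : pt2 u v 0 1 = v. Proof. by rewrite mxE. Qed.

Implicit Types (q : 'rV[R]_2).

Definition near_axis (q0 : 'rV[R]_2) (P : 'rV[R]_2 -> Prop) : Prop :=
  nbhs q0 [set q : 'rV[R]_2 | q 0 1 = 0 -> P q].

Lemma near_axisW q0 (P Q : 'rV[R]_2 -> Prop) :
  (forall q, P q -> Q q) -> near_axis q0 P -> near_axis q0 Q.
Proof. by move=> PQ; rewrite /near_axis; apply: filterS => q Pq q1; apply: PQ; exact: Pq. Qed.

Lemma near_axisI q0 (P Q S : 'rV[R]_2 -> Prop) :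
  (forall q, P q -> Q q -> S q) -> nbhs q0 P -> near_axis q0 Q -> near_axis q0 S.
Proof.
by move=> PQS; rewrite /near_axis; apply: filterS2 => q Pq Qq q1; apply: PQS; [|exact: Qq].
Qed.

Lemma near_axis_at q0 (P : 'rV[R]_2 -> Prop) : near_axis q0 P -> q0 0 1 = 0 -> P q0.
Proof. by move=> /nbhs_singleton. Qed.

(** The axis is invariant under translations in the first direction. *)
Lemma derive_on_axis (V : normedModType R) (F : 'rV[R]_2 -> V) (q0 : 'rV[R]_2) :
  near_axis q0 (fun q => F q = 0) ->
  near_axis q0 (fun q => 'D_(ebase 0) F q = 0).
Proof.
rewrite /near_axis => /nbhs_interior; apply: filterS => q Fq q1.
rewrite /derive; apply/cvg_lim => //.
apply: cvg_near_cst; have Fq0 : F q = 0 by exact: nbhs_singleton Fq q1.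
have cq : (fun h : R => h *: ebase 0 + q : 'rV[R]_2) @ 0 --> q.
  have := @cvgD _ _ _ _ _ (fun h : R => h *: (ebase 0 : 'rV[R]_2)) (fun=> q) 0 q.
  rewrite add0r; apply; last exact: cvg_cst.
  by rewrite -[X in _ --> X](scale0r (ebase 0 : 'rV[R]_2)); apply: cvgZr_tmp; exact: cvg_id.
have := cq _ Fq; rewrite near_simpl => /nbhs_dnbhs; apply: filterS => h /= Fh.
rewrite Fh ?Fq0 ?subrr ?scaler0//.
by rewrite !mxE q1 /= mulr0 addr0.
Qed.

Lemma pd0_on_axis (f : 'rV[R]_2 -> R) (q0 : 'rV[R]_2) :
  near_axis q0 (fun q => f q = 0) ->
  near_axis q0 (fun q => pd 0 f q = 0).
Proof. by move=> /derive_on_axis; apply: near_axisW => q; rewrite pdE. Qed.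

Lemma vpd0_on_axis m (F : 'rV[R]_2 -> 'rV[R]_m) (q0 : 'rV[R]_2) :
  near_axis q0 (fun q => F q = 0) ->
  near_axis q0 (fun q => vpd 0 F q = 0).
Proof. by move=> /derive_on_axis; apply: near_axisW => q; rewrite vpdE. Qed.

Definition same_gram (F G : 'rV[R]_2 -> 'rV[R]_3) (q : 'rV[R]_2) : Prop :=
  forall i j, dot3 (vpd i F q) (vpd j F q) = dot3 (vpd i G q) (vpd j G q).

Lemma near_vpdC n m i j (F : 'rV[R]_n -> 'rV[R]_m) p : map_analytic_at F p ->
  nbhs p [set x | vpd i (vpd j F) x = vpd j (vpd i F) x].
Proof.
by move=> Fa; apply: filterS (map_analytic_near Fa) => x Fx; exact: map_analytic_vpdC.
Qed.

(** On the axis F_v and F_uv vanish, which leaves one term of each Leibniz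
    expansion; the last identity is the Christoffel formula for F_uu . F_vv. *)
Lemma gram_on_axis (F : 'rV[R]_2 -> 'rV[R]_3) q0 :
  map_analytic_at F q0 -> q0 0 1 = 0 -> near_axis q0 (fun q => vpd 1 F q = 0) ->
  let gram i j q := dot3 (vpd i F q) (vpd j F q) in
  [/\ pd 1 (gram 0 1) q0 = dot3 (vpd 0 F q0) (vpd 1 (vpd 1 F) q0),
      pd 1 (pd 1 (gram 1 1)) q0 = 2 * dot3 (vpd 1 (vpd 1 F) q0) (vpd 1 (vpd 1 F) q0) &
      2 * pd 0 (pd 1 (gram 0 1)) q0 - pd 1 (pd 1 (gram 0 0)) q0 =
        2 * dot3 (vpd 0 (vpd 0 F) q0) (vpd 1 (vpd 1 F) q0)].
Proof.
move=> Fa q01 F1 gram.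
have F1q : vpd 1 F q0 = 0 by exact: near_axis_at F1 q01.
have F01 : vpd 0 (vpd 1 F) q0 = 0 by exact: near_axis_at (vpd0_on_axis F1) q01.
have F10 : vpd 1 (vpd 0 F) q0 = 0 by rewrite map_analytic_vpdC.
have A0 := map_analytic_vpd 0 Fa; have A1 := map_analytic_vpd 1 Fa.
split.
- by rewrite (pd_dot3 1 A0 A1) F1q dot30r add0r.
- by rewrite (pd_dot3_2 1 1 A1 A1) F1q dot30r dot30l; ring.
rewrite (pd_dot3_2 0 1 A0 A1) (pd_dot3_2 1 1 A0 A0) F1q F01 F10 dot30r !dot30l.
have -> : vpd 0 (vpd 1 (vpd 1 F)) q0 = vpd 1 (vpd 1 (vpd 0 F)) q0.
  rewrite (map_analytic_vpdC 0 1 A1).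
  exact: nbhs_singleton (near_eq_vpd 1 (near_vpdC 0 1 Fa)).
by rewrite (dot3C (vpd 1 (vpd 1 (vpd 0 F)) q0)); ring.
Qed.

(** The second order data of a map along its singular axis that its first
    fundamental form determines; the singular curvature is built from them. *)
Lemma same_gram_on_axis (F G : 'rV[R]_2 -> 'rV[R]_3) q0 :
  map_analytic_at F q0 -> map_analytic_at G q0 -> q0 0 1 = 0 ->
  near_axis q0 (fun q => vpd 1 F q = 0) -> near_axis q0 (fun q => vpd 1 G q = 0) ->
  nbhs q0 (same_gram F G) ->
  [/\ dot3 (vpd 0 F q0) (vpd 1 (vpd 1 F) q0) = dot3 (vpd 0 G q0) (vpd 1 (vpd 1 G) q0),
      dot3 (vpd 1 (vpd 1 F) q0) (vpd 1 (vpd 1 F) q0) =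
        dot3 (vpd 1 (vpd 1 G) q0) (vpd 1 (vpd 1 G) q0) &
      dot3 (vpd 0 (vpd 0 F) q0) (vpd 1 (vpd 1 F) q0) =
        dot3 (vpd 0 (vpd 0 G) q0) (vpd 1 (vpd 1 G) q0)].
Proof.
move=> Fa Ga q01 F1 G1 FG.
have [f1 f2 f3] := gram_on_axis Fa q01 F1; have [g1 g2 g3] := gram_on_axis Ga q01 G1.
have E i j : \forall q \near q0, dot3 (vpd i F q) (vpd j F q) = dot3 (vpd i G q) (vpd j G q).
  by apply: filterS FG => q; exact.
have E1 i j := near_eq_pd 1 (E i j).
rewrite (nbhs_singleton (E1 0 1)) in f1.
rewrite (nbhs_singleton (near_eq_pd 1 (E1 1 1))) in f2.
rewrite (nbhs_singleton (near_eq_pd 0 (E1 0 1))) (nbhs_singleton (near_eq_pd 1 (E1 0 0))) in f3.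
split; [by rewrite -f1 -g1|by move: f2; rewrite g2; lra|by move: f3; rewrite g3; lra].
Qed.

Definition vflip (q : 'rV[R]_2) : 'rV[R]_2 := pt2 (q 0 0) (- q 0 1).

Lemma vflip_axis q : q 0 1 = 0 -> vflip q = q.
Proof. by move=> q1; rewrite /vflip q1 oppr0 -{2}[q]pt2_eta q1. Qed.

Lemma vflip_analytic q : map_analytic_at vflip q.
Proof.
apply: map_analytic_pt2; first exact: analytic_coord.
rewrite (_ : (fun x => _) = (fun x : 'rV[R]_2 => -1 * x 0 1)).
  by apply: analyticM; [exact: analytic_cst|exact: analytic_coord].
by apply/funext => x; rewrite mulN1r.
Qed.

Lemma pd_coord2 i j (q : 'rV[R]_2) : pd i (fun x => x 0 j) q = (i == j)%:R.
Proof.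
have ida : map_analytic_at (fun x : 'rV[R]_2 => x) q by move=> k; exact: analytic_coord.
rewrite -(pd_coord i j (map_analytic_differentiable ida)) vpdE derive_id.
by rewrite /ebase mxE eqxx eq_sym.
Qed.

Lemma vpd_vflip i q : vpd i vflip q = pt2 (i == 0)%:R (- (i == 1)%:R).
Proof.
apply/rowP => j; rewrite pd_coord; last exact: map_analytic_differentiable (vflip_analytic q).
case: (ord2P j) => ->.
  rewrite (_ : (fun x => _) = (fun x : 'rV[R]_2 => x 0 0)); last by apply/funext => x; rewrite mxE.
  by rewrite pd_coord2 mxE.
rewrite (_ : (fun x => _) = (fun x : 'rV[R]_2 => -1 * x 0 1)); last first.
  by apply/funext => x; rewrite mxE /= mulN1r.
rewrite pdM; [|exact: differentiable_cst|exact: analytic_differentiable (analytic_coord _ _)].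
by rewrite [pd i (fun=> -1) q]pdE derive_cst mul0r add0r pd_coord2 mulN1r mxE.
Qed.

Lemma pd1_vflip (g : 'rV[R]_2 -> R) q : analytic_at g (vflip q) ->
  pd 1 (fun x => g (vflip x)) q = - pd 1 g (vflip q).
Proof.
move=> ga; rewrite pd_chain; last 2 first.
- exact: analytic_differentiable.
- exact: map_analytic_differentiable (vflip_analytic q).
rewrite vpd_vflip big_ord_recl big_ord1 !mxE /= mul0r add0r mulN1r; congr (- pd _ _ _).
exact: val_inj.
Qed.

Lemma parity_pd1 (s : R) (g : 'rV[R]_2 -> R) q0 : analytic_at g q0 -> q0 0 1 = 0 ->
  (\forall q \near q0, g (vflip q) = s * g q) ->
  \forall q \near q0, pd 1 g (vflip q) = - s * pd 1 g q.
Proof.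
move=> ga q01 gs.
have fa := map_analytic_continuous (vflip_analytic q0).
have ga' : \forall q \near q0, analytic_at g (vflip q).
  by apply: fa; rewrite vflip_axis//; exact: analytic_near.
have := near_eq_pd 1 gs; apply: filterS3 ga' (analytic_near ga) => q h1 h2.
rewrite pd1_vflip// pdM; [|exact: differentiable_cst|exact: analytic_differentiable].
by rewrite [pd 1 (fun=> s) q]pdE derive_cst mul0r add0r mulNr => <-; rewrite opprK.
Qed.

(** If the first fundamental form is invariant under reflection in the
    singular axis, the cubic term of the map in the transverse variable is
    orthogonal to the osculating data of the axis: the Gram coefficients E and G
    are even and F is odd, which annihilates one transverse derivative of each. *)
Lemma vflip_invariant_cubic (F : 'rV[R]_2 -> 'rV[R]_3) q0 :
  map_analytic_at F q0 -> q0 0 1 = 0 -> near_axis q0 (fun q => vpd 1 F q = 0) ->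
  (\forall q \near q0, forall i j,
     dot3 (vpd i F (vflip q)) (vpd j F (vflip q)) =
     (-1) ^+ (i != j) * dot3 (vpd i F q) (vpd j F q)) ->
  let F3 := vpd 1 (vpd 1 (vpd 1 F)) q0 in
  [/\ dot3 (vpd 0 F q0) F3 = 0, dot3 (vpd 1 (vpd 1 F) q0) F3 = 0 &
      dot3 (vpd 0 (vpd 0 F) q0) F3 = 0].
Proof.
move=> Fa q01 F1 FF F3.
have A0 := map_analytic_vpd 0 Fa; have A1 := map_analytic_vpd 1 Fa.
have A11 := map_analytic_vpd 1 A1; have A111 := map_analytic_vpd 1 A11.
pose E i j q := dot3 (vpd i F q) (vpd j F q).
have Ea i j : analytic_at (E i j) q0 by apply: analytic_dot3; exact: map_analytic_vpd.
have E1a i j : analytic_at (pd 1 (E i j)) q0 by exact: analytic_pd.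
have E2a i j : analytic_at (pd 1 (pd 1 (E i j))) q0 by exact: analytic_pd.
have P0 i j : \forall q \near q0, E i j (vflip q) = (-1) ^+ (i != j) * E i j q.
  by apply: filterS FF => q; exact.
have P2 i j := parity_pd1 (E1a i j) q01 (parity_pd1 (Ea i j) q01 (P0 i j)).
have P3 i j := parity_pd1 (E2a i j) q01 (P2 i j).
have Eiii i : pd 1 (pd 1 (pd 1 (E i i))) q0 = 0.
  have := nbhs_singleton (P3 i i); rewrite vflip_axis// eqxx expr0 opprK; lra.
have E01 : near_axis q0 (fun q => pd 1 (pd 1 (E 0 1)) q = 0).
  apply: filterS (P2 0 1) => q + q1; rewrite vflip_axis// /= expr1 opprK; lra.
have F01 : near_axis q0 (fun q => vpd 0 (vpd 1 F) q = 0) by exact: vpd0_on_axis.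
have F10 : near_axis q0 (fun q => vpd 1 (vpd 0 F) q = 0).
  by apply: near_axisI (near_vpdC 0 1 Fa) F01 => q /= ->.
have F1q := near_axis_at F1 q01; have F10q := near_axis_at F10 q01.
have F0F3 : near_axis q0 (fun q => dot3 (vpd 0 F q) (vpd 1 (vpd 1 (vpd 1 F)) q) = 0).
  rewrite /near_axis; near=> q => q1.
  have E01q : q 0 1 = 0 -> pd 1 (pd 1 (E 0 1)) q = 0 by near: q.
  have F1q' : q 0 1 = 0 -> vpd 1 F q = 0 by near: q.
  have F10q' : q 0 1 = 0 -> vpd 1 (vpd 0 F) q = 0 by near: q.
  have A0q : map_analytic_at (vpd 0 F) q by near: q; exact: map_analytic_near.
  have A1q : map_analytic_at (vpd 1 F) q by near: q; exact: map_analytic_near.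
  have := E01q q1; rewrite (pd_dot3_2 1 1 A0q A1q) F1q'// F10q'//.
  by rewrite dot30r !dot30l !add0r.
split; first exact: near_axis_at F0F3 q01.
  have := Eiii 1; rewrite (pd_dot3_3 1 A1 A1) F1q dot30r dot30l -/F3.
  rewrite (dot3C F3); lra.
have := near_axis_at (pd0_on_axis F0F3) q01; rewrite (pd_dot3 0 A0 A111) -/F3.
have -> : vpd 0 (vpd 1 (vpd 1 (vpd 1 F))) q0 = vpd 1 (vpd 1 (vpd 1 (vpd 0 F))) q0.
  rewrite (map_analytic_vpdC 0 1 A11) (nbhs_singleton (near_eq_vpd 1 (near_vpdC 0 1 A1))).
  exact: nbhs_singleton (near_eq_vpd 1 (near_eq_vpd 1 (near_vpdC 0 1 Fa))).
have := Eiii 0; rewrite (pd_dot3_3 1 A0 A0) F10q dot30r dot30l.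
rewrite (dot3C (vpd 1 (vpd 1 (vpd 1 (vpd 0 F))) q0)); lra.
Unshelve. all: by end_near. Qed.

End AxisCalculus.

(** * Charts of edges and the cubic term *)

Section Chart.
Context {R : realType}.
Implicit Types (q : 'rV[R]_2).

Definition jdet (chi : 'rV[R]_2 -> 'rV[R]_2) q : R :=
  vpd 0 chi q 0 0 * vpd 1 chi q 0 1 - vpd 0 chi q 0 1 * vpd 1 chi q 0 0.

Lemma sum2 (V : nmodType) (f : 'I_2 -> V) : \sum_i f i = f 0 + f 1.
Proof. by rewrite big_ord_recl big_ord1; congr (_ + f _); exact: val_inj. Qed.

(** The chain rule makes the Jacobian determinants of inverse maps inverse to
    each other. *)
Lemma jdet_neq0 (chi psi : 'rV[R]_2 -> 'rV[R]_2) q :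
  map_analytic_at chi q -> map_analytic_at psi (chi q) ->
  (\forall x \near q, psi (chi x) = x) -> jdet chi q != 0.
Proof.
move=> chia psia inv.
have E i : vpd i (fun x => psi (chi x)) q = ebase i.
  by rewrite (nbhs_singleton (near_eq_vpd i inv)) vpdE derive_id.
have C i := vpd_chain i (map_analytic_differentiable psia) (map_analytic_differentiable chia).
have H i j : (i == j)%:R = vpd i chi q 0 0 * vpd 0 psi (chi q) 0 j +
                           vpd i chi q 0 1 * vpd 1 psi (chi q) 0 j.
  have := congr1 (fun M : 'rV[R]_2 => M 0 j) (C i).
  by rewrite E sum2 !mxE eqxx /= eq_sym.
apply/eqP => d0.
have detM (e00 e11 e01 e10 a b c d a' b' c' d' : R) :
    e00 = a * a' + b * c' -> e11 = c * b' + d * d' -> e01 = a * b' + b * d' ->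
    e10 = c * a' + d * c' -> e00 * e11 - e01 * e10 = (a * d - b * c) * (a' * d' - b' * c').
  by move=> -> -> -> ->; ring.
have := detM _ _ _ _ _ _ _ _ _ _ _ _ (H 0 0) (H 1 1) (H 0 1) (H 1 0).
by move/eqP; rewrite -/(jdet chi q) d0 !eqxx /= !(mul0r, mulr0n, subr0, mulr1) oner_eq0.
Qed.

Lemma analytic_jdet chi q : map_analytic_at chi q -> analytic_at (jdet chi) q.
Proof.
move=> chia.
have va i j : analytic_at (fun x => vpd i chi x 0 j) q by exact: map_analytic_vpd.
have := analyticD (analyticM (va 0 0) (va 1 1))
  (analyticM (analytic_cst (-1) q) (analyticM (va 0 1) (va 1 0))).
by rewrite (_ : (fun x => _ + _) = jdet chi)//; apply/funext => x; rewrite mulN1r.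
Qed.

Lemma near_neq0 (g : 'rV[R]_2 -> R) q : analytic_at g q -> g q != 0 ->
  nbhs q [set x | g x != 0].
Proof.
move=> /analytic_continuous gc g0; apply: (gc [set y : R | y != 0]).
exact: open_nbhs_nbhs (conj (@open_neq R 0) g0).
Qed.

(** A nonzero Gram determinant is linear independence. *)
Lemma gram_indep (x y : 'rV[R]_3) a b :
  dot3 x x * dot3 y y - dot3 x y ^+ 2 != 0 -> a *: x + b *: y = 0 -> a = 0 /\ b = 0.
Proof.
move=> D0 E.
have hx : a * dot3 x x + b * dot3 x y = 0.
  by have := congr1 (dot3 x) E; rewrite dot3Dr !dot3Zr dot30r.
have hy : a * dot3 x y + b * dot3 y y = 0.
  by have := congr1 (dot3 y) E; rewrite dot3Dr !dot3Zr dot30r [dot3 y x]dot3C.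
split; apply: (mulIf D0); rewrite mul0r.
  have -> : a * (dot3 x x * dot3 y y - dot3 x y ^+ 2) =
    (a * dot3 x x + b * dot3 x y) * dot3 y y - (a * dot3 x y + b * dot3 y y) * dot3 x y by ring.
  by rewrite hx hy !mul0r subrr.
have -> : b * (dot3 x x * dot3 y y - dot3 x y ^+ 2) =
  (a * dot3 x y + b * dot3 y y) * dot3 x x - (a * dot3 x x + b * dot3 x y) * dot3 x y by ring.
by rewrite hx hy !mul0r subrr.
Qed.

(** The factor f_v / v of a chart f = gamma(u) + (v^2/2) xi. *)
Definition edge_slope (xi : 'rV[R]_2 -> 'rV[R]_3) q : 'rV[R]_3 :=
  xi q + (2^-1 * q 0 1) *: vpd 1 xi q.

Lemma edge_slope_analytic xi q : map_analytic_at xi q -> map_analytic_at (edge_slope xi) q.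
Proof.
move=> xia; apply: map_analyticD => //; apply: map_analyticZ; last exact: map_analytic_vpd.
by apply: analyticM; [exact: analytic_cst|exact: analytic_coord].
Qed.

Lemma vpd1_chart (f : 'rV[R]_2 -> 'rV[R]_3) (gam : R -> 'rV[R]_3) xi q :
  map_analytic_at f q -> map_analytic_at xi q ->
  (\forall x \near q, f x = gam (x 0 0) + (x 0 1 ^+ 2 / 2) *: xi x) ->
  vpd 1 f q = q 0 1 *: edge_slope xi q.
Proof.
move=> fa xia fE.
pose c (x : 'rV[R]_2) : R := 2^-1 * x 0 1 * x 0 1.
have ca : analytic_at c q.
  apply: analyticM; last exact: analytic_coord.
  by apply: analyticM; [exact: analytic_cst|exact: analytic_coord].
pose g x := f x - c x *: xi x.
have ga : map_analytic_at g q.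
  by apply: map_analyticD => //; apply: map_analyticN; exact: map_analyticZ.
have gE : \forall x \near q, g x = gam (x 0 0).
  by apply: filterS fE => x; rewrite /g /c => ->; rewrite -mulrA mulrC -expr2 addrK.
have g1 : vpd 1 g q = 0.
  rewrite (nbhs_singleton (near_eq_vpd 1 gE)) vpdE /derive; apply/cvg_lim => //.
  apply: cvg_near_cst; apply: nearW => h /=.
  by rewrite !mxE /= mulr0 add0r subrr scaler0.
rewrite (_ : f = (fun x => g x + c x *: xi x)); last by apply/funext => x; rewrite subrK.
rewrite vpdD; last 2 first.
- exact: map_analytic_differentiable.
- by apply: map_analytic_differentiable; exact: map_analyticZ.
rewrite g1 add0r vpdZ// /edge_slope scalerDr scalerA.
have -> : pd 1 c q = q 0 1.
  have da := analytic_differentiable (analytic_coord 1 q).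
  have dc : differentiable (fun x : 'rV[R]_2 => 2^-1 * x 0 1) q.
    by apply: differentiableM => //; exact: differentiable_cst.
  rewrite /c (pdM 1 dc da) (pdM 1 (differentiable_cst _ _) da).
  by rewrite [pd 1 (fun=> _) q]pdE derive_cst pd_coord2 eqxx -[cst _ q]/(2^-1 : R) -[true%:R]/(1 : R); field.
by congr (_ + _ *: _); rewrite /c; ring.
Qed.

(** Second order expansion in a chart f = gamma(u) + (v^2/2) xi. A change of
    coordinates [chi] that makes the transverse direction singular on the axis
    preserves the axis, because f_u and f_v/v are independent near the point;
    its mixed first derivatives then vanish and the second order chain rule
    collapses. *)
Lemma chart_second_order (f F : 'rV[R]_2 -> 'rV[R]_3) (chi : 'rV[R]_2 -> 'rV[R]_2)
    (gam : R -> 'rV[R]_3) (xi : 'rV[R]_2 -> 'rV[R]_3) q0 p0 :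
  map_analytic_at f p0 -> map_analytic_at xi p0 -> p0 0 1 = 0 ->
  (\forall q \near p0, f q = gam (q 0 0) + (q 0 1 ^+ 2 / 2) *: xi q) ->
  dot3 (vpd 0 f p0) (vpd 0 f p0) * dot3 (xi p0) (xi p0) - dot3 (vpd 0 f p0) (xi p0) ^+ 2 != 0 ->
  map_analytic_at chi q0 -> chi q0 = p0 -> jdet chi q0 != 0 -> q0 0 1 = 0 ->
  (\forall q \near q0, F q = f (chi q)) -> near_axis q0 (fun q => vpd 1 F q = 0) ->
  exists a b x1 x2, [/\ 0 < b, x1 != 0,
    vpd 1 (vpd 1 F) q0 = a *: vpd 0 f p0 + b *: xi p0,
    vpd 0 F q0 = x1 *: vpd 0 f p0 &
    vpd 0 (vpd 0 F) q0 = x2 *: vpd 0 f p0 + x1 ^+ 2 *: vpd 0 (vpd 0 f) p0].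
Proof.
move=> fa xia p01 fE D0 chia chi0 J0 q01 FE F1.
have f1 : nbhs p0 [set q | vpd 1 f q = q 0 1 *: edge_slope xi q].
  near=> q; apply: (vpd1_chart (gam := gam)); near: q.
  - exact: map_analytic_near.
  - exact: map_analytic_near.
  - exact: nbhs_interior fE.
have sa := edge_slope_analytic xia.
have s0 : edge_slope xi p0 = xi p0 by rewrite /edge_slope p01 mulr0 scale0r addr0.
have f1p : vpd 1 f p0 = 0 by rewrite (nbhs_singleton f1) p01 scale0r.
have f11 : vpd 1 (vpd 1 f) p0 = xi p0.
  rewrite (nbhs_singleton (near_eq_vpd 1 f1)) vpdZ//; last exact: analytic_coord.
  by rewrite pd_coord2 eqxx scale1r p01 scale0r addr0.
(* The Gram determinant of f_u and f_v/v. *)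
pose D q := dot3 (vpd 0 f q) (vpd 0 f q) * dot3 (edge_slope xi q) (edge_slope xi q) -
  dot3 (vpd 0 f q) (edge_slope xi q) ^+ 2.
have f0a := map_analytic_vpd 0 fa.
have Da : analytic_at D p0.
  have h := analytic_dot3 f0a sa.
  have := analyticD (analyticM (analytic_dot3 f0a f0a) (analytic_dot3 sa sa))
    (analyticM (analytic_cst (-1) p0) (analyticM h h)).
  by rewrite (_ : (fun x => _ + _) = D)//; apply/funext => x; rewrite mulN1r -expr2.
have Dn : nbhs p0 [set q | D q != 0] by apply: near_neq0 => //; rewrite /D s0.
have chic := map_analytic_continuous chia.
have pull (P : 'rV[R]_2 -> Prop) : nbhs p0 [set q | P q] -> nbhs q0 [set q | P (chi q)].
  by rewrite -chi0; exact: chic.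
have FE1 i := near_eq_vpd i FE.
have chain i : nbhs q0 [set q | vpd i F q =
    vpd i chi q 0 0 *: vpd 0 f (chi q) + vpd i chi q 0 1 *: vpd 1 f (chi q)].
  near=> q; rewrite /=; have -> : vpd i F q = vpd i (fun x => f (chi x)) q by near: q; exact: FE1.
  rewrite /= vpd_chain ?sum2//; apply: map_analytic_differentiable; near: q.
    by apply: (pull (map_analytic_at f)); exact: map_analytic_near.
  exact: map_analytic_near.
have key : near_axis q0 (fun q => vpd 1 chi q 0 0 = 0 /\ chi q 0 1 = 0).
  rewrite /near_axis; near=> q => q1.
  have F1q : q 0 1 = 0 -> vpd 1 F q = 0 by near: q.
  have : vpd 1 F q = vpd 1 chi q 0 0 *: vpd 0 f (chi q) + vpd 1 chi q 0 1 *: vpd 1 f (chi q).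
    by near: q; exact: chain.
  have -> : vpd 1 f (chi q) = chi q 0 1 *: edge_slope xi (chi q) by near: q; exact: pull f1.
  rewrite F1q// scalerA => /esym/gram_indep[|h1 h2]; first by near: q; exact: pull Dn.
  split => //; have : jdet chi q != 0 by near: q; apply: near_neq0 => //; exact: analytic_jdet.
  rewrite /jdet h1 mulr0 subr0 mulf_eq0 negb_or => /andP[_ c1].
  by move/eqP: h2; rewrite mulf_eq0 (negbTE c1) => /eqP.
have [c10 _] := near_axis_at key q01.
have c01 : vpd 0 chi q0 0 1 = 0.
  rewrite pd_coord; last exact: map_analytic_differentiable.
  by apply: (near_axis_at (pd0_on_axis _) q01); apply: near_axisW key => q [].
have /andP[c00 c11] : (vpd 0 chi q0 0 0 != 0) && (vpd 1 chi q0 0 1 != 0).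
  by move: J0; rewrite /jdet c01 mul0r subr0 mulf_eq0 negb_or.
have fchi : map_analytic_at f (chi q0) by rewrite chi0.
have F2 i := nbhs_singleton (near_eq_vpd i (FE1 i)).
exists (vpd 1 (vpd 1 chi) q0 0 0), (vpd 1 chi q0 0 1 ^+ 2), (vpd 0 chi q0 0 0),
  (vpd 0 (vpd 0 chi) q0 0 0); split => //.
- by rewrite exprn_even_gt0.
- rewrite F2 (vpd_chain2 1 fchi chia) !sum2 chi0 c10 f1p f11 !scale0r !scaler0 !add0r !addr0.
  by rewrite scalerA expr2.
- by rewrite (nbhs_singleton (chain 0)) chi0 c01 scale0r addr0.
- rewrite F2 (vpd_chain2 0 fchi chia) !sum2 chi0 c01 f1p !scale0r !scaler0 !addr0.
  by rewrite scalerA expr2.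
Unshelve. all: by end_near. Qed.

(** If the cubic term vanished, the third transverse derivative of the last
    coordinate v^3 of the model, which is 6 times the cube of a first derivative
    of [chi], would vanish; with the first coordinate of the model this makes the
    transverse derivative of [chi] zero. *)
Lemma cuspidal_cubic_neq0 (F : 'rV[R]_2 -> 'rV[R]_3) (h : 'I_3 -> 'rV[R]_3 -> R)
    (chi : 'rV[R]_2 -> 'rV[R]_2) q0 :
  map_analytic_at F q0 -> (forall k, analytic_at (h k) (F q0)) ->
  map_analytic_at chi q0 -> chi q0 = 0 -> jdet chi q0 != 0 ->
  (\forall q \near q0, h 0 (F q) = chi q 0 0 /\ h 2 (F q) = chi q 0 1 ^+ 3) ->
  vpd 1 F q0 = 0 -> vpd 1 (vpd 1 (vpd 1 F)) q0 <> 0.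
Proof.
move=> Fa ha chia chi0 J0 hE F1 F3.
pose grad k (p : 'rV[R]_3) : 'rV[R]_3 := \row_j pd j (h k) p.
have hF k : \forall q \near q0, pd 1 (fun x => h k (F x)) q = dot3 (vpd 1 F q) (grad k (F q)).
  near=> q; rewrite pd_chain; last 2 first.
  - apply: analytic_differentiable; near: q.
    exact: (map_analytic_continuous Fa) (analytic_near (ha k)).
  - by apply: map_analytic_differentiable; near: q; exact: map_analytic_near.
  by apply: eq_bigr => j _; rewrite mxE.
have hE0 : \forall q \near q0, h 0 (F q) = chi q 0 0 by apply: filterS hE => q [].
have hE2 : \forall q \near q0, h 2 (F q) = chi q 0 1 ^+ 3 by apply: filterS hE => q [].
have c10 : vpd 1 chi q0 0 0 = 0.
  rewrite pd_coord; last exact: map_analytic_differentiable.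
  by rewrite -(nbhs_singleton (near_eq_pd 1 hE0)) (nbhs_singleton (hF 0)) F1 dot30l.
have c11 : vpd 1 chi q0 0 1 = 0.
  rewrite pd_coord; last exact: map_analytic_differentiable.
  have y0 : chi q0 0 1 = 0 by rewrite chi0 mxE.
  have := pd_cube 1 (chia 1) y0.
  rewrite -(nbhs_singleton (near_eq_pd 1 (near_eq_pd 1 (near_eq_pd 1 hE2)))).
  rewrite (nbhs_singleton (near_eq_pd 1 (near_eq_pd 1 (hF 2)))).
  have gFa : map_analytic_at (fun q => grad 2 (F q)) q0.
    apply: (@map_analytic_comp _ _ _ _ (grad 2) F) => // j.
    rewrite (_ : (fun x => _) = pd j (h 2)); first exact: analytic_pd.
    by apply/funext => x; rewrite mxE.
  rewrite (pd_dot3_2 1 1 (map_analytic_vpd 1 Fa) gFa) F3 F1 !dot30l.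
  have -> : vpd 1 (fun q => grad 2 (F q)) q0 = 0.
    rewrite vpd_chain ?F1.
    - by apply: big1 => j _; rewrite mxE scale0r.
    - apply: map_analytic_differentiable => j.
      rewrite (_ : (fun x => _) = pd j (h 2)); first exact: analytic_pd.
      by apply/funext => x; rewrite mxE.
    - exact: map_analytic_differentiable.
  rewrite !dot30r !addr0 => /esym/eqP; rewrite mulf_eq0 pnatr_eq0/= expf_eq0 /=.
  by move/eqP.
by move/eqP: J0; apply; rewrite /jdet c10 c11 !mulr0 subrr.
Unshelve. all: by end_near. Qed.

End Chart.

(** * Germs along the segment *)

Section JGerms.
Context {R : realType}.
Implicit Types (l : R) (phi psi : 'rV[R]_2 -> 'rV[R]_2) (f g : 'rV[R]_2 -> 'rV[R]_3).

Lemma near_JnearP l (P : 'rV[R]_2 -> Prop) :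
  (\forall q \near Jnear l, P q) <-> forall p, Jseg l p -> nbhs p [set q | P q].
Proof.
by [].
Qed.

Lemma germ_eqP (T : Type) l (f g : 'rV[R]_2 -> T) :
  germ_eq l f g <-> forall p, Jseg l p -> \forall q \near p, f q = g q.
Proof. exact: near_JnearP. Qed.

Lemma Jseg_pt2 l u : u \in `[- l, l] -> Jseg l (pt2 u 0).
Proof. by exists u. Qed.

Lemma Jseg_axis l p : Jseg l p -> p 0 1 = 0.
Proof. by move=> [u _ <-]; rewrite pt2_1. Qed.

(** One map psi represents the inverse germ at all points of the segment. *)
Lemma Jdiffeo_local l phi : Jdiffeo l phi -> exists psi, forall p, Jseg l p ->
  [/\ map_analytic_at phi p, map_analytic_at psi p,
      \forall q \near p, psi (phi q) = q, \forall q \near p, phi (psi q) = q &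
      Jseg l (phi p) /\ Jseg l (psi p)].
Proof.
move=> [U [V [psi [[Uo Vo JU JV] [h1 h2 h3] Ua Va phiJ]]]].
exists psi => p Jp.
have nU : nbhs p U by apply: open_nbhs_nbhs; split => //; exact: JU.
have nV : nbhs p V by apply: open_nbhs_nbhs; split => //; exact: JV.
split.
- by have [] := Ua p (JU p Jp).
- exact: Va (JV p Jp).
- by apply: filterS nU => q /Ua[].
- by apply: filterS nV => q /h3[x Ux <-]; have [_ ->] := Ua x Ux.
- have : (phi @` Jseg l) p by rewrite phiJ.
  move=> [x Jx xp]; split; first by rewrite -phiJ; exists p.
  by rewrite -xp; have [_ ->] := Ua x (JU x Jx).
Qed.

Lemma open_preimage_at (f : 'rV[R]_2 -> 'rV[R]_2) (U W : set 'rV[R]_2) :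
  open U -> (forall p, U p -> {for p, continuous f}) -> open W -> open (U `&` f @^-1` W).
Proof.
rewrite !openE => Uo fc Wo p [Up Wp]; apply: filterI; first exact: Uo.
by apply: (fc p Up); exact: Wo.
Qed.

Lemma Jdiffeo_comp l phi phi' : Jdiffeo l phi -> Jdiffeo l phi' ->
  Jdiffeo l (fun q => phi' (phi q)).
Proof.
move=> [U [V [psi [[Uo Vo JU JV] [h1 h2 h3] Ua Va phiJ]]]].
move=> [U' [V' [psi' [[Uo' Vo' JU' JV'] [h1' h2' h3'] Ua' Va' phiJ']]]].
have Jphi p : Jseg l p -> Jseg l (phi p) by move=> Jp; rewrite -phiJ; exists p.
exists (U `&` phi @^-1` U'), (V' `&` psi' @^-1` V), (fun q => psi (psi' q)); split.
- split.
  + apply: open_preimage_at => // p /Ua[pa _]; exact: map_analytic_continuous.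
  + apply: open_preimage_at => // p /Va' pa; exact: map_analytic_continuous.
  + by move=> p Jp; split; [exact: JU|apply: JU'; exact: Jphi].
  + move=> p Jp; split; first exact: JV'.
    have : (phi' @` Jseg l) p by rewrite phiJ'.
    by move=> [x Jx <-] /=; have [_ ->] := Ua' x (JU' x Jx); exact: JV.
- split.
  + move=> p [Up U'p] /=; split; first exact: h1'.
    by rewrite /= (Ua' _ U'p).2; exact: h1.
  + move=> x y; rewrite !inE => -[Ux U'x] [Uy U'y] exy.
    have : phi x = phi y by apply: h2' => //; rewrite inE.
    by apply: h2; rewrite inE.
  + move=> q [V'q Vq]; have [y Uy ey] := h3 _ Vq; exists y.
      split => //; rewrite /= ey; have [x Ux xq] := h3' q V'q.
      by rewrite -xq (Ua' x Ux).2.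
    by rewrite ey; have [x Ux xq] := h3' q V'q; rewrite -xq (Ua' x Ux).2.
- move=> p [Up U'p]; split; last by rewrite (Ua' _ U'p).2 (Ua _ Up).2.
  by apply: map_analytic_comp; [have [] := Ua' _ U'p|have [] := Ua _ Up].
- by move=> q [V'q Vq]; apply: map_analytic_comp; [exact: Va|exact: Va'].
- by rewrite (_ : (fun q => _) = phi' \o phi)// -image_comp phiJ phiJ'.
Qed.

Lemma Jdiffeo_inv l phi : Jdiffeo l phi -> exists psi, [/\ Jdiffeo l psi,
  germ_eq l (fun q => psi (phi q)) id & germ_eq l (fun q => phi (psi q)) id].
Proof.
move=> dphi; have := dphi.
move=> [U [V [psi [[Uo Vo JU JV] [h1 h2 h3] Ua Va phiJ]]]].
have psiV q : V q -> U (psi q) /\ phi (psi q) = q.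
  by move=> /h3[x Ux <-]; have [_ ->] := Ua x Ux.
exists psi; split.
- exists V, U, phi; split => //.
  + split; [by move=> q /psiV[]| |].
      by move=> x y; rewrite !inE => /psiV[_ ex] /psiV[_ ey] exy; rewrite -ex -ey exy.
    by move=> p Up; exists (phi p); [exact: h1|have [_ ->] := Ua p Up].
  + by move=> q Vq; split; [exact: Va|have [] := psiV q Vq].
  + by move=> p /Ua[].
  + rewrite -{1}phiJ image_comp; apply/seteqP; split => [_ [p Jp <-]|p Jp] /=.
      by rewrite (Ua p (JU p Jp)).2.
    by exists p => //=; rewrite (Ua p (JU p Jp)).2.
- by apply/germ_eqP => p Jp; apply: filterS (open_nbhs_nbhs (conj Uo (JU p Jp))) => q /Ua[].
- by apply/germ_eqP => p Jp; apply: filterS (open_nbhs_nbhs (conj Vo (JV p Jp))) => q /psiV[].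
Qed.

Lemma Jdiffeo_id l : Jdiffeo l id.
Proof.
exists setT, setT, id; split => //.
- by split => //; exact: openT.
- by split => // q _; exists q.
- by move=> p _; split => // j; exact: analytic_coord.
- by move=> p _ j; exact: analytic_coord.
- by rewrite image_id.
Qed.

Lemma germ_eq_comp (T : Type) l (f g : 'rV[R]_2 -> T) phi : Jdiffeo l phi -> germ_eq l f g ->
  germ_eq l (fun q => f (phi q)) (fun q => g (phi q)).
Proof.
move=> /Jdiffeo_local[psi dphi] /germ_eqP fg; apply/germ_eqP => p Jp.
have [phia _ _ _ [Jphi _]] := dphi p Jp.
exact: (map_analytic_continuous phia) (fg _ Jphi).
Qed.

Lemma germ_eq_sym (T : Type) l (f g : 'rV[R]_2 -> T) : germ_eq l f g -> germ_eq l g f.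
Proof.
move=> /germ_eqP fg; apply/germ_eqP => p Jp.
by apply: filterS (fg p Jp) => q ->.
Qed.

Lemma germ_eq_trans (T : Type) l (f g h : 'rV[R]_2 -> T) :
  germ_eq l f g -> germ_eq l g h -> germ_eq l f h.
Proof.
move=> /germ_eqP fg /germ_eqP gh; apply/germ_eqP => p Jp.
by apply: filterS2 (fg p Jp) (gh p Jp) => q -> ->.
Qed.

Lemma right_equivalent_refl l f : right_equivalent l f f.
Proof. by exists id; [exact: Jdiffeo_id|apply/germ_eqP => p _; apply: filterE]. Qed.

Lemma right_equivalent_sym l f g : right_equivalent l f g -> right_equivalent l g f.
Proof.
move=> [phi dphi gE]; have [psi [dpsi _ inv]] := Jdiffeo_inv dphi.
exists psi => //; apply: germ_eq_sym; apply: germ_eq_trans (germ_eq_comp dpsi gE) _.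
by move/germ_eqP: inv => inv; apply/germ_eqP => p Jp; apply: filterS (inv p Jp) => q /= ->.
Qed.

Lemma right_equivalent_trans l f g h :
  right_equivalent l f g -> right_equivalent l g h -> right_equivalent l f h.
Proof.
move=> [phi dphi gE] [phi' dphi' hE]; exists (fun q => phi (phi' q)).
  exact: Jdiffeo_comp.
exact: germ_eq_trans hE (germ_eq_comp dphi' gE).
Qed.

Lemma right_class_eqP l f g : right_class l f = right_class l g <-> right_equivalent l f g.
Proof.
split=> [fg|fg].
  by have : right_class l g g := right_equivalent_refl l g; rewrite -fg.
apply/seteqP; split => h; last exact: right_equivalent_trans.
exact: right_equivalent_trans (right_equivalent_sym fg).
Qed.

Lemma fffE f q i j : differentiable f q ->
  first_fundamental_form f q i j = dot3 (vpd i f q) (vpd j f q).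
Proof.
move=> df; rewrite /first_fundamental_form mxE /dot3; apply: eq_bigr => k _.
by rewrite !mxE -!(row_jacobian _ df) !mxE.
Qed.

Lemma jacobian_comp n m k (h : 'rV[R]_m -> 'rV[R]_k) (G : 'rV[R]_n -> 'rV[R]_m) q :
  differentiable h (G q) -> differentiable G q ->
  'J (fun x => h (G x)) q = 'J G q *m 'J h (G q).
Proof.
move=> dh dG; apply/row_matrixP => i; rewrite row_mul (row_jacobian _ dG).
rewrite row_jacobian; last exact: differentiable_comp.
rewrite (vpd_chain i dh dG) mulmx_sum_row; apply: eq_bigr => j _.
by rewrite (row_jacobian _ dh).
Qed.

Lemma fff_comp f phi q : differentiable f (phi q) -> differentiable phi q ->
  first_fundamental_form (fun x => f (phi x)) q =
  pullback_form phi (first_fundamental_form f) q.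
Proof.
move=> df dphi; rewrite /first_fundamental_form /pullback_form (jacobian_comp df dphi).
by rewrite trmx_mul !mulmxA.
Qed.

Lemma row_gram_eq0 n (u : 'rV[R]_n) : u *m u^T = 0 -> u = 0.
Proof.
move=> uu; apply/rowP => j; rewrite [RHS]mxE; apply/eqP; rewrite -sqrf_eq0.
have := congr1 (fun A : 'M[R]_1 => A 0 0) uu; rewrite /= !mxE => /eqP.
rewrite psumr_eq0 => [/allP/(_ j)|k _]; last by rewrite mxE -expr2 sqr_ge0.
by rewrite mem_index_enum mxE -expr2 => /(_ isT).
Qed.

(** Over the reals a matrix and its Gram matrix have the same kernel. *)
Lemma mxrank_gram m n (M : 'M[R]_(m, n)) : \rank (M *m M^T) = \rank M.
Proof.
have := mxrank_mul_ker M M^T; suff -> : (M :&: kermx M^T)%MS = 0 by rewrite mxrank0 addn0.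
apply/eqP; rewrite -submx0; apply/row_subP => i; set u := row i _.
have : (u <= M :&: kermx M^T)%MS by exact: row_sub.
rewrite sub_capmx => /andP[/submxP[y uy] /sub_kermxP uM].
have uu : u *m u^T = 0 by rewrite {2}uy trmx_mul mulmxA uM mul0mx.
by rewrite (row_gram_eq0 uu) sub0mx.
Qed.

(** The Jacobian has the rank of its Gram matrix. *)
Lemma singular_point_fff f g p :
  first_fundamental_form f p = first_fundamental_form g p ->
  singular_point f p <-> singular_point g p.
Proof.
have h (a b x y : nat) : a = x -> b = y -> x = y -> (a < 2)%N <-> (b < 2)%N.
  by move=> -> -> ->.
have E k : \rank ('J k p) = \rank (first_fundamental_form k p).
  exact (esym (mxrank_gram ('J k p))).
move=> fg; exact (h _ _ _ _ (E f) (E g) (congr1 (@mxrank _ _ _) fg)).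
Qed.

Lemma local_diffeo_comp n (phi psi : 'rV[R]_n -> 'rV[R]_n) p :
  local_diffeo_at phi p -> local_diffeo_at psi (phi p) ->
  local_diffeo_at (fun q => psi (phi q)) p.
Proof.
move=> [phia [phi' [phia' k1 k2]]] [psia [psi' [psia' k3 k4]]]; split.
  exact (@map_analytic_comp _ n n n psi phi p psia phia).
have phi'0 : phi' (phi p) = p by exact: nbhs_singleton k1.
have psi'0 : psi' (psi (phi p)) = phi p by exact: nbhs_singleton k3.
exists (fun q => phi' (psi' q)); split.
- have phia'' : map_analytic_at phi' (psi' (psi (phi p))) by rewrite psi'0.
  exact (@map_analytic_comp _ n n n phi' psi' (psi (phi p)) phia'' psia').
- have := map_analytic_continuous phia k3; apply: filterS2 k1 => q /= h1 ->.
  exact: h1.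
- have c : psi' @ (psi (phi p)) --> phi p.
    by have := map_analytic_continuous psia'; rewrite /prop_for /continuous_at /= psi'0.
  by have := c _ k2; apply: filterS2 k4 => q /= h1 ->.
Qed.

Lemma local_diffeo_jdet (chi : 'rV[R]_2 -> 'rV[R]_2) p : local_diffeo_at chi p -> jdet chi p != 0.
Proof. by move=> [chia [psi [psia inv _]]]; exact: jdet_neq0 chia psia inv. Qed.

Lemma Jdiffeo_local_diffeo l phi p : Jdiffeo l phi -> Jseg l p -> local_diffeo_at phi p.
Proof.
move=> /Jdiffeo_local[psi dphi] Jp; have [phia _ k1 _ [Jphi _]] := dphi p Jp.
have [_ psia _ k2 _] := dphi _ Jphi.
by split => //; exists psi; split.
Qed.

End JGerms.

(** * The axis and its Frenet frame *)

Section AxisFrame.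
Context {R : realType}.
Implicit Types (l : R) (f g : 'rV[R]_2 -> 'rV[R]_3).

(** With e = 1 or e = -1, the model of an isometry acting on the axis. *)
Definition uscale (e : R) (q : 'rV[R]_2) : 'rV[R]_2 := pt2 (e * q 0 0) (q 0 1).

Lemma pt2E (u : R) : pt2 u 0 = u *: ebase 0 :> 'rV[R]_2.
Proof. by apply/rowP => i; case: (ord2P i) => ->; rewrite !mxE /= ?mulr1 ?mulr0. Qed.

Lemma uscale_pt2 e u : uscale e (pt2 u 0) = pt2 (e * u) 0.
Proof. by rewrite /uscale pt2_0 pt2_1. Qed.

Lemma uscale_analytic e q : map_analytic_at (uscale e) q.
Proof.
apply: map_analytic_pt2; last exact: analytic_coord.
by apply: analyticM; [exact: analytic_cst|exact: analytic_coord].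
Qed.

Lemma vpd0_uscale e q : vpd 0 (uscale e) q = e *: ebase 0.
Proof.
have da := map_analytic_differentiable (uscale_analytic e q).
apply/rowP => j; rewrite (pd_coord 0 j da); case: (ord2P j) => ->.
  rewrite (_ : (fun x => _) = (fun x : 'rV[R]_2 => e * x 0 0)); last first.
    by apply/funext => x; rewrite mxE.
  rewrite pdM; [|exact: differentiable_cst|exact: analytic_differentiable (analytic_coord _ _)].
  by rewrite [pd 0 (fun=> e) q]pdE derive_cst mul0r add0r pd_coord2 !mxE.
rewrite (_ : (fun x => _) = (fun x : 'rV[R]_2 => x 0 1)); last first.
  by apply/funext => x; rewrite mxE.
by rewrite pd_coord2 !mxE /= mulr0.
Qed.

Lemma mem_J_scale e l u : e ^+ 2 = 1 -> u \in `[- l, l] -> e * u \in `[- l, l].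
Proof.
move=> /eqP; rewrite sqrf_eq1 => /orP[] /eqP ->; rewrite ?mul1r// mulN1r.
by rewrite !in_itv /= => /andP[h1 h2]; apply/andP; split; lra.
Qed.

Lemma uscaleK e : e ^+ 2 = 1 -> cancel (uscale e) (uscale e).
Proof.
move=> e2 q; rewrite /uscale pt2_0 pt2_1 mulrA -expr2 e2 mul1r; exact: pt2_eta.
Qed.

Lemma Jdiffeo_uscale l e : e ^+ 2 = 1 -> Jdiffeo l (uscale e).
Proof.
move=> e2; exists setT, setT, (uscale e); split => //.
- by split => //; exact: openT.
- split => // [x y _ _ xy|q _]; first by rewrite -(uscaleK e2 x) xy uscaleK.
  by exists (uscale e q) => //; exact: uscaleK.
- by move=> p _; split; [exact: uscale_analytic|exact: uscaleK].
- by move=> p _; exact: uscale_analytic.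
- apply/seteqP; split => [_ [_ [u uJ <-] <-]|_ [u uJ <-]] /=.
    by rewrite uscale_pt2; apply: Jseg_pt2; exact: mem_J_scale.
  exists (pt2 (e * u) 0); first by apply: Jseg_pt2; exact: mem_J_scale.
  by rewrite uscale_pt2 mulrA -expr2 e2 mul1r.
Qed.

Lemma derive1_axis m (F : 'rV[R]_2 -> 'rV[R]_m) :
  (fun u => derive1 (fun w => F (pt2 w 0)) u) = (fun u => vpd 0 F (pt2 u 0)).
Proof.
apply/funext => u; rewrite vpdE /derive1 /derive.
apply: (congr1 (fun k : R -> 'rV[R]_m => lim (k @ 0^'))).
by apply/funext => h /=; rewrite !pt2E -scalerDl.
Qed.

Lemma derive1_axis_curve f u : derive1 (axis_curve f) u = vpd 0 f (pt2 u 0).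
Proof. exact: (congr1 (fun h => h u) (derive1_axis f)). Qed.

Lemma derive1_axis_curve2 f u :
  derive1 (derive1 (axis_curve f)) u = vpd 0 (vpd 0 f) (pt2 u 0).
Proof.
have -> : derive1 (axis_curve f) = axis_curve (vpd 0 f).
  by apply/funext => w; exact: derive1_axis_curve.
exact: derive1_axis_curve.
Qed.

(** Derivatives along the axis at the end points of J involve points outside J;
    identities there follow by continuity from the interior. *)
Lemma J_ext l (g : 'rV[R]_2 -> R) : 0 < l ->
  (forall u, u \in `[- l, l] -> {for pt2 u 0, continuous g}) ->
  (forall u, u \in `]- l, l[ -> g (pt2 u 0) = 0) ->
  forall u, u \in `[- l, l] -> g (pt2 u 0) = 0.
Proof.
move=> l0 gc g0 u uJ; apply/eqP/negPn/negP => gu.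
have nu : nbhs (pt2 u 0) [set q | g q != 0].
  by apply: (gc u uJ [set y : R | y != 0]); apply: open_nbhs_nbhs; split => //; exact: open_neq.
(* Points of J are approached from the interior by shrinking towards 0. *)
have hc : (fun h : R => pt2 ((1 - h) * u) 0 : 'rV[R]_2) @ 0 --> pt2 u 0.
  rewrite (_ : (fun h => _) = (fun h : R => ((1 - h) * u) *: (ebase 0 : 'rV[R]_2))); last first.
    by apply/funext => h; rewrite pt2E.
  rewrite pt2E; apply: cvgZr_tmp; rewrite -[X in _ --> X]mul1r; apply: cvgMr_tmp.
  by rewrite -[X in _ --> X]subr0; apply: cvgB; [exact: cvg_cst|exact: cvg_id].
have h1 : \forall h \near (0 : R)^'+, g (pt2 ((1 - h) * u) 0) != 0.
  rewrite near_withinE; have h0 : \forall h \near (0 : R), g (pt2 ((1 - h) * u) 0) != 0 := hc _ nu.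
  by apply: filterS h0 => h gh _.
have [h [h0 hle gh]] : exists h, [/\ 0 < h, h <= 1 & g (pt2 ((1 - h) * u) 0) != 0].
  have [h [[h0 hle] gh]] := filter_ex (filterI (filterI (nbhs_right_gt (0 : R))
    (nbhs_right_le (ltr01 : 0 < 1 :> R))) h1).
  by exists h.
move/eqP: gh; apply; apply: g0; move: uJ; rewrite !in_itv /= => /andP[u1 u2].
by apply/andP; split; nra.
Qed.

Lemma J_interior_derive l (V : normedModType R) (F : 'rV[R]_2 -> V) :
  (forall u, u \in `]- l, l[ -> F (pt2 u 0) = 0) ->
  forall u, u \in `]- l, l[ -> 'D_(ebase 0) F (pt2 u 0) = 0.
Proof.
move=> F0 u uJ; rewrite /derive; apply/cvg_lim => //; apply: cvg_near_cst.
have : \forall h \near (0 : R), (h + u) \in `]- l, l[.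
  have : nbhs u [set` `]- l, l[] by apply: open_nbhs_nbhs; split => //; exact: itv_open.
  rewrite -{1}[u]add0r => H.
  have c : (fun h : R => h + u) @ 0 --> 0 + u by apply: cvgD; [exact: cvg_id|exact: cvg_cst].
  exact: c _ H.
move=> /nbhs_dnbhs; apply: filterS => h /= hu.
by rewrite pt2E -scalerDl -!pt2E !F0// subrr scaler0.
Qed.

Lemma J_vpd0_eq l m (F G : 'rV[R]_2 -> 'rV[R]_m) : 0 < l ->
  (forall u, u \in `[- l, l] -> map_analytic_at F (pt2 u 0)) ->
  (forall u, u \in `[- l, l] -> map_analytic_at G (pt2 u 0)) ->
  (forall u, u \in `[- l, l] -> F (pt2 u 0) = G (pt2 u 0)) ->
  forall u, u \in `[- l, l] -> vpd 0 F (pt2 u 0) = vpd 0 G (pt2 u 0).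
Proof.
move=> l0 Fa Ga FG u uJ; apply/rowP => j; apply/eqP; rewrite -subr_eq0; apply/eqP.
apply: (@J_ext l (fun q => vpd 0 F q 0 j - vpd 0 G q 0 j)) uJ => // {}u uJ.
  apply: analytic_continuous.
  have := analyticD (map_analytic_vpd 0 (Fa u uJ) j)
    (analyticM (analytic_cst (-1) _) (map_analytic_vpd 0 (Ga u uJ) j)).
  by rewrite (_ : (fun x => _ + _) = (fun q => vpd 0 F q 0 j - vpd 0 G q 0 j))//;
    apply/funext => x; rewrite mulN1r.
have uJ' : u \in `[- l, l] by exact: subset_itv_oo_cc uJ.
have dF := diff_derivable (map_analytic_differentiable (Fa u uJ')).
have dG := diff_derivable (map_analytic_differentiable (Ga u uJ')).
have := @J_interior_derive l _ (fun q => F q - G q) _ u uJ.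
rewrite deriveB// -!vpdE => /(_ _)/wrap[].
  by move=> w wJ; rewrite FG ?subrr//; exact: subset_itv_oo_cc wJ.
by move=> /(congr1 (fun M : 'rV[R]_m => M 0 j)); rewrite !mxE.
Qed.

Lemma Gomega_analytic l c f p : Gomega l c f -> Jseg l p -> map_analytic_at f p.
Proof. by move=> [[U [_ JU Ua _]] _ _] Jp; apply: Ua; exact: JU. Qed.

Lemma enorm3_sqr (x : 'rV[R]_3) : enorm3 x ^+ 2 = dot3 x x.
Proof. by rewrite /enorm3 sqr_sqrtr// dot3_ge0. Qed.

Lemma Gomega_orient l c f : Gomega l c f ->
  exists2 e : R, e ^+ 2 = 1 & forall u, u \in `[- l, l] -> f (pt2 u 0) = c (e * u).
Proof.
move=> [_ _ [h|h]]; [exists 1|exists (-1)].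
- by rewrite expr1n.
- by move=> u uJ; rewrite mul1r; exact: h.
- by rewrite sqrrN expr1n.
- by move=> u uJ; rewrite mulN1r; exact: h.
Qed.

(** The axis is parametrized by arc length, with unit speed carried to the end
    points of J by continuity. *)
Lemma axis_unit l c f : 0 < l -> arclength_embedding l c -> Gomega l c f ->
  forall u, u \in `[- l, l] ->
  dot3 (vpd 0 f (pt2 u 0)) (vpd 0 f (pt2 u 0)) = 1 /\
  dot3 (vpd 0 f (pt2 u 0)) (vpd 0 (vpd 0 f) (pt2 u 0)) = 0.
Proof.
move=> l0 [_ _ c1 _ _] Gf; have [e e2 fc] := Gomega_orient Gf.
have fa u : u \in `[- l, l] -> map_analytic_at f (pt2 u 0).
  by move=> uJ; apply: (Gomega_analytic Gf); exact: Jseg_pt2.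
pose E q := dot3 (vpd 0 f q) (vpd 0 f q) - 1.
have Ea u : u \in `[- l, l] -> analytic_at E (pt2 u 0).
  move=> uJ; apply: analyticD; last exact: analytic_cst.
  by apply: analytic_dot3; apply: map_analytic_vpd; exact: fa.
have Eint u : u \in `]- l, l[ -> E (pt2 u 0) = 0.
  move=> uJ; have uJ' := subset_itv_oo_cc uJ; pose w := e * u.
  have wJ : w \in `]- l, l[.
    move: e2 uJ => /eqP; rewrite sqrf_eq1 /w => /orP[] /eqP ->; rewrite ?mul1r// mulN1r.
    by rewrite !in_itv /= => /andP[h1 h2]; apply/andP; split; lra.
  have wJ' := subset_itv_oo_cc wJ.
  have ew : e * w = u by rewrite /w mulrA -expr2 e2 mul1r.
  have cE : \forall x \near w, c x = f (uscale e (pt2 x 0)).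
    have : nbhs w [set` `]- l, l[] by apply: open_nbhs_nbhs; split => //; exact: itv_open.
    apply: filterS => x xJ; have xJ' := subset_itv_oo_cc xJ.
    by rewrite uscale_pt2 fc ?mem_J_scale// mulrA -expr2 e2 mul1r.
  have cw : derive1 c w = e *: vpd 0 f (pt2 u 0).
    rewrite derive1E (near_eq_derive _ cE) -derive1E.
    have := congr1 (fun h => h w) (derive1_axis (fun q => f (uscale e q))); rewrite /= => ->.
    have da : differentiable f (uscale e (pt2 w 0)).
      by rewrite uscale_pt2 ew; apply: map_analytic_differentiable; exact: fa.
    rewrite (vpd_chain 0 da (map_analytic_differentiable (uscale_analytic e _))).
    by rewrite sum2 vpd0_uscale !mxE /= uscale_pt2 ew mulr1 mulr0 scale0r addr0.
  have := enorm3_sqr (derive1 c w); rewrite c1// expr1n cw dot3Zl dot3Zr mulrA -expr2 e2 mul1r.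
  by rewrite /E => <-; rewrite subrr.
have E0 := J_ext l0 (fun u uJ => analytic_continuous (Ea u uJ)) Eint.
move=> u uJ; split; first by apply/eqP; rewrite -subr_eq0; apply/eqP; exact: E0.
apply: (@J_ext l (fun q => dot3 (vpd 0 f q) (vpd 0 (vpd 0 f) q))) uJ => // {}u uJ.
  apply: analytic_continuous; apply: analytic_dot3; apply: map_analytic_vpd.
    exact: fa.
  by apply: map_analytic_vpd; exact: fa.
have uJ' := subset_itv_oo_cc uJ; have f0a := map_analytic_vpd 0 (fa u uJ').
have := J_interior_derive Eint uJ; rewrite -pdE /E.
rewrite (pdD 0 (analytic_differentiable (analytic_dot3 f0a f0a)) (differentiable_cst _ _)).
rewrite (pd_dot3 0 f0a f0a) [pd 0 (fun=> -1) _]pdE derive_cst addr0.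
by rewrite [dot3 (vpd 0 (vpd 0 f) _) _]dot3C; lra.
Qed.

Definition edge_chart l f phi (xi : 'rV[R]_2 -> 'rV[R]_3) : Prop :=
  [/\ Jdiffeo l phi,
      (forall u, u \in `[- l, l] -> phi (pt2 u 0) = pt2 u 0),
      (forall p, Jseg l p -> map_analytic_at xi p) &
      \forall q \near Jnear l,
        f (phi q) = axis_curve f (q 0 0) + (q 0 1 ^+ 2 / 2) *: xi q].

Definition angle_frame f (xi : 'rV[R]_2 -> 'rV[R]_3) (theta : R) u : Prop :=
  let tau := derive1 (axis_curve f) u in
  let x := xi (pt2 u 0) in
  let xperp := x - dot3 x tau *: tau in
  row_free (col_mx tau x) /\
  (enorm3 xperp)^-1 *: xperp =
    cos theta *: principal_normal (axis_curve f) u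
    - sin theta *: binormal (axis_curve f) u.

Lemma cuspidal_angleP l f theta : cuspidal_angle l f theta <->
  [/\ (forall u, u \in `[- l, l] -> fun_analytic_at theta u),
      - pi < theta 0 <= pi &
      exists phi xi, edge_chart l f phi xi /\
        forall u, u \in `[- l, l] -> angle_frame f xi (theta u) u].
Proof.
split=> [[ta t0 [phi [xi [[h1 h2] h3 h4 h5]]]]|[ta t0 [phi [xi [[h1 h2 h3 h4] h5]]]]].
  by split => //; exists phi, xi.
by split => //; exists phi, xi.
Qed.

Lemma cross3_perp (a b : 'rV[R]_3) : dot3 (cross3 a b) a = 0 /\ dot3 (cross3 a b) b = 0.
Proof. by rewrite !dot3E /cross3 /pt3 !mxE /=; split; ring. Qed.

Lemma cross3_norm (a b : 'rV[R]_3) :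
  dot3 (cross3 a b) (cross3 a b) = dot3 a a * dot3 b b - dot3 a b ^+ 2.
Proof. by rewrite !dot3E /cross3 /pt3 !mxE /=; ring. Qed.

(** The frame condition forces positive curvature, since its left-hand side is
    not zero; r is the length of the part of [xi] orthogonal to the axis. *)
Lemma angle_frameP f xi theta u :
  dot3 (vpd 0 f (pt2 u 0)) (vpd 0 f (pt2 u 0)) = 1 ->
  dot3 (vpd 0 f (pt2 u 0)) (vpd 0 (vpd 0 f) (pt2 u 0)) = 0 ->
  angle_frame f xi theta u ->
  let tau := vpd 0 f (pt2 u 0) in
  let n := principal_normal (axis_curve f) u in
  let b := binormal (axis_curve f) u in
  let k := curvature (axis_curve f) u in
  [/\ 0 < k /\ vpd 0 (vpd 0 f) (pt2 u 0) = k *: n,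
      [/\ b = cross3 tau n, dot3 n n = 1 & dot3 tau n = 0],
      [/\ dot3 b b = 1, dot3 b tau = 0 & dot3 b n = 0] &
      exists a r, 0 < r /\ xi (pt2 u 0) = a *: tau + r *: (cos theta *: n - sin theta *: b)].
Proof.
move=> t1 t2; rewrite /angle_frame derive1_axis_curve.
set tau := vpd 0 f (pt2 u 0); set n := principal_normal _ _; set b := binormal _ _.
set k := curvature _ _; set x := xi _ => -[] /=; set xp := x - _ => rf xpE.
have bE : b = cross3 tau n by rewrite /b /binormal derive1_axis_curve.
have xp0 : xp <> 0.
  move=> x0; have : row_mx (- (dot3 x tau)%:M) (1%:M : 'M[R]_1) *m col_mx tau x == 0.
    by rewrite mul_row_col mul1mx mulNmx mul_scalar_mx addrC; apply/eqP.
  rewrite mulmx_free_eq0//= => /eqP/(congr1 (fun M : 'M[R]_(1, 1 + 1) => M 0 (rshift 1 0))).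
  by rewrite row_mxEr !mxE /= => /eqP; rewrite oner_eq0.
have r0 : 0 < enorm3 xp.
  rewrite lt_def sqrtr_ge0 andbT; apply/eqP => e0; apply: xp0; apply: dot3_eq0.
  by rewrite -enorm3_sqr e0 expr0n.
have xpE' : xp = enorm3 xp *: (cos theta *: n - sin theta *: b).
  by rewrite -xpE scalerA divff ?gt_eqF// scale1r.
have k0 : 0 < k.
  rewrite lt_def sqrtr_ge0 andbT; apply/eqP => k0; apply: xp0; rewrite xpE'.
  have n0 : n = 0 by rewrite /n /principal_normal -/k k0 invr0 scale0r.
  have -> : b = 0.
    by rewrite bE n0; apply: dot3_eq0; rewrite cross3_norm dot30l dot30r; ring.
  by rewrite n0 !scaler0 subrr scaler0.
have c2E : vpd 0 (vpd 0 f) (pt2 u 0) = k *: n.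
  by rewrite /n /principal_normal -/k derive1_axis_curve2 scalerA divff ?gt_eqF// scale1r.
have tn : dot3 tau n = 0.
  by move: t2; rewrite c2E dot3Zr => /eqP; rewrite mulf_eq0 gt_eqF//= => /eqP.
have nn : dot3 n n = 1.
  have : k ^+ 2 = dot3 (vpd 0 (vpd 0 f) (pt2 u 0)) (vpd 0 (vpd 0 f) (pt2 u 0)).
    by rewrite /k /curvature enorm3_sqr derive1_axis_curve2.
  rewrite c2E dot3Zl dot3Zr mulrA -expr2 => h.
  by apply: (mulfI (lt0r_neq0 (exprn_gt0 2 k0))); rewrite mulr1.
have [bt bn] := cross3_perp tau n.
split => //.
  by split; rewrite bE//; rewrite cross3_norm t1 nn tn; ring.
exists (dot3 x tau), (enorm3 xp); split => //.
by rewrite -xpE' /xp addrC subrK.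
Qed.

Lemma gram_frame (tau n b : 'rV[R]_3) a r theta :
  dot3 tau tau = 1 -> dot3 n n = 1 -> dot3 tau n = 0 -> dot3 b b = 1 ->
  dot3 b tau = 0 -> dot3 b n = 0 -> 0 < r ->
  let x := a *: tau + r *: (cos theta *: n - sin theta *: b) in
  [/\ dot3 tau x = a, dot3 n x = r * cos theta, dot3 b x = - (r * sin theta) &
   dot3 x x = a ^+ 2 + r ^+ 2].
Proof.
move=> tt nn tn bb bt bn r0 x.
have h1 : dot3 tau x = a.
  by rewrite /x !dot3Dr !dot3Zr dot3Dr dot3Nr !dot3Zr tt tn [dot3 tau b]dot3C bt; ring.
have h2 : dot3 n x = r * cos theta.
  by rewrite /x !dot3Dr !dot3Zr dot3Dr dot3Nr !dot3Zr [dot3 n tau]dot3C tn [dot3 n b]dot3C bn nn; ring.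
have h3 : dot3 b x = - (r * sin theta).
  by rewrite /x !dot3Dr !dot3Zr dot3Dr dot3Nr !dot3Zr bt bn bb; ring.
split => //.
have cs := cos2Dsin2 theta.
rewrite {1}/x !dot3Dl !dot3Zl dot3Dl dot3Nl !dot3Zl h1 h2 h3.
have -> : a * a + r * (cos theta * (r * cos theta) - sin theta * - (r * sin theta)) =
  a ^+ 2 + r ^+ 2 * (cos theta ^+ 2 + sin theta ^+ 2) by ring.
by rewrite cs mulr1.
Qed.

End AxisFrame.

(** * The cuspidal angle in arbitrary coordinates *)

(* Both unfold to limits, which conversion must not try to compare. *)
#[local] Opaque first_fundamental_form jacobian.

Section Reparametrization.
Context {R : realType}.
Implicit Types (l : R) (f g : 'rV[R]_2 -> 'rV[R]_3) (phi : 'rV[R]_2 -> 'rV[R]_2).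

Lemma power_sum_at0 n (a : {ffun 'I_n -> nat} -> R) r M (g : 'rV[R]_n -> R) :
  0 < r -> power_sum a r M g -> g 0 = a (idx0 n).
Proof.
move=> r0 aM; have := power_sum_linear_approx (t := 0) (z := 0) r0 _ aM.
rewrite lexx ler01 => /(_ isT) /(_ _)/wrap[] => [j|]; first by rewrite mxE normr0 mul0r.
rewrite expr0n mul0r normr_le0 big1 => [|i _]; last by rewrite mxE mulr0.
by rewrite subr0 subr_eq0 => /eqP.
Qed.

(** Iterated derivatives at the centre recover the coefficients on the axis, up
    to nonzero factors. *)
Lemma iter_deriv_coef n (i : 'I_n) m : forall (a : {ffun 'I_n -> nat} -> R),
  exists2 C : {ffun 'I_n -> nat} -> R, forall k, C k != 0 &
  forall k, iter m (deriv_coef i) a k = C k * a (iter m (incr_idx i) k).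
Proof.
elim: m => [|m IH] a; first by exists (fun=> 1) => k; rewrite ?oner_neq0 ?mul1r.
have [C C0 CE] := IH (deriv_coef i a).
exists (fun k => C k * ((iter m (incr_idx i) k) i).+1%:R) => k.
  by rewrite mulf_neq0// pnatr_eq0.
by rewrite iterSr CE /deriv_coef mulrA.
Qed.

Lemma J_pd0_zero l (h : 'rV[R]_2 -> R) : 0 < l ->
  (forall u, u \in `[- l, l] -> analytic_at h (pt2 u 0)) ->
  (forall u, u \in `[- l, l] -> h (pt2 u 0) = 0) ->
  forall u, u \in `[- l, l] -> pd 0 h (pt2 u 0) = 0.
Proof.
move=> l0 ha h0; apply: (J_ext l0) => u uJ.
  by apply: analytic_continuous; apply: analytic_pd; exact: ha.
rewrite pdE; apply: (J_interior_derive (l := l)) => // w wJ.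
by apply: h0; exact: subset_itv_oo_cc.
Qed.

(** The identity theorem along the axis: an analytic function that vanishes on
    J x {0} vanishes on the axis beyond the end points too, since all its
    derivatives in the direction of the axis vanish there. *)
Lemma axis_identity l (h : 'rV[R]_2 -> R) : 0 < l ->
  (forall u, u \in `[- l, l] -> analytic_at h (pt2 u 0)) ->
  (forall u, u \in `[- l, l] -> h (pt2 u 0) = 0) ->
  forall u, u \in `[- l, l] -> near_axis (pt2 u 0) (fun q => h q = 0).
Proof.
move=> l0 ha h0 u uJ.
have hm m : (forall w, w \in `[- l, l] -> analytic_at (iter m (pd 0) h) (pt2 w 0)) /\
            (forall w, w \in `[- l, l] -> iter m (pd 0) h (pt2 w 0) = 0).
  elim: m => [|m [IHa IH0]] //; split => w wJ /=.
    by apply: analytic_pd; exact: IHa.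
  exact: (J_pd0_zero l0 IHa IH0).
have /analytic_atP[r [M [r0 [a aM]]]] := ha u uJ.
have am m : exists rM : R * R, 0 < rM.1 /\
    power_sum (iter m (deriv_coef 0) a) rM.1 rM.2 (fun z => iter m (pd 0) h (pt2 u 0 + z)).
  elim: m => [|m [[s N] /= [s0 IH]]]; first by exists (r, M).
  exists (s / 2, 2 / s * N); split; first exact: divr_gt0.
  exact: power_sum_pd.
have a0 m : a (iter m (incr_idx 0) (idx0 2)) = 0.
  have [[s N] /= [s0 H]] := am m; have := power_sum_at0 s0 H.
  rewrite addr0 (hm m).2//; have [C C0 ->] := iter_deriv_coef 0 m a.
  by move=> /esym/eqP; rewrite mulf_eq0 (negbTE (C0 _)) => /eqP.
have z0 (z : 'rV[R]_2) : (forall i, `|z 0 i| <= r) -> z 0 1 = 0 -> h (pt2 u 0 + z) = 0.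
  move=> zr z1; apply: (has_sum_unique (aM.2 z zr)).
  have := @has_sum_fset R {ffun 'I_2 -> nat} (fun=> 0) fset0 (fun _ _ => erefl).
  rewrite big_seq_fset0; apply: eq_has_sum => k.
  have [k1|k1] := posnP (k 1); last first.
    rewrite (mon_split 1) z1 expr0n; case: (k 1) k1 => // m _.
    by rewrite mul0r mulr0.
  suff -> : k = iter (k 0) (incr_idx 0) (idx0 2) by rewrite a0 mul0r.
  have E m : iter m (incr_idx 0) (idx0 2) 0 = m /\ iter m (incr_idx 0) (idx0 2) 1 = 0%N.
    elim: m => [|m [E0 E1]]; first by rewrite /idx0 !ffunE.
    rewrite !iterS; move: E0 E1; set X := iter m _ _ => E0 E1.
    by rewrite /incr_idx !ffunE E0 E1 addn1.
  by apply/ffunP => i; have [E0 E1] := E (k 0); case: (ord2P i) => ->; rewrite ?E0 ?E1.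
have : \forall q \near pt2 u 0, `|q - pt2 u 0| <= r.
  near=> q; rewrite distrC; near: q; apply: cvgr_dist_le => //; exact: cvg_id.
rewrite /near_axis; apply: filterS => q qr q1.
rewrite -(subrK (pt2 u 0) q) addrC; apply: z0 => [i|].
  exact: le_trans (coord_norm_le _ i) qr.
by rewrite !mxE q1 /= subrr.
Unshelve. all: by end_near. Qed.

Lemma near_pull (sig : 'rV[R]_2 -> 'rV[R]_2) q0 (P : 'rV[R]_2 -> Prop) :
  {for q0, continuous sig} -> nbhs (sig q0) [set q | P q] -> nbhs q0 [set q | P (sig q)].
Proof. by move=> sigc; exact: sigc. Qed.

Lemma near_fff_comp f g (sig : 'rV[R]_2 -> 'rV[R]_2) q0 :
  map_analytic_at f (sig q0) -> map_analytic_at g (sig q0) -> map_analytic_at sig q0 ->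
  (\forall q \near sig q0, first_fundamental_form f q = first_fundamental_form g q) ->
  \forall q \near q0, first_fundamental_form (fun x => f (sig x)) q =
                       first_fundamental_form (fun x => g (sig x)) q.
Proof.
move=> fa ga siga fg; have sigc := map_analytic_continuous siga.
near=> q.
have fq : map_analytic_at f (sig q) by near: q; exact: (sigc _ (map_analytic_near fa)).
have gq : map_analytic_at g (sig q) by near: q; exact: (sigc _ (map_analytic_near ga)).
have sq : map_analytic_at sig q by near: q; exact: map_analytic_near.
have fgq : first_fundamental_form f (sig q) = first_fundamental_form g (sig q).
  near: q; exact (@near_pull sig q0 (fun x => first_fundamental_form f x = first_fundamental_form g x) sigc fg).
have df := map_analytic_differentiable fq; have dg := map_analytic_differentiable gq.
have ds := map_analytic_differentiable sq.
rewrite (fff_comp df ds) (fff_comp dg ds) /pullback_form.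
by rewrite fgq.
Unshelve. all: by end_near. Qed.

Lemma near_same_gram f g p : map_analytic_at f p -> map_analytic_at g p ->
  (\forall q \near p, first_fundamental_form f q = first_fundamental_form g q) ->
  nbhs p (same_gram f g).
Proof.
move=> fa ga fg; near=> q => i j.
have fq : map_analytic_at f q by near: q; exact: map_analytic_near.
have gq : map_analytic_at g q by near: q; exact: map_analytic_near.
rewrite -(fffE i j (map_analytic_differentiable fq)) -(fffE i j (map_analytic_differentiable gq)).
have fgq : first_fundamental_form f q = first_fundamental_form g q.
  near: q; exact fg.
by rewrite fgq.
Unshelve. all: by end_near. Qed.

Lemma near_eq_fff f g p : map_analytic_at f p -> (\forall q \near p, f q = g q) ->
  \forall q \near p, first_fundamental_form f q = first_fundamental_form g q.
Proof.
move=> fa fg; have ga := map_analytic_at_near fg fa.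
near=> q.
have fq : map_analytic_at f q by near: q; exact: map_analytic_near.
have gq : map_analytic_at g q by near: q; exact: map_analytic_near.
have e0 : vpd 0 f q = vpd 0 g q by near: q; exact (near_eq_vpd 0 fg).
have e1 : vpd 1 f q = vpd 1 g q by near: q; exact (near_eq_vpd 1 fg).
have Ei i : vpd i f q = vpd i g q by have [->|->] := ord2P i.
apply/matrixP => i j.
refine (etrans (fffE i j (map_analytic_differentiable fq)) (etrans _
  (esym (fffE i j (map_analytic_differentiable gq))))).
by rewrite (Ei i) (Ei j).
Unshelve. all: by end_near. Qed.

(** The data at a point of J x {0} can be read off in any local coordinates [sig]
    around it in which the transverse direction is singular: the second
    transverse derivative is a positive multiple of [xi] up to a tangential
    term. *)
Lemma chart_transfer l c f phi xi theta u (sig : 'rV[R]_2 -> 'rV[R]_2) q0 :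
  0 < l -> arclength_embedding l c -> Gomega l c f ->
  edge_chart l f phi xi -> u \in `[- l, l] -> angle_frame f xi theta u ->
  local_diffeo_at sig q0 -> sig q0 = pt2 u 0 -> q0 0 1 = 0 ->
  near_axis q0 (fun q => vpd 1 (fun x => f (sig x)) q = 0) ->
  let tau := vpd 0 f (pt2 u 0) in
  let F x := f (sig x) in
  exists a b x1 x2, [/\ 0 < b, x1 != 0,
    vpd 1 (vpd 1 F) q0 = a *: tau + b *: xi (pt2 u 0),
    vpd 0 F q0 = x1 *: tau &
    vpd 0 (vpd 0 F) q0 = x2 *: tau + x1 ^+ 2 *: vpd 0 (vpd 0 f) (pt2 u 0)].
Proof.
move=> l0 ce Gf [dphi phiJ xia chart] uJ frame sigd sigq q01 F1 tau F.
have fa w : w \in `[- l, l] -> map_analytic_at f (pt2 w 0).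
  by move=> wJ; apply: (Gomega_analytic Gf); exact: Jseg_pt2.
have Jp := Jseg_pt2 uJ.
have [psi dpsi] := Jdiffeo_local dphi.
pose ft q := f (phi q).
have fta w : w \in `[- l, l] -> map_analytic_at ft (pt2 w 0).
  move=> wJ; have [phia _ _ _ _] := dpsi _ (Jseg_pt2 wJ).
  by apply: (@map_analytic_comp _ _ _ _ f phi) => //; rewrite phiJ//; exact: fa.
have ft0 w : w \in `[- l, l] -> ft (pt2 w 0) = f (pt2 w 0) by move=> wJ; rewrite /ft phiJ.
have ft1 := J_vpd0_eq l0 fta fa ft0.
have ft2 := J_vpd0_eq l0 (fun w wJ => map_analytic_vpd 0 (fta w wJ))
  (fun w wJ => map_analytic_vpd 0 (fa w wJ)) ft1.
have [t1 t2] := axis_unit l0 ce Gf uJ.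
have [_ [_ nn tn] [bb bt bn] [a [r [r0 xE]]]] := angle_frameP t1 t2 frame.
have [_ psia phi1 phi2 _] := dpsi _ Jp.
have phip : phi (pt2 u 0) = pt2 u 0 by exact: phiJ.
have psip : psi (pt2 u 0) = pt2 u 0 by rewrite -{1}phip (nbhs_singleton phi1).
have [siga _] := sigd; have sigc := map_analytic_continuous siga.
have psid : local_diffeo_at psi (sig q0).
  rewrite sigq; split => //; exists phi; split => //.
    by rewrite psip; have [] := dpsi _ Jp.
  by rewrite psip.
have := @chart_second_order R ft F (fun q => psi (sig q)) (axis_curve f) xi q0 (pt2 u 0)
  (fta u uJ) (xia _ Jp) (pt2_1 _ _) (chart _ Jp) _
  (@map_analytic_comp _ _ _ _ psi sig q0 psid.1 siga) _
  (local_diffeo_jdet (local_diffeo_comp sigd psid)) q01 _ F1.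
rewrite ft1// ft2//; apply.
- have [] := gram_frame a theta t1 nn tn bb bt bn r0; rewrite -xE => -> _ _ ->.
  by rewrite t1 mul1r [a ^+ 2 + _]addrC addrK; rewrite lt0r_neq0// exprn_gt0.
- by rewrite sigq.
- have H : nbhs (sig q0) [set q | phi (psi q) = q] by rewrite sigq.
  by apply: filterS (near_pull sigc H) => q /= E; rewrite /F /ft E.
Qed.

(** Two charts differ by a change of coordinates that alters [xi] on the axis by a
    positive factor and a tangential term, neither of which affects the angle. *)
Lemma angle_unique l c f th1 th2 u :
  0 < l -> arclength_embedding l c -> Gomega l c f ->
  cuspidal_angle l f th1 -> cuspidal_angle l f th2 -> u \in `[- l, l] ->
  cos (th1 u) = cos (th2 u) /\ sin (th1 u) = sin (th2 u).
Proof.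
move=> l0 ce Gf /cuspidal_angleP[_ _ [phi1 [xi1 [C1 A1]]]].
move=> /cuspidal_angleP[_ _ [phi2 [xi2 [C2 A2]]]] uJ.
have Jp := Jseg_pt2 uJ.
have [d2 phi2J xi2a chart2] := C2.
have fp : map_analytic_at f (pt2 u 0) by exact: (Gomega_analytic Gf Jp).
have phi2p := phi2J u uJ.
have [psi2 dpsi2] := Jdiffeo_local d2; have [phi2a _ _ _ _] := dpsi2 _ Jp.
have Fa : map_analytic_at (fun x => f (phi2 x)) (pt2 u 0).
  by apply: (@map_analytic_comp _ _ _ _ f phi2) => //; rewrite phi2p.
have F1 : nbhs (pt2 u 0) [set q | vpd 1 (fun x => f (phi2 x)) q = q 0 1 *: edge_slope xi2 q].
  near=> q; apply: (vpd1_chart (gam := axis_curve f)); near: q.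
  - exact: map_analytic_near.
  - by apply: map_analytic_near; exact: xi2a.
  - by apply: nbhs_interior; exact: chart2 _ Jp.
have F1ax : near_axis (pt2 u 0) (fun q => vpd 1 (fun x => f (phi2 x)) q = 0).
  by rewrite /near_axis; apply: filterS F1 => q /= -> ->; rewrite scale0r.
have [a [b [_ [_ [b0 _ E _ _]]]]] := chart_transfer l0 ce Gf C1 uJ (A1 u uJ)
  (Jdiffeo_local_diffeo d2 Jp) phi2p (pt2_1 _ _) F1ax.
have F11 : vpd 1 (vpd 1 (fun x => f (phi2 x))) (pt2 u 0) = xi2 (pt2 u 0).
  rewrite (nbhs_singleton (near_eq_vpd 1 F1)) vpdZ; last 2 first.
  - exact: analytic_coord.
  - by apply: edge_slope_analytic; exact: xi2a.
  by rewrite pd_coord2 eqxx scale1r pt2_1 scale0r addr0 /edge_slope pt2_1 mulr0 scale0r addr0.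
have [t1 t2] := axis_unit l0 ce Gf uJ.
have [_ [_ nn tn] [bb bt bn] [a1 [r1 [r10 x1E]]]] := angle_frameP t1 t2 (A1 u uJ).
have [_ _ _ [a2 [r2 [r20 x2E]]]] := angle_frameP t1 t2 (A2 u uJ).
have [_ n1 s1 _] := gram_frame a1 (th1 u) t1 nn tn bb bt bn r10.
have [_ n2 s2 _] := gram_frame a2 (th2 u) t1 nn tn bb bt bn r20.
rewrite -x1E in n1 s1; rewrite -x2E -F11 E in n2 s2.
have [nt bt'] : dot3 (principal_normal (axis_curve f) u) (vpd 0 f (pt2 u 0)) = 0 /\
    dot3 (binormal (axis_curve f) u) (vpd 0 f (pt2 u 0)) = 0 by split => //; rewrite dot3C.
rewrite dot3Dr !dot3Zr nt n1 mulr0 add0r in n2.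
rewrite dot3Dr !dot3Zr bt' s1 mulr0 add0r in s2.
have k1 := cos2Dsin2 (th1 u); have k2 := cos2Dsin2 (th2 u).
have s2' : b * (r1 * sin (th1 u)) = r2 * sin (th2 u) by lra.
have br : b * r1 = r2.
  have br0 : 0 < b * r1 by rewrite mulr_gt0.
  have : (b * r1) ^+ 2 = r2 ^+ 2.
    rewrite -[LHS]mulr1 -k1 -[RHS]mulr1 -k2.
    have -> : (b * r1) ^+ 2 * (cos (th1 u) ^+ 2 + sin (th1 u) ^+ 2) =
      (b * (r1 * cos (th1 u))) ^+ 2 + (b * (r1 * sin (th1 u))) ^+ 2 by ring.
    by rewrite n2 s2'; ring.
  by move=> /eqP; rewrite eqrXn2 ?ltW// => /eqP.
have r2n : r2 != 0 by rewrite gt_eqF.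
by split; apply: (mulfI r2n); rewrite -?n2 -?s2' -br mulrA.
Unshelve. all: by end_near. Qed.

End Reparametrization.

(** * Reparametrization by an isometry of the form *)

Section IsometriesOfTheForm.
Context {R : realType}.
Implicit Types (l : R) (f g : 'rV[R]_2 -> 'rV[R]_3) (phi : 'rV[R]_2 -> 'rV[R]_2).

Lemma vpd0_uscale_comp m e (h : 'rV[R]_2 -> 'rV[R]_m) u : map_analytic_at h (pt2 (e * u) 0) ->
  vpd 0 (fun q => h (uscale e q)) (pt2 u 0) = e *: vpd 0 h (pt2 (e * u) 0).
Proof.
move=> ha; have da : differentiable h (uscale e (pt2 u 0)).
  by rewrite uscale_pt2; exact: map_analytic_differentiable.
rewrite (vpd_chain 0 da (map_analytic_differentiable (uscale_analytic e _))).
by rewrite sum2 vpd0_uscale !mxE /= uscale_pt2 mulr1 mulr0 scale0r addr0.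
Qed.

(** Derivatives along J see [phi] through its values on J, so [phi] may be
    replaced by the linear map [uscale e]. *)
Lemma reparam_derivatives l (g : 'rV[R]_2 -> 'rV[R]_3) phi e : 0 < l -> e ^+ 2 = 1 ->
  (forall p, Jseg l p -> map_analytic_at g p) -> Jdiffeo l phi ->
  (forall u, u \in `[- l, l] -> phi (pt2 u 0) = pt2 (e * u) 0) ->
  forall u, u \in `[- l, l] ->
  vpd 0 (fun q => g (phi q)) (pt2 u 0) = e *: vpd 0 g (pt2 (e * u) 0) /\
  vpd 0 (vpd 0 (fun q => g (phi q))) (pt2 u 0) = vpd 0 (vpd 0 g) (pt2 (e * u) 0).
Proof.
move=> l0 e2 ga dphi phiJ; have [psi dpsi] := Jdiffeo_local dphi.
have gJ u : u \in `[- l, l] -> map_analytic_at g (pt2 (e * u) 0).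
  by move=> uJ; apply: ga; apply: Jseg_pt2; exact: mem_J_scale.
have gphia u : u \in `[- l, l] -> map_analytic_at (fun q => g (phi q)) (pt2 u 0).
  move=> uJ; have [phia _ _ _ _] := dpsi _ (Jseg_pt2 uJ).
  by apply: (@map_analytic_comp _ _ _ _ g phi) => //; rewrite phiJ//; exact: gJ.
have gsa m (h : 'rV[R]_2 -> 'rV[R]_m) u : map_analytic_at h (pt2 (e * u) 0) ->
    map_analytic_at (fun q => h (uscale e q)) (pt2 u 0).
  move=> ha; apply: (@map_analytic_comp _ _ _ _ h (uscale e)); last exact: uscale_analytic.
  by rewrite uscale_pt2.
have E0 u : u \in `[- l, l] -> g (phi (pt2 u 0)) = g (uscale e (pt2 u 0)).
  by move=> uJ; rewrite phiJ// uscale_pt2.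
have E1 := J_vpd0_eq l0 gphia (fun u uJ => gsa _ g u (gJ u uJ)) E0.
have E1' u : u \in `[- l, l] -> vpd 0 (fun q => g (phi q)) (pt2 u 0) =
    e *: vpd 0 g (uscale e (pt2 u 0)).
  by move=> uJ; rewrite E1// vpd0_uscale_comp ?uscale_pt2//; exact: gJ.
have ea u : u \in `[- l, l] -> map_analytic_at (fun q => e *: vpd 0 g (uscale e q)) (pt2 u 0).
  move=> uJ; apply: map_analyticZ; first exact: analytic_cst.
  by apply: gsa; apply: map_analytic_vpd; exact: gJ.
move=> u uJ; split; first by rewrite E1'// uscale_pt2.
rewrite (J_vpd0_eq l0 (fun w wJ => map_analytic_vpd 0 (gphia w wJ)) ea E1')//.
have ga' := map_analytic_vpd 0 (gJ u uJ).
rewrite (vpdZ 0 (analytic_cst e _) (gsa _ _ _ ga')) pdE derive_cst scale0r add0r.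
by rewrite vpd0_uscale_comp// scalerA -expr2 e2 scale1r.
Qed.

(** By the identity theorem [phi] is linear on the axis beyond the end points
    too, as a chart on a full neighbourhood of J requires. *)
Lemma axis_param_near l phi e : 0 < l -> Jdiffeo l phi ->
  (forall u, u \in `[- l, l] -> phi (pt2 u 0) = pt2 (e * u) 0) ->
  forall p, Jseg l p -> near_axis p (fun q => phi q = uscale e q).
Proof.
move=> l0 dphi phiJ _ [u uJ <-]; have [psi dpsi] := Jdiffeo_local dphi.
have H j : near_axis (pt2 u 0) (fun q => phi q 0 j + -1 * uscale e q 0 j = 0).
  apply: (@axis_identity _ l) => // w wJ; last by rewrite phiJ// uscale_pt2 mulN1r subrr.
  have [phia _ _ _ _] := dpsi _ (Jseg_pt2 wJ).
  apply: analyticD; first exact: phia.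
  by apply: analyticM; [exact: analytic_cst|exact: uscale_analytic].
move: (H 0) (H 1); rewrite /near_axis; apply: filterS2 => q H0 H1 q1.
apply/rowP => j; apply/eqP; rewrite -subr_eq0 -mulN1r; apply/eqP.
by case: (ord2P j) => ->; [exact: H0|exact: H1].
Qed.

Lemma curvature_reparam l g phi e u : 0 < l -> e ^+ 2 = 1 ->
  (forall p, Jseg l p -> map_analytic_at g p) -> Jdiffeo l phi ->
  (forall w, w \in `[- l, l] -> phi (pt2 w 0) = pt2 (e * w) 0) -> u \in `[- l, l] ->
  curvature (axis_curve (fun q => g (phi q))) u = curvature (axis_curve g) (e * u).
Proof.
move=> l0 e2 ga dphi phiJ uJ; rewrite /curvature !derive1_axis_curve2.
by have [_ ->] := reparam_derivatives l0 e2 ga dphi phiJ uJ.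
Qed.

Lemma fun_analytic_scale e (theta : R -> R) u : fun_analytic_at theta (e * u) ->
  fun_analytic_at (fun w => e * theta (e * w)) u.
Proof.
move=> ta; apply: analyticM; first exact: analytic_cst.
rewrite (_ : (fun x => theta _) = (fun x : 'rV[R]_1 =>
  theta ((const_mx (e * x 0 0) : 'rV[R]_1) 0 0))); last by apply/funext => x; rewrite mxE.
apply: (@analytic_comp _ _ _ (fun x : 'rV[R]_1 => theta (x 0 0))
  (fun x : 'rV[R]_1 => const_mx (e * x 0 0) : 'rV[R]_1) (const_mx u)) => [|j].
  by rewrite mxE.
rewrite (_ : (fun x => _) = (fun x : 'rV[R]_1 => e * x 0 0)).
  by apply: analyticM; [exact: analytic_cst|exact: analytic_coord].
by apply/funext => x; rewrite mxE.
Qed.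

Lemma row_free_scale (e : R) (tau x : 'rV[R]_3) : e != 0 ->
  row_free (col_mx (e *: tau) x) = row_free (col_mx tau x).
Proof.
move=> e0; rewrite /row_free -(addsmxE (e *: tau) x) -(addsmxE tau x).
by rewrite (adds_eqmx (eqmx_scale tau e0) (eqmx_refl x)).
Qed.

(** Reversing the orientation of the axis reverses the binormal, hence the sign
    of the cuspidal angle. *)
Lemma cuspidal_angle_reparam l c g phi e theta : 0 < l -> e ^+ 2 = 1 -> Gomega l c g ->
  Jdiffeo l phi -> (forall u, u \in `[- l, l] -> phi (pt2 u 0) = pt2 (e * u) 0) ->
  cuspidal_angle l g theta -> - pi < e * theta 0 <= pi ->
  cuspidal_angle l (fun q => g (phi q)) (fun u => e * theta (e * u)).
Proof.
move=> l0 e2 Gg dphi phiJ /cuspidal_angleP[ta _ [ph [xi [[dph phJ xia chart] frame]]]] t0.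
have ga p (Jp : Jseg l p) := Gomega_analytic Gg Jp.
have eJ u := @mem_J_scale _ e l u e2.
have e0 : e != 0.
  by apply/eqP => e0; move/eqP: e2; rewrite e0 expr0n /= eq_sym oner_eq0.
apply/cuspidal_angleP; split; first by move=> u uJ; apply: fun_analytic_scale; exact: ta (eJ u uJ).
  by rewrite mulr0.
have [psi [dpsi inv1 inv2]] := Jdiffeo_inv dphi.
have dR := Jdiffeo_uscale l e2.
have psiJ u : u \in `[- l, l] -> psi (pt2 (e * u) 0) = pt2 u 0.
  move=> uJ; rewrite -phiJ//; exact: nbhs_singleton (inv1 _ (Jseg_pt2 uJ)).
exists (fun q => psi (ph (uscale e q))), (fun q => xi (uscale e q)); split; first split.
- exact: (Jdiffeo_comp (Jdiffeo_comp dR dph) dpsi).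
- by move=> u uJ; rewrite uscale_pt2 phJ ?psiJ//; exact: eJ.
- move=> _ [u uJ <-]; apply: (@map_analytic_comp _ _ _ _ xi (uscale e)).
    by rewrite uscale_pt2; apply: xia; apply: Jseg_pt2; exact: eJ.
  exact: uscale_analytic.
- apply/near_JnearP => p Jp.
  have [u uJ pE] := Jp.
  have Rp : Jseg l (uscale e p) by rewrite -pE uscale_pt2; apply: Jseg_pt2; exact: eJ.
  have Rc := map_analytic_continuous (uscale_analytic e p).
  have h1 : nbhs p [set q | phi (psi (ph (uscale e q))) = ph (uscale e q)].
    exact: (germ_eq_comp (Jdiffeo_comp dR dph) inv2 Jp).
  have h2 : nbhs p [set q | g (ph (uscale e q)) = axis_curve g (uscale e q 0 0) +
      (uscale e q 0 1 ^+ 2 / 2) *: xi (uscale e q)].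
    exact: (near_pull Rc (chart _ Rp)).
  have ac : {for p, continuous (fun q : 'rV[R]_2 => pt2 (q 0 0) 0 : 'rV[R]_2)}.
    apply: map_analytic_continuous; apply: map_analytic_pt2; first exact: analytic_coord.
    exact: analytic_cst.
  have h3 : nbhs p [set q | phi (pt2 (q 0 0) 0) = uscale e (pt2 (q 0 0) 0)].
    have H := axis_param_near l0 dphi phiJ Jp.
    have pE' : pt2 (p 0 0) 0 = p by rewrite -pE pt2_0.
    have H' : nbhs (pt2 (p 0 0) 0) [set q : 'rV[R]_2 | q 0 1 = 0 -> phi q = uscale e q].
      by rewrite pE'.
    apply: filterS (near_pull ac H') => q /=; apply; exact: pt2_1.
  apply: filterS3 h1 h2 h3 => q /= -> -> E.
  by rewrite /axis_curve E uscale_pt2 /uscale pt2_0 pt2_1.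
- move=> u uJ; have [] := frame _ (eJ u uJ); rewrite /angle_frame.
  have [d1 d2] := reparam_derivatives l0 e2 ga dphi phiJ uJ.
  have nE : principal_normal (axis_curve (fun q => g (phi q))) u =
      principal_normal (axis_curve g) (e * u).
    by rewrite /principal_normal (curvature_reparam l0 e2 ga dphi phiJ uJ) !derive1_axis_curve2 d2.
  rewrite /binormal nE !derive1_axis_curve d1 uscale_pt2.
  set tau := vpd 0 g _; set x := xi _; set n := principal_normal _ _ => rf.
  have -> : dot3 x (e *: tau) *: (e *: tau) = dot3 x tau *: tau.
    by rewrite dot3Zr scalerA mulrC mulrA -expr2 e2 mul1r.
  move=> ->; split.
    rewrite (row_free_scale tau x e0); exact rf.
  have -> : cross3 (e *: tau) n = e *: cross3 tau n.
    by apply/rowP => j; rewrite /cross3 /pt3 !mxE; case: j => -[|[|[|//]]] j3 /=; ring.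
  move: e2 => /eqP; rewrite sqrf_eq1 => /orP[] /eqP ->; first by rewrite !mul1r scale1r.
  by rewrite !mulN1r cosN sinN scaleN1r scaleNr scalerN opprK.
Qed.

(** The singular set is determined by the form, so that an isometry preserves
    it. *)
Lemma Gomega_reparam l c g phi e : e ^+ 2 = 1 -> Gomega l c g -> Jdiffeo l phi ->
  (forall u, u \in `[- l, l] -> phi (pt2 u 0) = pt2 (e * u) 0) ->
  same_first_fundamental_form l (fun q => g (phi q)) g ->
  Gomega l c (fun q => g (phi q)).
Proof.
move=> e2 Gg dphi phiJ iso; have [[U [Uo JU Ua Us]] gen ax] := Gg.
have [psi dpsi] := Jdiffeo_local dphi.
have gphia p : Jseg l p -> map_analytic_at (fun q => g (phi q)) p.
  move=> Jp; have [phia _ _ _ [Jphi _]] := dpsi p Jp.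
  by apply: (@map_analytic_comp _ _ _ _ g phi) => //; exact: Gomega_analytic Gg Jphi.
split.
- exists ([set q | map_analytic_at (fun x => g (phi x)) q /\
           (singular_point (fun x => g (phi x)) q <-> q 0 1 = 0)]°); split.
  + exact: open_interior.
  + move=> p Jp; rewrite /interior /=.
    have nU : nbhs p U by apply: open_nbhs_nbhs; split => //; exact: JU.
    near=> q.
    have aq : map_analytic_at (fun x => g (phi x)) q.
      by near: q; exact: (map_analytic_near (gphia p Jp)).
    have Uq : U q by near: q.
    have eq : first_fundamental_form (fun x => g (phi x)) q = first_fundamental_form g q.
      near: q; exact (iso p Jp).
    split; first exact aq.
    exact (iff_trans (singular_point_fff eq) (Us q Uq)).
  + move=> p Up; exact (interior_subset Up).1.
  + move=> p Up; exact (interior_subset Up).2.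
- move=> p Jp; have [phia _ inv1 _ [Jphi _]] := dpsi p Jp.
  have [_ psia _ inv2 _] := dpsi _ Jphi.
  have [al ala [p0 [Phi [dp0 dPhi p00 Phi0 model]]]] := gen _ Jphi.
  exists al => //; exists (fun q => psi (p0 q)), Phi.
  have psip : psi (phi p) = p by exact: nbhs_singleton inv1.
  have dpsi' : local_diffeo_at psi (p0 0).
    rewrite p00; split; first exact psia.
    by exists phi; split; [rewrite psip; exact phia|exact inv2|rewrite psip; exact inv1].
  split.
  + exact: (local_diffeo_comp dp0 dpsi').
  + exact dPhi.
  + by rewrite p00.
  + exact Phi0.
  + have p0c := map_analytic_continuous dp0.1.
    have inv2' : nbhs (p0 0) [set q | phi (psi q) = q] by rewrite p00.
    by apply: filterS2 model (near_pull p0c inv2') => q /= <- ->.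
- have oJ u : u \in `[- l, l] -> - u \in `[- l, l].
    by rewrite !in_itv /= => /andP[h1 h2]; apply/andP; split; lra.
  move: e2 => /eqP; rewrite sqrf_eq1 => /orP[] /eqP eE.
    by case: ax => ax; [left|right] => u uJ; rewrite phiJ// eE mul1r ax.
  case: ax => ax; [right|left] => u uJ; rewrite phiJ// eE mulN1r ax ?oJ//.
  by rewrite opprK.
Unshelve. all: by end_near. Qed.

Lemma Gadmissible_reparam l c g phi e theta : 0 < l -> e ^+ 2 = 1 -> Gomega l c g ->
  cuspidal_angle l g theta ->
  sup [set `|singular_curvature g theta u| | u in `[- l, l]] <
    inf [set curvature (axis_curve g) u | u in `[- l, l]] ->
  - pi < e * theta 0 <= pi -> Jdiffeo l phi ->
  (forall u, u \in `[- l, l] -> phi (pt2 u 0) = pt2 (e * u) 0) ->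
  same_first_fundamental_form l (fun q => g (phi q)) g ->
  Gadmissible l c (fun q => g (phi q)).
Proof.
move=> l0 e2 Gg ang ineq t0 dphi phiJ iso; split; first exact: (Gomega_reparam e2 Gg dphi phiJ iso).
exists (fun u => e * theta (e * u)); first exact: (cuspidal_angle_reparam l0 e2 Gg dphi phiJ ang t0).
have ga p (Jp : Jseg l p) := Gomega_analytic Gg Jp.
have kE u (uJ : u \in `[- l, l]) := curvature_reparam l0 e2 ga dphi phiJ uJ.
have image_e (h h' : R -> R) : (forall u, u \in `[- l, l] -> h u = h' (e * u)) ->
    [set h u | u in `[- l, l]] = [set h' u | u in `[- l, l]].
  move=> hh; apply/seteqP; split => [_ [u uJ <-]|_ [u uJ <-]].
    by exists (e * u); [exact: mem_J_scale|rewrite hh].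
  by exists (e * u); [exact: mem_J_scale|rewrite hh ?mem_J_scale// mulrA -expr2 e2 mul1r].
rewrite (image_e _ (curvature (axis_curve g)) kE).
rewrite (image_e (fun u => `|singular_curvature (fun q => g (phi q))
  (fun w => e * theta (e * w)) u|) (fun u => `|singular_curvature g theta u|)) => [|u uJ].
  exact ineq.
rewrite /singular_curvature (kE u uJ); congr (`|_ * _|).
by move: e2 => /eqP; rewrite sqrf_eq1 => /orP[] /eqP ->; rewrite ?mul1r// !mulN1r cosN.
Qed.

(** The form of f o phi is the pullback of the form of f. *)
Lemma germ_isometry l c f phi : Gomega l c f -> Jdiffeo l phi ->
  germ_eq l (pullback_form phi (first_fundamental_form f)) (first_fundamental_form f) <->
  same_first_fundamental_form l (fun q => f (phi q)) f.
Proof.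
move=> Gf dphi; have [psi dpsi] := Jdiffeo_local dphi.
have H p : Jseg l p -> nbhs p [set q | first_fundamental_form (fun x => f (phi x)) q =
    pullback_form phi (first_fundamental_form f) q].
  move=> Jp; have [phia _ _ _ [Jphi _]] := dpsi p Jp.
  have phic := map_analytic_continuous phia.
  have fa := Gomega_analytic Gf Jphi.
  near=> q; apply: fff_comp; apply: map_analytic_differentiable; near: q.
    exact: (near_pull (P := map_analytic_at f) phic (map_analytic_near fa)).
  exact: map_analytic_near.
split=> iso p Jp.
- by apply: filterS2 (H p Jp) (iso p Jp) => q E1 E2; exact (etrans E1 E2).
- by apply: filterS2 (H p Jp) (iso p Jp) => q E1 E2; exact (etrans (esym E1) E2).
Unshelve. all: by end_near. Qed.

End IsometriesOfTheForm.

(** * Invariance of the singular curvature *)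

Section SingularCurvature.
Context {R : realType}.
Implicit Types (l : R) (f g : 'rV[R]_2 -> 'rV[R]_3) (phi : 'rV[R]_2 -> 'rV[R]_2).

(** The numbers of [same_gram_on_axis] in the Frenet frame: A is the tangential
    part and B the orthogonal length of the second transverse derivative. *)
Lemma axis_numbers l c f phi xi theta u (sig : 'rV[R]_2 -> 'rV[R]_2) q0 :
  0 < l -> arclength_embedding l c -> Gomega l c f ->
  edge_chart l f phi xi -> u \in `[- l, l] -> angle_frame f xi theta u ->
  local_diffeo_at sig q0 -> sig q0 = pt2 u 0 -> q0 0 1 = 0 ->
  near_axis q0 (fun q => vpd 1 (fun x => f (sig x)) q = 0) ->
  let F x := f (sig x) in
  let Fu := vpd 0 F q0 in let Fuu := vpd 0 (vpd 0 F) q0 in let Fvv := vpd 1 (vpd 1 F) q0 in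
  exists A B x1 x2, [/\ 0 < B /\ x1 != 0,
    dot3 Fu Fu = x1 ^+ 2, dot3 Fuu Fu = x1 * x2, dot3 Fu Fvv = x1 * A &
    dot3 Fvv Fvv = A ^+ 2 + B ^+ 2 /\
    dot3 Fuu Fvv = x2 * A + x1 ^+ 2 * (B * (curvature (axis_curve f) u * cos theta))].
Proof.
move=> l0 ce Gf chart uJ frame sigd sigq q01 F1 F Fu Fuu Fvv.
have [a [b [x1 [x2 [b0 x10 Evv Eu Euu]]]]] := chart_transfer l0 ce Gf chart uJ frame sigd sigq q01 F1.
have [t1 t2] := axis_unit l0 ce Gf uJ.
have [[k0 kE] [_ nn tn] [bb bt bn] [a1 [r1 [r10 xE]]]] := angle_frameP t1 t2 frame.
(* Abstracting the frame keeps its vectors from being unfolded as multiples. *)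
move: kE nn tn bb bt bn xE; generalize (principal_normal (axis_curve f) u) => n.
generalize (binormal (axis_curve f) u) => bi kE nn tn bb bt bn xE.
have br : 0 < b * r1 by rewrite mulr_gt0.
have [h1 h2 _ h4] := gram_frame (a + b * a1) theta t1 nn tn bb bt bn br.
rewrite xE scalerDr (scalerA b a1) (scalerA b r1) addrA -scalerDl -/Fvv in Evv.
rewrite -Evv in h1 h2 h4.
exists (a + b * a1), (b * r1), x1, x2; split => //.
- by rewrite /Fu Eu dot3Zl dot3Zr t1 mulr1 expr2.
- rewrite /Fuu /Fu Euu Eu kE dot3Dl !dot3Zl !dot3Zr t1.
  by rewrite [dot3 n _]dot3C tn; ring.
- by rewrite /Fu Eu dot3Zl h1.
- split => //; rewrite /Fuu Euu kE dot3Dl !dot3Zl h1 h2; ring.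
Qed.

(** These numbers can be solved for B, and then for the singular curvature S. *)
Lemma axis_numbers_unique (A B x1 x2 S A' B' y1 y2 S' : R) :
  0 < B -> 0 < B' -> x1 != 0 ->
  x1 ^+ 2 = y1 ^+ 2 -> x1 * x2 = y1 * y2 -> x1 * A = y1 * A' ->
  A ^+ 2 + B ^+ 2 = A' ^+ 2 + B' ^+ 2 ->
  x2 * A + x1 ^+ 2 * (B * S) = y2 * A' + y1 ^+ 2 * (B' * S') -> S = S'.
Proof.
move=> B0 B0' x10 e1 e2 e3 e4 e5.
have x12 : x1 ^+ 2 != 0 by rewrite expf_neq0.
have A2 : A ^+ 2 = A' ^+ 2.
  apply: (mulfI x12); rewrite -exprMn e3 exprMn -e1 //.
have BB : B = B'.
  have : B ^+ 2 = B' ^+ 2 by lra.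
  by move/eqP; rewrite eqrXn2 ?ltW// => /eqP.
have E : x2 * A = y2 * A'.
  apply: (mulfI x12); rewrite {2}e1.
  have -> : x1 ^+ 2 * (x2 * A) = (x1 * x2) * (x1 * A) by ring.
  by rewrite e2 e3; ring.
have : x1 ^+ 2 * (B * S) = x1 ^+ 2 * (B * S').
  by rewrite {2}e1 {2}BB; lra.
by move=> /(mulfI x12)/(mulfI (lt0r_neq0 B0)).
Qed.

(** In a chart f_v is v times the slope. *)
Lemma chart_singular_axis l c f phi xi p : Gomega l c f -> edge_chart l f phi xi -> Jseg l p ->
  phi p = p -> near_axis p (fun q => vpd 1 (fun x => f (phi x)) q = 0).
Proof.
move=> Gf [dphi phiJ xia chart] Jp phip; have [psi dpsi] := Jdiffeo_local dphi.
have [phia _ _ _ _] := dpsi _ Jp.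
have Fa : map_analytic_at (fun x => f (phi x)) p.
  by apply: (@map_analytic_comp _ _ _ _ f phi) => //; rewrite phip; exact: Gomega_analytic Gf Jp.
rewrite /near_axis; near=> q => q1.
have -> : vpd 1 (fun x => f (phi x)) q = q 0 1 *: edge_slope xi q.
  apply: (vpd1_chart (gam := axis_curve f)); near: q.
  - exact: map_analytic_near.
  - by apply: map_analytic_near; exact: xia.
  - by apply: nbhs_interior; exact: chart _ Jp.
by rewrite q1 scale0r.
Unshelve. all: by end_near. Qed.

(** Singular directions are null directions of the first fundamental form. *)
Lemma same_gram_singular (F G : 'rV[R]_2 -> 'rV[R]_3) q0 : nbhs q0 (same_gram F G) ->
  near_axis q0 (fun q => vpd 1 F q = 0) -> near_axis q0 (fun q => vpd 1 G q = 0).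
Proof.
rewrite /near_axis => FG; apply: filterS2 FG => q FGq F1 q1.
by apply: dot3_eq0; rewrite -FGq F1// dot30l.
Qed.

Lemma half_eq (p1 p2 s1 t1 s2 t2 : R) : p1 = p2 -> p1 = s1 + t1 -> p2 = s2 + t2 ->
  t1 = s1 -> t2 = s2 -> s1 = s2.
Proof. by lra. Qed.

(** The singular curvature is intrinsic, hence invariant under an isometry that
    reverses the axis. *)
Lemma singular_curvature_reversed l c f phi theta :
  0 < l -> arclength_embedding l c -> Gomega l c f -> cuspidal_angle l f theta ->
  Jdiffeo l phi -> (forall u, u \in `[- l, l] -> phi (pt2 u 0) = pt2 (-1 * u) 0) ->
  same_first_fundamental_form l (fun q => f (phi q)) f ->
  forall u, u \in `[- l, l] ->
    singular_curvature f theta u = singular_curvature f theta (-1 * u).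
Proof.
move=> l0 ce Gf /cuspidal_angleP[_ _ [ph [xi [chart frame]]]] dphi phiJ iso u uJ.
have e2 : (-1 : R) ^+ 2 = 1 by rewrite sqrrN expr1n.
have uJ' : -1 * u \in `[- l, l] by exact: mem_J_scale.
have Jp := Jseg_pt2 uJ.
have [dph phJ _ _] := chart.
have php := phJ u uJ.
have [psi dpsi] := Jdiffeo_local dphi; have [phia _ _ _ [Jphi _]] := dpsi _ Jp.
have dph0 := Jdiffeo_local_diffeo dph Jp.
pose F1 := fun x => f (ph x); pose F2 := fun x => f (phi (ph x)).
have fa p (J : Jseg l p) := Gomega_analytic Gf J.
have F1a : map_analytic_at F1 (pt2 u 0).
  by apply: (@map_analytic_comp _ _ _ _ f ph); [rewrite php; exact: fa|exact dph0.1].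
have sigd : local_diffeo_at (fun x => phi (ph x)) (pt2 u 0).
  apply: local_diffeo_comp => //; rewrite php; exact: Jdiffeo_local_diffeo dphi Jp.
have sigq : phi (ph (pt2 u 0)) = pt2 (-1 * u) 0 by rewrite php phiJ.
have F2a : map_analytic_at F2 (pt2 u 0).
  apply: (@map_analytic_comp _ _ _ _ f (fun x => phi (ph x))); last exact sigd.1.
  by rewrite sigq; apply: fa; exact: Jseg_pt2.
have fphia : map_analytic_at (fun q => f (phi q)) (ph (pt2 u 0)).
  rewrite php; apply: (@map_analytic_comp _ _ _ _ f phi) => //; exact: fa.
have fa' : map_analytic_at f (ph (pt2 u 0)) by rewrite php; exact: fa.
have iso' : \forall q \near ph (pt2 u 0),
    first_fundamental_form (fun x => f (phi x)) q = first_fundamental_form f q.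
  rewrite php; exact (iso _ Jp).
have SG : nbhs (pt2 u 0) (same_gram F2 F1).
  exact (near_same_gram F2a F1a (near_fff_comp fphia fa' dph0.1 iso')).
have SG' : nbhs (pt2 u 0) (same_gram F1 F2).
  by apply: filterS SG => q H i j; rewrite H.
have S1 := chart_singular_axis Gf chart Jp php.
have S2 := same_gram_singular SG' S1.
have [A [B [x1 [x2 [[B0 x10] n1 n2 n3 [n4 n5]]]]]] :=
  axis_numbers l0 ce Gf chart uJ (frame u uJ) dph0 php (pt2_1 _ _) S1.
have [A' [B' [y1 [y2 [[B0' _] m1 m2 m3 [m4 m5]]]]]] :=
  axis_numbers l0 ce Gf chart uJ' (frame _ uJ') sigd sigq (pt2_1 _ _) S2.
have [g1 g2 g3] := same_gram_on_axis F1a F2a (pt2_1 _ _) S1 S2 SG'.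
have g0 : dot3 (vpd 0 F1 (pt2 u 0)) (vpd 0 F1 (pt2 u 0)) =
  dot3 (vpd 0 F2 (pt2 u 0)) (vpd 0 F2 (pt2 u 0)) by exact: (nbhs_singleton SG' 0 0).
have g4 : dot3 (vpd 0 (vpd 0 F1) (pt2 u 0)) (vpd 0 F1 (pt2 u 0)) =
    dot3 (vpd 0 (vpd 0 F2) (pt2 u 0)) (vpd 0 F2 (pt2 u 0)).
  have E : \forall q \near pt2 u 0, dot3 (vpd 0 F1 q) (vpd 0 F1 q) = dot3 (vpd 0 F2 q) (vpd 0 F2 q).
    by apply: filterS SG' => q; exact.
  have a1 := map_analytic_vpd 0 F1a; have a2 := map_analytic_vpd 0 F2a.
  exact (half_eq (nbhs_singleton (near_eq_pd 0 E)) (pd_dot3 0 a1 a1) (pd_dot3 0 a2 a2)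
    (dot3C _ _) (dot3C _ _)).
exact (axis_numbers_unique B0 B0' x10 (etrans (esym n1) (etrans g0 m1))
  (etrans (esym n2) (etrans g4 m2)) (etrans (esym n3) (etrans g1 m3))
  (etrans (esym n4) (etrans g2 m4)) (etrans (esym n5) (etrans g3 m5))).
Qed.

End SingularCurvature.

(** * Isometries of the form on the axis *)

Section IsometryAxis.
Context {R : realType}.
Implicit Types (l : R) (f g : 'rV[R]_2 -> 'rV[R]_3) (phi : 'rV[R]_2 -> 'rV[R]_2).

(** An isometry of the form preserves arc length on the axis, so it restricts to
    the identity or to the reversal of J. *)
Lemma isometry_axis l c f phi :
  0 < l -> arclength_embedding l c -> Gomega l c f -> Jdiffeo l phi ->
  same_first_fundamental_form l (fun q => f (phi q)) f ->
  exists2 e : R, e = 1 \/ e = -1 &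
    forall u, u \in `[- l, l] -> phi (pt2 u 0) = pt2 (e * u) 0.
Proof.
move=> l0 ce Gf dphi iso; have [psi dpsi] := Jdiffeo_local dphi.
have fa p (J : Jseg l p) := Gomega_analytic Gf J.
pose s u := phi (pt2 u 0) 0 0.
have sJ u : u \in `[- l, l] -> s u \in `[- l, l] /\ phi (pt2 u 0) = pt2 (s u) 0.
  move=> uJ; have [_ _ _ _ [[w wJ wE] _]] := dpsi _ (Jseg_pt2 uJ).
  by rewrite /s -wE pt2_0.
have s1 u : u \in `[- l, l] -> pd 0 (fun q => phi q 0 1) (pt2 u 0) = 0.
  apply: (J_pd0_zero l0) => w wJ; last by rewrite (sJ w wJ).2 pt2_1.
  by have [phia _ _ _ _] := dpsi _ (Jseg_pt2 wJ); exact: phia.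
have ds u : u \in `[- l, l] -> is_derive u (1 : R) s (pd 0 (fun q => phi q 0 0) (pt2 u 0)).
  move=> uJ; have [phia _ _ _ _] := dpsi _ (Jseg_pt2 uJ).
  have := derivableP (diff_derivable (v := ebase 0) (analytic_differentiable (phia 0))).
  rewrite -pdE => -[der val].
  have E : (fun h : R => h^-1 *: ((s \o shift u) (h *: 1) - s u)) =
     (fun h : R => h^-1 *: (((fun q => phi q 0 0) \o shift (pt2 u 0)) (h *: ebase 0)
        - phi (pt2 u 0) 0 0)).
    by apply/funext => h; rewrite /s /= !pt2E -scalerDl /GRing.scale/= mulr1.
  by apply: DeriveDef; [rewrite /derivable E|rewrite /derive E].
have s2 u : u \in `[- l, l] -> pd 0 (fun q => phi q 0 0) (pt2 u 0) ^+ 2 = 1.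
  move=> uJ; have Jp := Jseg_pt2 uJ; have [phia _ _ _ [Jphi _]] := dpsi _ Jp.
  have dp := map_analytic_differentiable phia.
  have df := map_analytic_differentiable (fa _ Jphi).
  have fphia : map_analytic_at (fun q => f (phi q)) (pt2 u 0).
    by apply: (@map_analytic_comp _ _ _ _ f phi) => //; exact: fa.
  have := nbhs_singleton (near_same_gram fphia (fa _ Jp) (iso _ Jp)) 0 0.
  rewrite (axis_unit l0 ce Gf uJ).1 (vpd_chain 0 df dp) sum2.
  rewrite !(pd_coord _ _ dp) s1// scale0r addr0 dot3Zl dot3Zr (sJ u uJ).2.
  by rewrite (axis_unit l0 ce Gf (sJ u uJ).1).1 mulr1 expr2.
(* The speed of s is 1 or -1 at each point, so s is 1-Lipschitz; being onto J,
   it must attain both ends of J at ends of J. *)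
have lip a b : a \in `[- l, l] -> b \in `[- l, l] -> a <= b -> `|s b - s a| <= b - a.
  move=> aJ bJ ab.
  have sub x : x \in `[a, b] -> x \in `[- l, l].
    move: aJ bJ; rewrite !in_itv /= => /andP[h1 h2] /andP[h3 h4] /andP[h5 h6].
    by apply/andP; split; lra.
  have [w wab ->] := @MVT_segment R s (fun u => pd 0 (fun q => phi q 0 0) (pt2 u 0)) a b ab
    (fun x xab => ds x (sub x (subset_itv_oo_cc xab))) (derivable_within_continuous
      (fun x xab => @ex_derive _ _ _ _ _ _ _ (ds x (sub x xab)))).
  have := s2 w (sub w wab); move=> /eqP; rewrite sqrf_eq1 => /orP[] /eqP ->.
    by rewrite mul1r ger0_norm ?subr_ge0.
  by rewrite mulN1r normrN ger0_norm ?subr_ge0.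
have surj w : w \in `[- l, l] -> exists2 a, a \in `[- l, l] & s a = w.
  move=> wJ; have [_ _ _ inv2 [_ [a aJ aE]]] := dpsi _ (Jseg_pt2 wJ).
  by exists a => //; rewrite /s aE (nbhs_singleton inv2) pt2_0.
have lJ : l \in `[- l, l] by rewrite in_itv /=; apply/andP; split; lra.
have nlJ : - l \in `[- l, l] by rewrite in_itv /=; apply/andP; split; lra.
have [a aJ sa] := surj _ nlJ; have [b bJ sb] := surj _ lJ.
have itv x : x \in `[- l, l] -> - l <= x /\ x <= l by rewrite in_itv /= => /andP[].
have [a1 a2] := itv _ aJ; have [b1 b2] := itv _ bJ.
have lipn x y : x \in `[- l, l] -> y \in `[- l, l] -> x <= y ->
    s y - s x <= y - x /\ s x - s y <= y - x.
  move=> xJ yJ xy; have := lip x y xJ yJ xy; rewrite ler_norml => /andP[h1 h2].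
  by split; lra.
have [ab|ba] := lerP a b.
  exists 1; first by left.
  have [h1 h2] := lipn a b aJ bJ ab.
  have aE : a = - l by lra.
  have bE : b = l by lra.
  move=> u uJ; have [u1 u2] := itv _ uJ; rewrite (sJ u uJ).2 mul1r; congr pt2.
  have [h3 h4] := lipn _ _ nlJ uJ u1; have [h5 h6] := lipn _ _ uJ lJ u2.
  rewrite -aE sa in h3 h4; rewrite -bE sb in h5 h6; lra.
exists (-1); first by right.
have [h1 h2] := lipn b a bJ aJ (ltW ba).
have aE : a = l by lra.
have bE : b = - l by lra.
move=> u uJ; have [u1 u2] := itv _ uJ; rewrite (sJ u uJ).2 mulN1r; congr pt2.
have [h3 h4] := lipn _ _ nlJ uJ u1; have [h5 h6] := lipn _ _ uJ lJ u2.
rewrite -bE sb in h3 h4; rewrite -aE sa in h5 h6; lra.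
Qed.

End IsometryAxis.

(** * Symmetries of the fold (u, v) -> (u, v^2) *)

Section Rigidity.
Context {R : realType}.
Implicit Types (l : R) (f g h : 'rV[R]_2 -> 'rV[R]_3) (phi w : 'rV[R]_2 -> 'rV[R]_2).

Lemma sign_choice (g d v : R) : g ^+ 2 = v ^+ 2 -> g * d = v -> 0 < d -> g = v.
Proof.
move=> g2 gd d0; have [v0|v0] := eqVneq v 0.
  by move: g2; rewrite v0 expr0n => /eqP; rewrite sqrf_eq0 => /eqP.
move/eqP: g2; rewrite eqf_sqr => /orP[/eqP//|/eqP gN].
suff : d = -1 by move=> dE; move: d0; rewrite dE ltr0N1.
by apply: (mulfI v0); rewrite mulrN1 -{2}gd gN mulNr opprK.
Qed.

(** Pointwise the second coordinate w2 is v or -v. Differentiating w2^2 = v^2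
    gives w2 * (dw2/dv) = v, so the sign of dw2/dv at the origin decides for all
    nearby points. *)
Lemma fold_symmetry w : map_analytic_at w 0 -> jdet w 0 != 0 ->
  (\forall q \near (0 : 'rV[R]_2), w q 0 0 = q 0 0 /\ w q 0 1 ^+ 2 = q 0 1 ^+ 2) ->
  (\forall q \near (0 : 'rV[R]_2), w q = q) \/ (\forall q \near (0 : 'rV[R]_2), w q = vflip q).
Proof.
move=> wa w0 wE; pose g q := w q 0 1; have ga : analytic_at g 0 by exact: wa.
pose d q := pd 1 g q; have da : analytic_at d 0 by exact: analytic_pd.
have dw := map_analytic_differentiable wa.
have d0 : d 0 != 0.
  apply: contraNneq w0 => d0; rewrite /jdet !(pd_coord _ _ dw) -/g -/(d 0) d0 mulr0.
  have -> : pd 1 (fun x => w x 0 0) 0 = pd 1 (fun x : 'rV[R]_2 => x 0 0) 0.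
    by apply: (nbhs_singleton (near_eq_pd 1 _)); apply: filterS wE => q [].
  by rewrite pd_coord2 mulr0 subrr.
have gd : \forall q \near (0 : 'rV[R]_2), g q * d q = q 0 1.
  have sq : \forall q \near (0 : 'rV[R]_2), g q * g q = q 0 1 * q 0 1.
    by apply: filterS wE => q [_]; rewrite !expr2.
  have E := near_eq_pd 1 sq; near=> q.
  have gq : differentiable g q.
    by apply: analytic_differentiable; near: q; exact: analytic_near.
  have cq : differentiable (fun x : 'rV[R]_2 => x 0 1) q.
    by apply: analytic_differentiable; exact: analytic_coord.
  have : pd 1 (fun x => g x * g x) q = pd 1 (fun x : 'rV[R]_2 => x 0 1 * x 0 1) q.
    by near: q; exact: E.
  rewrite (pdM 1 gq gq) (pdM 1 cq cq) pd_coord2 eqxx mul1r mulr1 -/(d q) mulrC => H.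
  by clear -H; lra.
have dc : {for 0, continuous d} := analytic_continuous da.
have [dp|dn|/esym/eqP] := ltrgtP 0 (d 0); last by rewrite (negbTE d0).
  left; near=> q.
  have [q0 q2] : w q 0 0 = q 0 0 /\ w q 0 1 ^+ 2 = q 0 1 ^+ 2 by near: q; exact: wE.
  have gdq : g q * d q = q 0 1 by near: q; exact: gd.
  have dq : 0 < d q by near: q; exact: (cvgr_gt (d 0)).
  by rewrite -(pt2_eta (w q)) q0 (sign_choice q2 gdq dq) pt2_eta.
right; near=> q.
have [q0 q2] : w q 0 0 = q 0 0 /\ w q 0 1 ^+ 2 = q 0 1 ^+ 2 by near: q; exact: wE.
have gdq : g q * - d q = - q 0 1 by rewrite mulrN; congr (- _); near: q; exact: gd.
have dq : 0 < - d q by rewrite oppr_gt0; near: q; exact: (cvgr_lt (d 0)).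
rewrite -(sqrrN (q 0 1)) in q2.
by rewrite -(pt2_eta (w q)) q0 (sign_choice q2 gdq dq).
Unshelve. all: by end_near. Qed.

Lemma map_analytic_pt3 (a b c : 'rV[R]_2 -> R) p :
  analytic_at a p -> analytic_at b p -> analytic_at c p ->
  map_analytic_at (fun q => pt3 (a q) (b q) (c q)) p.
Proof.
move=> aa ba ca [[|[|[]]]//= j3].
- by rewrite (_ : (fun _ => _) = a)//; apply/funext => q; rewrite mxE.
- by rewrite (_ : (fun _ => _) = b)//; apply/funext => q; rewrite mxE.
- by rewrite (_ : (fun _ => _) = c)//; apply/funext => q; rewrite mxE.
Qed.

Lemma fold_model_analytic (a : 'rV[R]_2 -> R) q : analytic_at a q ->
  map_analytic_at (fun q : 'rV[R]_2 => pt3 (q 0 0) (q 0 1 ^+ 2) (q 0 1 ^+ 3 * a q)) q.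
Proof.
move=> aa; have ca := @analytic_coord R 2 1 q.
apply: map_analytic_pt3; first exact: analytic_coord.
  by rewrite (_ : (fun _ => _) = (fun q : 'rV[R]_2 => q 0 1 * q 0 1)); [exact: analyticM|].
apply: analyticM => //.
rewrite (_ : (fun _ => _) = (fun q : 'rV[R]_2 => q 0 1 * (q 0 1 * q 0 1))).
  by apply: analyticM => //; exact: analyticM.
by apply/funext => x; rewrite exprS expr2.
Qed.

(** Every component of the model is v^2 times an analytic function, up to a
    function of u. *)
Lemma fold_model_singular (a : 'rV[R]_2 -> R) q : analytic_at a q -> q 0 1 = 0 ->
  vpd 1 (fun q : 'rV[R]_2 => pt3 (q 0 0) (q 0 1 ^+ 2) (q 0 1 ^+ 3 * a q)) q = 0.
Proof.
move=> aa q1; have ca := @analytic_coord R 2 1 q.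
have dc := analytic_differentiable ca.
have ma := fold_model_analytic aa.
have zero (e : 'rV[R]_2 -> R) : analytic_at e q ->
    pd 1 (fun x : 'rV[R]_2 => x 0 1 * (x 0 1 * e x)) q = 0.
  move=> ea; have ce := analyticM ca ea.
  by rewrite (pdM 1 dc (analytic_differentiable ce)) q1 !mul0r mulr0 addr0.
apply/rowP => j; rewrite (pd_coord _ _ (map_analytic_differentiable ma)) mxE.
case: j => [[|[|[]]]//= j3].
- rewrite (_ : (fun _ => _) = (fun x : 'rV[R]_2 => x 0 0)) ?pd_coord2//.
  by apply/funext => x; rewrite mxE.
- rewrite (_ : (fun _ => _) = (fun x : 'rV[R]_2 => x 0 1 * (x 0 1 * 1))).
    by apply: zero; exact: analytic_cst.
  by apply/funext => x; rewrite mxE /= mulr1 expr2.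
- rewrite (_ : (fun _ => _) = (fun x : 'rV[R]_2 => x 0 1 * (x 0 1 * (x 0 1 * a x)))).
    by apply: zero; exact: analyticM.
  by apply/funext => x; rewrite mxE /= exprS expr2 !mulrA.
Qed.

End Rigidity.

(** * Self-equivalences in a normal chart *)

Section NormalChart.
Context {R : realType}.
Implicit Types (l : R) (f g h : 'rV[R]_2 -> 'rV[R]_3) (phi w : 'rV[R]_2 -> 'rV[R]_2).

(** The normal form (u, v^2, v^3 alpha) determines u and v^2, so a
    self-equivalence read in a normal chart preserves both and is the identity or
    the flip of v. *)
Lemma normal_chart_symmetry h phi p : map_analytic_at h p -> generalized_cuspidal_edge_point h p ->
  local_diffeo_at phi p -> phi p = p -> (\forall q \near p, h (phi q) = h q) ->
  exists sig, [/\ local_diffeo_at sig 0, sig 0 = p,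
    near_axis 0 (fun q => vpd 1 (fun x => h (sig x)) q = 0) &
    (\forall q \near p, phi q = q) \/
    (\forall q \near (0 : 'rV[R]_2), phi (sig q) = sig (vflip q))].
Proof.
move=> ha [alpha alphaa [sig [Phi [dsig dPhi sig0 _ model]]]] dphi phip hphi.
pose M (q : 'rV[R]_2) := pt3 (q 0 0) (q 0 1 ^+ 2) (q 0 1 ^+ 3 * alpha q).
have {}model : \forall q \near (0 : 'rV[R]_2), Phi (h (sig q)) = M q by exact: model.
exists sig; split=> //.
  have [_ [Psi [Psia PsiPhi _]]] := dPhi.
  have hsa : map_analytic_at (fun x => h (sig x)) 0.
    by apply: (@map_analytic_comp _ _ _ _ h sig); [rewrite sig0|exact: dsig.1].
  have hsc := map_analytic_continuous hsa.
  have hsE : nbhs (0 : 'rV[R]_2) [set q | Psi (Phi (h (sig q))) = h (sig q)].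
    by apply: (hsc [set y | Psi (Phi y) = y]); rewrite sig0; exact: PsiPhi.
  have hsM : \forall q \near (0 : 'rV[R]_2), h (sig q) = Psi (M q).
    by apply: filterS2 hsE model => q /= E ME; rewrite -E ME.
  have Ma : map_analytic_at M 0 by exact: fold_model_analytic.
  have M0 : M 0 = Phi (h p) by rewrite -(nbhs_singleton model) sig0.
  have Psi0 : map_analytic_at Psi (M 0) by rewrite M0.
  have Mc := map_analytic_continuous Ma.
  have near1 := near_eq_vpd 1 hsM; have nearPsi := map_analytic_near Psi0.
  rewrite /near_axis; near=> q => q1.
  have -> : vpd 1 (fun x => h (sig x)) q = vpd 1 (fun x => Psi (M x)) q.
    by near: q; exact: near1.
  have Psiq : map_analytic_at Psi (M q) by near: q; exact: Mc nearPsi.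
  have Mq : map_analytic_at M q by near: q; exact: map_analytic_near.
  rewrite (vpd_chain 1 (map_analytic_differentiable Psiq) (map_analytic_differentiable Mq)).
  have aq : analytic_at alpha q by near: q; exact: analytic_near.
  by rewrite (fold_model_singular aq q1) big1// => j _; rewrite mxE scale0r.
have [siga [psi [psia psisig sigpsi]]] := dsig.
rewrite sig0 in psia sigpsi.
have sigc := map_analytic_continuous siga; have psic := map_analytic_continuous psia.
have psip : psi p = 0 by rewrite -sig0 (nbhs_singleton psisig).
have dpsi : local_diffeo_at psi (phi (sig 0)).
  by rewrite sig0 phip; split => //; exists sig; rewrite psip.
have dphi' : local_diffeo_at phi (sig 0) by rewrite sig0.
pose w q := psi (phi (sig q)).
have dw : local_diffeo_at w 0.
  exact: (local_diffeo_comp (local_diffeo_comp dsig dphi') dpsi).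
have w0 : w 0 = 0 by rewrite /w sig0 phip psip.
have wc : {for 0, continuous w} := map_analytic_continuous dw.1.
have phisigc : {for 0, continuous (fun q => phi (sig q))}.
  exact: map_analytic_continuous (local_diffeo_comp dsig dphi').1.
have phisig : \forall q \near (0 : 'rV[R]_2), sig (w q) = phi (sig q).
  apply: (near_pull (P := fun x => sig (psi x) = x) phisigc).
  by rewrite sig0 phip.
have hw : \forall q \near (0 : 'rV[R]_2), M (w q) = M q.
  have m1 : nbhs (0 : 'rV[R]_2) [set q | Phi (h (sig (w q))) = M (w q)].
    by apply: (near_pull (P := fun x => Phi (h (sig x)) = M x) wc); rewrite w0.
  have h1 : nbhs (0 : 'rV[R]_2) [set q | h (phi (sig q)) = h (sig q)].
    by apply: (near_pull (P := fun x => h (phi x) = h x) sigc); rewrite sig0.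
  near=> q.
  have <- : Phi (h (sig (w q))) = M (w q) by near: q; exact: m1.
  have -> : sig (w q) = phi (sig q) by near: q; exact: phisig.
  have -> : h (phi (sig q)) = h (sig q) by near: q; exact: h1.
  by near: q; exact: model.
have wE : \forall q \near (0 : 'rV[R]_2), w q 0 0 = q 0 0 /\ w q 0 1 ^+ 2 = q 0 1 ^+ 2.
  apply: filterS hw => q E; split.
    by have := congr1 (fun x : 'rV[R]_3 => x 0 0) E; rewrite !mxE.
  by have := congr1 (fun x : 'rV[R]_3 => x 0 1) E; rewrite !mxE.
have [wid|wflip] := fold_symmetry dw.1 (local_diffeo_jdet dw) wE; [left|right].
  have w1 : nbhs p [set q | w (psi q) = psi q].
    by apply: (near_pull (P := fun x => w x = x) psic); rewrite psip.
  have s1 : nbhs p [set q | sig (w (psi q)) = phi (sig (psi q))].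
    by apply: (near_pull (P := fun x => sig (w x) = phi (sig x)) psic); rewrite psip.
  near=> q.
  have E1 : sig (psi q) = q by near: q; exact: sigpsi.
  rewrite -{1}E1.
  have <- : sig (w (psi q)) = phi (sig (psi q)) by near: q; exact: s1.
  have -> : w (psi q) = psi q by near: q; exact: w1.
  exact E1.
near=> q.
have <- : sig (w q) = phi (sig q) by near: q; exact: phisig.
by congr sig; near: q; exact: wflip.
Unshelve. all: by end_near. Qed.

End NormalChart.

(** * Rigidity of isometries that fix the axis *)

Section RigidityOnTheAxis.
Context {R : realType}.
Implicit Types (l : R) (f g h : 'rV[R]_2 -> 'rV[R]_3) (phi w : 'rV[R]_2 -> 'rV[R]_2).

(** The three directions span the space, as [gram_cross] shows for an
    orthonormal pair. *)
Lemma frame_orthogonal_eq0 (t n b w : 'rV[R]_3) (a r s k C : R) :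
  b = cross3 t n -> dot3 t t = 1 -> dot3 n n = 1 -> dot3 t n = 0 ->
  0 < r -> s != 0 -> k != 0 ->
  dot3 t w = 0 -> dot3 (k *: n) w = 0 ->
  dot3 (a *: t + r *: (C *: n - s *: b)) w = 0 -> w = 0.
Proof.
move=> bE tt nn tn r0 s0 k0 tw; rewrite dot3Zl => /eqP.
rewrite mulf_eq0 (negbTE k0) => /eqP nw.
rewrite dot3Dl dot3Zl tw mulr0 add0r dot3Zl dot3Dl dot3Zl nw mulr0 add0r dot3Nl dot3Zl mulrN => /eqP.
rewrite oppr_eq0 mulf_eq0 (gt_eqF r0) mulf_eq0 (negbTE s0) => /eqP bw.
apply: dot3_eq0; have := gram_cross w t n.
by rewrite tt nn tn -bE dot3C bw dot3C tw dot3C nw; rewrite !expr0n /= => H; lra.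
Qed.

Lemma vpd_comp_vflip (F : 'rV[R]_2 -> 'rV[R]_3) q i : differentiable F (vflip q) ->
  vpd i (fun x => F (vflip x)) q = (-1) ^+ (i == 1) *: vpd i F (vflip q).
Proof.
move=> dF; rewrite (vpd_chain i dF (map_analytic_differentiable (vflip_analytic _))) sum2.
by rewrite vpd_vflip pt2_0 pt2_1; case: (ord2P i) => -> /=;
  rewrite ?scale1r ?oppr0 ?scale0r ?addr0 ?add0r.
Qed.

Lemma flip_same_gram (F : 'rV[R]_2 -> 'rV[R]_3) : map_analytic_at F 0 ->
  nbhs (0 : 'rV[R]_2) (same_gram (fun x => F (vflip x)) F) ->
  \forall q \near (0 : 'rV[R]_2), forall i j : 'I_2,
    dot3 (vpd i F (vflip q)) (vpd j F (vflip q)) =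
    (-1) ^+ (i != j) * dot3 (vpd i F q) (vpd j F q).
Proof.
move=> Fa inv; have flip0 : vflip (0 : 'rV[R]_2) = 0 by apply: vflip_axis; rewrite mxE.
have flipc := map_analytic_continuous (vflip_analytic (0 : 'rV[R]_2)).
have nf : nbhs (0 : 'rV[R]_2) [set q | map_analytic_at F (vflip q)].
  apply: (near_pull (P := fun x => map_analytic_at F x) flipc).
  rewrite flip0; exact (map_analytic_near Fa).
apply: filterS2 inv nf => q /= G Fq i j.
have dF := map_analytic_differentiable Fq.
rewrite -(G i j) (vpd_comp_vflip i dF) (vpd_comp_vflip j dF) dot3Zl dot3Zr.
move: (dot3 _ _) => d; clear.
by case: (ord2P i) => ->; case: (ord2P j) => -> /=; rewrite !(expr0, expr1); ring.
Qed.

(** The normal form (u, v^2, v^3) has a cubic term that coordinate changes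
    keeping the transverse direction singular cannot cancel. *)
Lemma cuspidal_edge_cubic f p (sig : 'rV[R]_2 -> 'rV[R]_2) :
  map_analytic_at f p -> cuspidal_edge_point f p ->
  local_diffeo_at sig 0 -> sig 0 = p -> vpd 1 (fun x => f (sig x)) 0 = 0 ->
  vpd 1 (vpd 1 (vpd 1 (fun x => f (sig x)))) 0 <> 0.
Proof.
move=> fa [phi1 [Phi1 [d1 D1 p1 _ model]]] dsig sig0 F1.
have [phi1a [psi1 [psi1a psi1K phi1K]]] := d1.
rewrite p1 in psi1a phi1K.
have psi1p : psi1 p = 0 by rewrite -p1 (nbhs_singleton psi1K).
have dpsi1 : local_diffeo_at psi1 (sig 0).
  by rewrite sig0; split => //; exists phi1; rewrite psi1p.
have dchi := local_diffeo_comp dsig dpsi1.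
have chic : {for 0, continuous (fun q => psi1 (sig q))} := map_analytic_continuous dchi.1.
have sigc := map_analytic_continuous dsig.1.
have m1 : nbhs (0 : 'rV[R]_2) [set q | Phi1 (f (phi1 (psi1 (sig q)))) =
    pt3 (psi1 (sig q) 0 0) (psi1 (sig q) 0 1 ^+ 2) (psi1 (sig q) 0 1 ^+ 3)].
  apply: (near_pull (P := fun x => Phi1 (f (phi1 x)) = pt3 (x 0 0) (x 0 1 ^+ 2) (x 0 1 ^+ 3)) chic).
  rewrite sig0 psi1p; exact model.
have m2 : nbhs (0 : 'rV[R]_2) [set q | phi1 (psi1 (sig q)) = sig q].
  apply: (near_pull (P := fun x => phi1 (psi1 x) = x) sigc).
  rewrite sig0; exact phi1K.
apply: (@cuspidal_cubic_neq0 R (fun x => f (sig x)) (fun k y => Phi1 y 0 k)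
  (fun q => psi1 (sig q)) 0).
- by apply: (@map_analytic_comp _ _ _ _ f sig); [rewrite sig0|exact: dsig.1].
- by move=> j; rewrite sig0; exact: D1.1.
- exact: dchi.1.
- by rewrite sig0.
- exact: local_diffeo_jdet.
- by apply: filterS2 m1 m2 => q /= E1 E2; rewrite E2 in E1; rewrite E1 !mxE.
- exact F1.
Qed.

Lemma near_flip_gram f phi p (sig : 'rV[R]_2 -> 'rV[R]_2) :
  map_analytic_at f p -> map_analytic_at phi p -> phi p = p ->
  map_analytic_at sig 0 -> sig 0 = p ->
  (\forall q \near p,
    first_fundamental_form (fun x => f (phi x)) q = first_fundamental_form f q) ->
  (\forall q \near (0 : 'rV[R]_2), phi (sig q) = sig (vflip q)) ->
  nbhs (0 : 'rV[R]_2) (same_gram (fun x => f (sig (vflip x))) (fun x => f (sig x))).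
Proof.
move=> fa phia phip siga sig0 iso flip.
have flip0 : vflip (0 : 'rV[R]_2) = 0 by apply: vflip_axis; rewrite mxE.
have flipa := vflip_analytic (0 : 'rV[R]_2).
have Fa : map_analytic_at (fun x => f (sig x)) 0.
  by apply: (@map_analytic_comp _ _ _ _ f sig); rewrite ?sig0.
have Fflipa : map_analytic_at (fun x => f (sig (vflip x))) 0.
  by apply: (@map_analytic_comp _ _ _ _ (fun x => f (sig x)) vflip); rewrite ?flip0.
have fphia : map_analytic_at (fun q => f (phi q)) p.
  by apply: (@map_analytic_comp _ _ _ _ f phi); rewrite ?phip.
rewrite -sig0 in fphia fa iso.
have E1 := near_fff_comp fphia fa siga iso.
have E2 : \forall q \near (0 : 'rV[R]_2), f (sig (vflip q)) = f (phi (sig q)).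
  by apply: filterS flip => q E; rewrite E.
have E3 := near_eq_fff Fflipa E2.
apply: (near_same_gram Fflipa Fa).
apply: filterS2 E1 E3 => q e1 e3; exact (etrans e3 e1).
Qed.

(** If the flip of a singular coordinate system is an isometry, the cubic term of
    the map is orthogonal to everything of lower order, hence zero. *)
Lemma flip_not_isometry l c f theta u (sig : 'rV[R]_2 -> 'rV[R]_2) :
  0 < l -> arclength_embedding l c -> Gomega l c f -> cuspidal_angle l f theta ->
  u \in `[- l, l] -> sin (theta u) != 0 -> cuspidal_edge_point f (pt2 u 0) ->
  local_diffeo_at sig 0 -> sig 0 = pt2 u 0 ->
  near_axis 0 (fun q => vpd 1 (fun x => f (sig x)) q = 0) ->
  nbhs (0 : 'rV[R]_2) (same_gram (fun x => f (sig (vflip x))) (fun x => f (sig x))) ->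
  False.
Proof.
move=> l0 ce Gf /cuspidal_angleP[_ _ [ph [xi [chart frame]]]] uJ s0 edge dsig sig0 S1 inv.
have fa := Gomega_analytic Gf (Jseg_pt2 uJ).
have q01 : (0 : 'rV[R]_2) 0 1 = 0 by rewrite mxE.
pose F x := f (sig x).
have Fa : map_analytic_at F 0.
  by apply: (@map_analytic_comp _ _ _ _ f sig); [rewrite sig0|exact: dsig.1].
have [c1 c2 c3] := vflip_invariant_cubic Fa q01 S1 (flip_same_gram Fa inv).
have [a [b [x1 [x2 [b0 x10 Evv Eu Euu]]]]] :=
  chart_transfer l0 ce Gf chart uJ (frame u uJ) dsig sig0 q01 S1.
have [t1 t2] := axis_unit l0 ce Gf uJ.
have [[k0 kE] [bE nn tn] _ [a1 [r1 [r10 xE]]]] := angle_frameP t1 t2 (frame u uJ).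
rewrite kE in Euu; rewrite xE in Evv.
have F3 := cuspidal_edge_cubic fa edge dsig sig0 (near_axis_at S1 q01).
clear - t1 bE nn tn k0 Evv Eu Euu c1 c2 c3 F3 x10 b0 r10 s0.
move: F3 c1 c2 c3; rewrite -/F Evv Eu Euu => F3 c1 c2 c3; apply: F3.
move: (vpd 1 (vpd 1 (vpd 1 F)) 0) c1 c2 c3 => w c1 c2 c3.
move: (principal_normal _ u) (binormal _ u) (curvature _ u) bE nn tn k0 c1 c2 c3 {Evv Eu Euu}.
move: (vpd 0 f (pt2 u 0)) t1 => t t1 n bi k bE nn tn k0 c1 c2 c3.
have tF : dot3 t w = 0.
  by move: c1; rewrite dot3Zl => /eqP; rewrite mulf_eq0 (negbTE x10) => /eqP.
have nF : dot3 (k *: n) w = 0.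
  move: c3; rewrite dot3Dl dot3Zl tF mulr0 add0r dot3Zl => /eqP.
  by rewrite mulf_eq0 expf_eq0 (negbTE x10) => /eqP.
have xF : dot3 (a1 *: t + r1 *: (cos (theta u) *: n - sin (theta u) *: bi)) w = 0.
  move: c2; rewrite dot3Dl dot3Zl tF mulr0 add0r dot3Zl => /eqP.
  by rewrite mulf_eq0 (gt_eqF b0) => /eqP.
exact: (frame_orthogonal_eq0 bE t1 nn tn r10 s0 (lt0r_neq0 k0) tF nF xF).
Qed.

(** Where [phi] is not locally the identity, a normal chart of [h] turns it into
    the flip of v; it preserves the form of [f] as well, which
    [flip_not_isometry] excludes. The two maps share the singular directions
    because they have the same form. *)
Lemma isometry_rigid l c f h phi theta :
  0 < l -> arclength_embedding l c -> Gomega l c f -> Gomega l c h ->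
  cuspidal_angle l f theta -> (forall u, u \in `[- l, l] -> sin (theta u) != 0) ->
  (forall p, Jseg l p -> cuspidal_edge_point f p) ->
  same_first_fundamental_form l h f ->
  Jdiffeo l phi -> (forall u, u \in `[- l, l] -> phi (pt2 u 0) = pt2 u 0) ->
  same_first_fundamental_form l (fun q => f (phi q)) f ->
  germ_eq l (fun q => h (phi q)) h -> germ_eq l phi id.
Proof.
move=> l0 ce Gf Gh ang s0 edge hf dphi phiJ iso hphi; apply/germ_eqP => p Jp.
have [u uJ pE] := Jp; rewrite -{}pE in Jp *.
have ha := Gomega_analytic Gh Jp; have fa := Gomega_analytic Gf Jp.
have [_ genc _] := Gh.
have dphip := Jdiffeo_local_diffeo dphi Jp.
have hphi' : \forall q \near pt2 u 0, h (phi q) = h q by move/germ_eqP: hphi; exact.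
have [sig [dsig sig0 S1 [//|flip]]] :=
  normal_chart_symmetry ha (genc _ Jp) dphip (phiJ u uJ) hphi'.
have hfp : \forall q \near pt2 u 0, first_fundamental_form h q = first_fundamental_form f q.
  have /germ_eqP H := hf; exact (H _ Jp).
have isop : \forall q \near pt2 u 0,
    first_fundamental_form (fun x => f (phi x)) q = first_fundamental_form f q.
  have /germ_eqP H := iso; exact (H _ Jp).
have Fa : map_analytic_at (fun x => f (sig x)) 0.
  by apply: (@map_analytic_comp _ _ _ _ f sig); [rewrite sig0|exact: dsig.1].
have Ha : map_analytic_at (fun x => h (sig x)) 0.
  by apply: (@map_analytic_comp _ _ _ _ h sig); [rewrite sig0|exact: dsig.1].
rewrite -sig0 in ha fa hfp.
have G := near_same_gram Ha Fa (near_fff_comp ha fa dsig.1 hfp).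
have S2 := same_gram_singular G S1.
rewrite sig0 in fa.
have inv := near_flip_gram fa dphip.1 (phiJ u uJ) dsig.1 sig0 isop flip.
case: (flip_not_isometry l0 ce Gf ang uJ (s0 u uJ) (edge _ Jp) dsig sig0 S2 inv).
Qed.

End RigidityOnTheAxis.

(** * Cuspidal angles of germs *)

Section AnglesAndGerms.
Context {R : realType}.
Implicit Types (l : R) (f g h : 'rV[R]_2 -> 'rV[R]_3) (phi : 'rV[R]_2 -> 'rV[R]_2).
Implicit Types th theta : R -> R.

Lemma mem0J l : 0 < l -> (0 : R) \in `[- l, l].
Proof. by move=> l0; rewrite in_itv /= oppr_le0 !ltW. Qed.

Lemma cuspidal_angle_ext l f th1 th2 : 0 < l ->
  {in `[- l, l], th1 =1 th2} -> (forall u, u \in `[- l, l] -> fun_analytic_at th2 u) ->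
  cuspidal_angle l f th1 -> cuspidal_angle l f th2.
Proof.
move=> l0 E th2a /cuspidal_angleP[_ r1 [phi [xi [chart frame]]]].
apply/cuspidal_angleP; split => //; first by rewrite -E// mem0J.
by exists phi, xi; split => // u uJ; rewrite -E//; exact: frame.
Qed.

Lemma axis_curve_germ l f g u : germ_eq l f g -> u \in `[- l, l] ->
  [/\ f (pt2 u 0) = g (pt2 u 0),
      derive1 (axis_curve f) u = derive1 (axis_curve g) u &
      derive1 (derive1 (axis_curve f)) u = derive1 (derive1 (axis_curve g)) u].
Proof.
move=> /germ_eqP fg uJ; have E := fg _ (Jseg_pt2 uJ).
rewrite !derive1_axis_curve2 !derive1_axis_curve; split.
- exact: (nbhs_singleton E).
- exact: (nbhs_singleton (near_eq_vpd 0 E)).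
- exact: (nbhs_singleton (near_eq_vpd 0 (near_eq_vpd 0 E))).
Qed.

(** A chart of one map is a chart of the other, as the axes agree near every
    point of J, including beyond the end points. *)
Lemma cuspidal_angle_germ l f g th : germ_eq l f g -> cuspidal_angle l f th ->
  cuspidal_angle l g th.
Proof.
move=> fg /cuspidal_angleP[ta r1 [phi [xi [[dphi phiJ xia chart] frame]]]].
apply/cuspidal_angleP; split => //; exists phi, xi; split => [|u uJ].
  split => //; apply/near_JnearP => p Jp.
  have c1 : nbhs p [set q | f (phi q) = axis_curve f (q 0 0) + (q 0 1 ^+ 2 / 2) *: xi q].
    exact (chart _ Jp).
  have c2 : nbhs p [set q | f (phi q) = g (phi q)].
    by have /germ_eqP := germ_eq_comp dphi fg; exact.
  have c3 : nbhs p [set q : 'rV[R]_2 | f (pt2 (q 0 0) 0) = g (pt2 (q 0 0) 0)].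
    have pa : map_analytic_at (fun q : 'rV[R]_2 => pt2 (q 0 0) 0) p.
      by apply: map_analytic_pt2; [exact: analytic_coord|exact: analytic_cst].
    apply: (near_pull (P := fun x => f x = g x) (map_analytic_continuous pa)).
    have -> : pt2 (p 0 0) 0 = p by rewrite -{2}(pt2_eta p) (Jseg_axis Jp).
    by move/germ_eqP: fg; exact.
  by apply: filterS3 c1 c2 c3 => q /= E1 E2 E3; rewrite -E2 E1 /axis_curve E3.
have [_ d1 d2] := axis_curve_germ fg uJ.
have := frame u uJ.
by rewrite /angle_frame /binormal /principal_normal /curvature d1 d2.
Qed.

Lemma sin_angle_neq0 (t : R) : 0 < `|t| < pi -> sin t != 0.
Proof.
move=> tp; have := sin_gt0_pi tp.
have [t0|t0] := lerP 0 t; first by rewrite ger0_norm// => /lt0r_neq0.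
by rewrite ltr0_norm// sinN oppr_gt0 => /ltr0_neq0.
Qed.

(** The angle is an invariant of the germ. *)
Lemma opposite_angles_distinct l c f g th : 0 < l -> arclength_embedding l c ->
  Gomega l c g -> cuspidal_angle l f th -> cuspidal_angle l g (fun u => - th u) ->
  sin (th 0) != 0 -> ~ germ_eq l f g.
Proof.
move=> l0 ce Gg af ag s0 fg.
have [_] := angle_unique l0 ce Gg (cuspidal_angle_germ fg af) ag (mem0J l0).
by rewrite sinN => /eqP; rewrite -addr_eq0 -mulr2n mulrn_eq0 (negbTE s0).
Qed.

(** The axes run in opposite directions, and the two ends of C are distinct. *)
Lemma opposite_axes_distinct l c f g e : 0 < l -> arclength_embedding l c -> e ^+ 2 = 1 ->
  (forall u, u \in `[- l, l] -> f (pt2 u 0) = c (e * u)) ->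
  (forall u, u \in `[- l, l] -> g (pt2 u 0) = c (e * - u)) -> ~ germ_eq l f g.
Proof.
move=> l0 [_ cinj _ _ _] e2 fc gc fg.
have lJ : l \in `[- l, l] by rewrite in_itv /=; apply/andP; split; lra.
have [E _ _] := axis_curve_germ fg lJ.
have E' : c (e * l) = c (e * - l) by rewrite -fc// -gc.
have lJ' : - l \in `[- l, l] by rewrite in_itv /=; apply/andP; split; lra.
have := cinj _ _ (mem_J_scale e2 lJ) (mem_J_scale e2 lJ') E'.
move=> H; have e0 : e != 0 by apply: contraTneq (oner_neq0 R) => e0; rewrite -e2 e0 expr0n eqxx.
by move: (mulfI e0 H) => /eqP; rewrite -addr_eq0 -mulr2n mulrn_eq0 (gt_eqF l0).
Qed.

Lemma fun_analytic_continuous th u : fun_analytic_at th u -> {for u, continuous th}.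
Proof.
move=> ta; have tc := analytic_continuous ta.
have -> : th = (fun x : 'rV[R]_1 => th (x 0 0)) \o (fun w : R => w *: const_mx 1).
  by apply/funext => w /=; rewrite !mxE mulr1.
apply: continuous_comp; first exact: scalel_continuous.
rewrite (_ : u *: const_mx 1 = const_mx u)//.
by apply/matrixP => i j; rewrite !mxE mulr1.
Qed.

(** Intermediate value theorem. *)
Lemma same_sign l th : (forall u, u \in `[- l, l] -> fun_analytic_at th u) ->
  (forall u, u \in `[- l, l] -> th u != 0) ->
  forall a b, a \in `[- l, l] -> b \in `[- l, l] -> 0 < th a * th b.
Proof.
move=> ta th0.
suff wl a b : a \in `[- l, l] -> b \in `[- l, l] -> a <= b -> 0 < th a * th b.
  by move=> a b aJ bJ; have [ab|/ltW ba] := lerP a b; [|rewrite mulrC]; exact: wl.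
move=> aJ bJ ab; rewrite ltNge; apply/negP => neg.
have sub x : x \in `[a, b] -> x \in `[- l, l].
  move: aJ bJ; rewrite !in_itv /= => /andP[h1 _] /andP[_ h4] /andP[h5 h6].
  by rewrite (le_trans h1 h5) (le_trans h6 h4).
have thc : {within `[a, b], continuous th}.
  apply: continuous_in_subspaceT => x /set_mem xab; apply: fun_analytic_continuous.
  by apply: ta; apply: sub.
have [|x xab /eqP] := IVT (v := 0) ab thc; last by rewrite (negbTE (th0 _ (sub x xab))).
have [a0|a0] := lerP 0 (th a); have [b0|b0] := lerP 0 (th b).
- have a1 : 0 < th a by rewrite lt_neqAle eq_sym th0.
  have b1 : 0 < th b by rewrite lt_neqAle eq_sym th0.
  by move: neg; rewrite leNgt mulr_gt0.
- by rewrite ge_min le_max a0 (ltW b0) orbT.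
- by rewrite ge_min le_max b0 (ltW a0) orbT.
- by move: neg; rewrite leNgt nmulr_rgt0// b0.
Qed.

(** The cosine is injective on (0, pi) and on (-pi, 0). *)
Lemma angle_determined (s t : R) : 0 < `|s| < pi -> 0 < `|t| < pi -> 0 < s * t ->
  cos s = cos t -> s = t.
Proof.
wlog s0 : s t / 0 < s => [H sp tp st E|].
  have [s0|s0] := ltrP 0 s; first exact: H.
  have s0' : 0 < - s by rewrite oppr_gt0 lt_neqAle s0 -normr_gt0 andbT; case/andP: sp.
  apply: oppr_inj; apply: H => //; rewrite ?normrN ?mulrNN ?cosN//.
move=> /andP[_ sp] /andP[_ tp]; rewrite (pmulr_rgt0 _ s0) => t0 E.
rewrite gtr0_norm// in sp; rewrite gtr0_norm// in tp.
by apply: (@cos_inj R) => //; rewrite in_itv /= ?ltW.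
Qed.

End AnglesAndGerms.

(** * The dual, the inverse and their right equivalences *)

Section FourMaps.
Context {R : realType}.
Implicit Types (l : R) (f g h : 'rV[R]_2 -> 'rV[R]_3) (phi : 'rV[R]_2 -> 'rV[R]_2).

(** Being an isometry depends on the form only, which the two maps share. *)
Lemma isometry_transfer l c f g phi : Gomega l c f -> Gomega l c g ->
  same_first_fundamental_form l g f -> Jdiffeo l phi ->
  same_first_fundamental_form l (fun q => f (phi q)) f ->
  same_first_fundamental_form l (fun q => g (phi q)) g.
Proof.
move=> Gf Gg gf dphi /(germ_isometry Gf dphi) /germ_eqP iso.
apply/(germ_isometry Gg dphi)/germ_eqP => p Jp.
have /germ_eqP gf1 := gf; have /germ_eqP gf2 := germ_eq_comp dphi gf.
have E1 := gf1 _ Jp; have E2 := gf2 _ Jp; have E3 := iso _ Jp.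
apply: filterS3 E1 E2 E3 => q e1 e2 e3.
refine (etrans _ (etrans e3 (esym e1))).
exact (congr1 (fun w => 'J phi q *m w *m ('J phi q)^T) e2).
Qed.

(** Pulling back by [phi] turns the form of [g] into that of [h]. *)
Lemma equivalence_isometry l c g h phi : Gomega l c g -> same_first_fundamental_form l h g ->
  Jdiffeo l phi -> germ_eq l h (fun q => g (phi q)) ->
  same_first_fundamental_form l (fun q => g (phi q)) g.
Proof.
move=> Gg hg dphi E; apply/germ_eqP => p Jp.
have [psi dpsi] := Jdiffeo_local dphi; have [phia _ _ _ [Jphi _]] := dpsi _ Jp.
have ga : map_analytic_at (fun q => g (phi q)) p.
  by apply: (@map_analytic_comp _ _ _ _ g phi) => //; exact: Gomega_analytic Gg Jphi.
have /germ_eqP E1 := germ_eq_sym E; have E2 := near_eq_fff ga (E1 _ Jp).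
have /germ_eqP H := hg; have E3 := H _ Jp.
apply: filterS2 E2 E3 => q e2 e3; exact (etrans e2 e3).
Qed.

(** A right equivalence is an isometry, hence trivial, and then the germs are
    equal. *)
Lemma asymmetric_classes_neq l c f g h : Gomega l c f -> Gomega l c g ->
  same_first_fundamental_form l g f -> same_first_fundamental_form l h f ->
  ~ (exists phi, form_symmetry l f phi) -> ~ germ_eq l g h ->
  right_class l g <> right_class l h.
Proof.
move=> Gf Gg gf hf nosym ngh /right_class_eqP[phi dphi E].
have fg : same_first_fundamental_form l f g by exact (germ_eq_sym gf).
have hg : same_first_fundamental_form l h g by exact (germ_eq_trans hf fg).
have isog := equivalence_isometry Gg hg dphi E.
have isof := isometry_transfer Gg Gf fg dphi isog.
have [triv|ntriv] := pselect (germ_eq l phi id).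
  apply: ngh; apply/germ_eqP => p Jp.
  have /germ_eqP E1 := E; have /germ_eqP E2 := triv.
  by apply: filterS2 (E1 _ Jp) (E2 _ Jp) => q e1 e2; rewrite e1 /= e2.
apply: nosym; exists phi; split; [exact dphi|exact ntriv|].
exact ((germ_isometry Gf dphi).2 isof).
Qed.

Lemma dual_spec l c f g : isometric_dual l c f g ->
  [/\ Gomega l c g, same_first_fundamental_form l g f,
    (forall u, u \in `[- l, l] -> g (pt2 u 0) = f (pt2 u 0)) &
    exists2 theta, cuspidal_angle l f theta & cuspidal_angle l g (fun u => - theta u)].
Proof. by move=> [[[Gg _] gf ax ang] _]. Qed.

(** By uniqueness of the dual, a symmetry of the form that fixes the axis carries
    the dual to itself. *)
Lemma dual_invariant l c f g phi : 0 < l -> isometric_dual l c f g -> Gomega l c f ->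
  Jdiffeo l phi -> (forall u, u \in `[- l, l] -> phi (pt2 u 0) = pt2 u 0) ->
  same_first_fundamental_form l (fun q => f (phi q)) f ->
  germ_eq l (fun q => g (phi q)) g.
Proof.
move=> l0 [[[Gg [ta tang tsup]] gf ax [theta af ag]] uniq] Gf dphi phiJ iso.
have isog := isometry_transfer Gf Gg gf dphi iso.
have e1 : (1 : R) ^+ 2 = 1 by rewrite expr1n.
have phiJ1 u : u \in `[- l, l] -> phi (pt2 u 0) = pt2 (1 * u) 0.
  by move=> uJ; rewrite mul1r phiJ.
have range th : cuspidal_angle l g th -> - pi < 1 * th 0 <= pi.
  by case=> _ r _; rewrite mul1r.
have ag1 := cuspidal_angle_reparam l0 e1 Gg dphi phiJ1 ag (range _ ag).
apply: uniq; split.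
- exact (Gadmissible_reparam l0 e1 Gg tang tsup (range _ tang) dphi phiJ1 isog).
- exact (germ_eq_trans isog gf).
- by move=> u uJ; rewrite phiJ// ax.
- exists theta; first exact af.
  move: ag1; congr (cuspidal_angle l _ _); apply/funext => u.
  by rewrite !mul1r.
Qed.

(** A symmetry of the form that reverses the axis turns the map into the dual of
    its inverse: the singular curvature determines the cosine of the angle, and
    the angle keeps its sign along J. *)
Lemma reversed_inverse_dual l c f f_inv f_invdual phi :
  0 < l -> arclength_embedding l c -> Gadmissible l c f ->
  inverse_map l c f f_inv -> isometric_dual l c f_inv f_invdual ->
  Jdiffeo l phi -> (forall u, u \in `[- l, l] -> phi (pt2 u 0) = pt2 (-1 * u) 0) ->
  same_first_fundamental_form l (fun q => f (phi q)) f ->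
  germ_eq l (fun q => f (phi q)) f_invdual.
Proof.
move=> l0 ce [Gf [ta tang tsup]] [[_ invf inva [theta [theta' [af ai th]]]] _] [_ uniq] dphi phiJ iso.
have e2 : (-1 : R) ^+ 2 = 1 by rewrite sqrrN expr1n.
have oJ := mem0J l0; have [th0 _ _ _] := th _ oJ.
have thn0 u : u \in `[- l, l] -> theta u != 0.
  by move=> uJ; have [/andP[h _] _ _ _] := th u uJ; rewrite -normr_gt0.
have tha u : u \in `[- l, l] -> fun_analytic_at theta u by case: af => H _ _; exact: H.
have range : - pi < -1 * theta 0 <= pi.
  move: th0 => /andP[_]; rewrite ltr_norml => /andP[h1 h2].
  by rewrite mulN1r ltrN2 h2 /= lerNl ltW.
(* The angle ta, given with admissibility, may differ from theta, but its sine
   does not vanish either, which excludes the value pi. *)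
have rangea : - pi < -1 * ta 0 <= pi.
  have [_ /andP[h1 h2] _] := tang.
  have [_ sE] := angle_unique l0 ce Gf tang af oJ.
  rewrite mulN1r ltrN2 lerNl (ltW h1) andbT lt_neqAle h2 andbT.
  apply: contraTneq (sin_angle_neq0 th0) => E; by rewrite -sE E sinpi eqxx.
have kpos u : u \in `[- l, l] -> 0 < curvature (axis_curve f) u.
  move=> uJ; have /cuspidal_angleP[_ _ [ph [xi [_ frame]]]] := af.
  have [t1 t2] := axis_unit l0 ce Gf uJ.
  by have [[]] := angle_frameP t1 t2 (frame u uJ).
have angE u : u \in `[- l, l] -> theta' u = theta (- u).
  move=> uJ; have uJ' : - u \in `[- l, l] by rewrite -mulN1r; exact: mem_J_scale.
  have [t1 t2 ct tt] := th u uJ; have [t3 _ _ _] := th _ uJ'.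
  apply: angle_determined => //.
    have := same_sign tha thn0 uJ uJ' => pos.
    have : 0 < (theta' u * theta u) * (theta u * theta (- u)) by rewrite mulr_gt0.
    have -> : theta' u * theta u * (theta u * theta (- u)) =
      theta u ^+ 2 * (theta' u * theta (- u)) by ring.
    by rewrite pmulr_rgt0// exprn_even_gt0// thn0.
  rewrite ct (singular_curvature_reversed l0 ce Gf af dphi phiJ iso uJ) mulN1r.
  rewrite /singular_curvature; move: (curvature _ _) (kpos _ uJ') => k k0.
  by rewrite mulrC mulKf// lt0r_neq0.
have ag1 := cuspidal_angle_reparam l0 e2 Gf dphi phiJ af range.
apply: uniq; split.
- exact (Gadmissible_reparam l0 e2 Gf tang tsup rangea dphi phiJ iso).
- have fi : same_first_fundamental_form l f f_inv by exact (germ_eq_sym invf).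
  exact (germ_eq_trans iso fi).
- by move=> u uJ; rewrite inva// phiJ// mulN1r.
- exists theta'; first exact ai.
  apply: (cuspidal_angle_ext l0 _ _ ag1) => u uJ.
    by rewrite !mulN1r angE.
  have [ta' _ _] := ai; rewrite /fun_analytic_at.
  rewrite (_ : (fun x => - _) = (fun x : 'rV[R]_1 => -1 * theta' (x 0 0))).
    by apply: analyticM; [exact: analytic_cst|exact: ta'].
  by apply/funext => x; rewrite mulN1r.
Qed.

End FourMaps.

(** * Counting the classes *)

Section Counting.
Context {T U : Type}.

Lemma set4_image (F : T -> U) (a b c d : T) :
  [set F x | x in [set a; b; c; d]] =
  [set nth (F a) [:: F a; F b; F c; F d] i | i in `I_4].
Proof.
apply/seteqP; split => [_ [x /= [[[->|->]|->]|->] <-]|_ [[|[|[|[|]]]]//= _ <-]].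
- by exists 0%N.
- by exists 1%N.
- by exists 2%N.
- by exists 3%N.
- by exists a => //; left; left; left.
- by exists b => //; left; left; right.
- by exists c => //; left; right.
- by exists d => //; right.
Qed.

Lemma card_image4 (F : T -> U) (a b c d : T) :
  [/\ F a <> F b, F a <> F c & F a <> F d] -> [/\ F b <> F c, F b <> F d & F c <> F d] ->
  ([set F x | x in [set a; b; c; d]] #= `I_4)%card.
Proof.
move=> [ab ac ad] [bc bd cd]; rewrite set4_image; apply: inj_card_eq.
move=> [|[|[|[|i]]]] [|[|[|[|j]]]] /set_mem/= i4 /set_mem/= j4 //= E; exfalso;
  by [exact: ab|exact: ac|exact: ad|exact: bc|exact: bd|exact: cd
     |exact: ab (esym E)|exact: ac (esym E)|exact: ad (esym E)
     |exact: bc (esym E)|exact: bd (esym E)|exact: cd (esym E)].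
Qed.

Lemma card_image4_lt (F : T -> U) (a b c d : T) : F a = F d ->
  ~ ([set F x | x in [set a; b; c; d]] #= `I_4)%card.
Proof.
move=> ad /card_eqPle[_ le4].
have sub : [set F x | x in [set a; b; c; d]] `<=`
    [set nth (F a) [:: F a; F b; F c] i | i in `I_3].
  move=> _ [x /= [[[->|->]|->]|->] <-].
  - by exists 0%N.
  - by exists 1%N.
  - by exists 2%N.
  - by exists 0%N.
have := card_le_trans le4 (card_le_trans (subset_card_le sub) (card_image_le _ _)).
by rewrite card_le_II.
Qed.

End Counting.

Theorem mainTheorem3 (R : realType) (l : R) (c : R -> 'rV[R]_3)
    (f f_dual f_inv f_invdual : 'rV[R]_2 -> 'rV[R]_3) :
  0 < l ->
  arclength_embedding l c ->
  Gadmissible32 l c f ->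
  isometric_dual l c f f_dual ->
  inverse_map l c f f_inv ->
  isometric_dual l c f_inv f_invdual ->
  ([set right_class l g | g in [set f; f_dual; f_inv; f_invdual]] #= `I_4)%card
  <-> ~ exists phi : 'rV[R]_2 -> 'rV[R]_2, form_symmetry l f phi.
Proof.
move=> l0 ce [adm edge] dual inv invdual.
have [Gf _] := adm.
have [Gd df da [thd afd add]] := dual_spec dual.
have [Gid idf ida [thi aii aid]] := dual_spec invdual.
have [[[Gi _] invf inva [theta [theta' [af ai th]]]] _] := inv.
have oJ := mem0J l0.
have sth u : u \in `[- l, l] -> sin (theta u) != 0.
  by move=> uJ; have [h _ _ _] := th u uJ; exact: sin_angle_neq0.
split=> [card4 [phi [dphi nontriv /(germ_isometry Gf dphi) iso]]|nosym].
  have [e [->|->] phiJ] := isometry_axis l0 ce Gf dphi iso.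
    have phiJ1 u : u \in `[- l, l] -> phi (pt2 u 0) = pt2 u 0.
      by move=> uJ; rewrite phiJ// mul1r.
    apply: nontriv.
    exact: (isometry_rigid l0 ce Gf Gd af sth edge df dphi phiJ1 iso
      (dual_invariant l0 dual Gf dphi phiJ1 iso)).
  apply: (card_image4_lt _ card4); apply/right_class_eqP; exists phi => //.
  exact: germ_eq_sym (reversed_inverse_dual l0 ce adm inv invdual dphi phiJ iso).
have idf' : same_first_fundamental_form l f_invdual f by exact (germ_eq_trans idf invf).
have ff : same_first_fundamental_form l f f by apply/germ_eqP => p _; exact: filterE.
have sd : sin (thd 0) != 0.
  by have [_ ->] := angle_unique l0 ce Gf afd af oJ; exact: sth.
have si : sin (thi 0) != 0.
  have [_ ->] := angle_unique l0 ce Gi aii ai oJ; have [_ h _ _] := th _ oJ.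
  exact: sin_angle_neq0.
have [e e2 fc] := Gomega_orient Gf.
have nJ u : u \in `[- l, l] -> - u \in `[- l, l].
  by move=> uJ; rewrite -mulN1r; apply: mem_J_scale => //; rewrite sqrrN expr1n.
have dc u : u \in `[- l, l] -> f_dual (pt2 u 0) = c (e * u) by move=> uJ; rewrite da// fc.
have ic u : u \in `[- l, l] -> f_inv (pt2 u 0) = c (e * - u).
  by move=> uJ; rewrite inva// fc// nJ.
have idc u : u \in `[- l, l] -> f_invdual (pt2 u 0) = c (e * - u) by move=> uJ; rewrite ida// ic.
apply: card_image4; split.
- exact: (asymmetric_classes_neq Gf Gf ff df nosym (opposite_angles_distinct l0 ce Gd afd add sd)).
- exact: (asymmetric_classes_neq Gf Gf ff invf nosym (opposite_axes_distinct l0 ce e2 fc ic)).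
- exact: (asymmetric_classes_neq Gf Gf ff idf' nosym (opposite_axes_distinct l0 ce e2 fc idc)).
- exact: (asymmetric_classes_neq Gf Gd df invf nosym (opposite_axes_distinct l0 ce e2 dc ic)).
- exact: (asymmetric_classes_neq Gf Gd df idf' nosym (opposite_axes_distinct l0 ce e2 dc idc)).
- exact: (asymmetric_classes_neq Gf Gi invf idf' nosym (opposite_angles_distinct l0 ce Gid aii aid si)).
Qed.
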